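(* Let $n\ge 1$ and let $h_i:\mathbb{R}^{n-i}\to\mathbb{R}$ ($i=1,\dots,n-1$) be $C^2$ functions for which there is $M>0$ with $|h_i(X_{i+1})|\le M|X_{i+1}|^2$ whenever $|X_{i+1}|_\infty\le 1$. Consider the feedforward system $$\dot x(t)=f(x(t),u(t)),\qquad f(x,u)=\big(x_2+h_1(X_2),\ \dots,\ x_n+h_{n-1}(X_n),\ u\big)^T .$$ Let $\bar\ell\in\mathbb{R}^n_+$, $\theta>0$ and $\hat R>0$ be arbitrary. Suppose the parameters $\varepsilon_1,\dots,\varepsilon_n$, $\kappa\ge 1$, $L$ of the controller $\alpha$ (defined in the context) satisfy $$1=30\varepsilon_n=30^2\varepsilon_{n-1}=\dots=30^n\varepsilon_1,$$ $$\kappa\ge\theta\max\left\{6\cdot 30^{n+1}n(n+1),\ 8n^2\big(8n(1+n^2)^{n-1}+1\big)^2\right\},$$ $$0<L\le\min\left\{\frac{\kappa}{20\cdot 30^n n^4(n!)^3},\ \frac{\kappa}{8(1+n^2)^{n-1}\sqrt n\,n^3(n!)^3},\ \frac{M\kappa}{(n+1)!},\ M\right\}.$$ Then the system is semi-globally asymptotically and locally exponentially stabilizable using an average data rate arbitrarily close to the infimal one. That is, there exist a Schur stable $n\times n$ matrix $\Lambda$ and a strictly increasing sequence of transmission times $\{t_k\}_{k\in\mathbb{Z}_+}$ with $T_m\le t_{k+1}-t_k\le T_M$ for some positive constants $T_m,T_M$, such that the closed-loop system formed by the process, the controller $u(t)=\alpha(\psi(t))$, the encoder and the decoder described in the context,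 with state $X=(x,\omega,\xi,\ell,\psi,\nu)$, with initial conditions $|x_i(t_0)|\le\bar\ell_i$ ($i=1,\dots,n$) for the process and the prescribed initial conditions for the encoder and decoder, has the following properties: (i) there exist a compact set $C$ containing the origin and $T>0$ such that $X(t)\in C$ for all $t\ge T$; (ii) for some positive real numbers $k,\delta$, $|X(t)|\le k\|X_T\|\exp(-\delta(t-T))$ for all $t\ge T$; (iii) $R_{av}<\hat R$.
   Context: Notation. $X_i=(x_i,\dots,x_n)$; $|\cdot|$ is the Euclidean norm and $|\cdot|_\infty$ the max norm; $\|X_t\|=\sup_{-2\theta\le\varsigma\le 0}|X(t+\varsigma)|$; $X(t^+)$ is the right limit, while the value at a jump time is the value before the jump. $\mathrm{sgn}(s)=1,0,-1$ for $s>0$, $s=0$, $s<0$, and acts componentwise on vectors; $\mathrm{diag}(v)$ is the diagonal matrix with diagonal $v$; $\mathbf 0_n$ is the zero vector of $\mathbb{R}^n$. A matrix is Schur stable if all its eigenvalues lie strictly inside the unit circle. Saturations. $\sigma:\mathbb{R}\to\mathbb{R}$ is an odd $C^1$ function with $0\le\sigma'(s)\le1$ for all $s$, $\sigma(s)=1$ for $s\ge 21/20$ and $\sigma(s)=s$ for $0\le s\le 19/20$; $\sigma_i(s)=\varepsilon_i\sigma(s/\varepsilon_i)$. Linear maps. $p_i(a_i,\dots,a_n)=\sum_{j=i}^n\frac{(n-i)!}{(n-j)!(j-i)!}a_j$. The nonsingular matrix $\Phi$ is defined by letting the $i$-th component of $\Phi x$ be $p_i\big(\frac ML\kappa^{i-1}x_i,\dots,\frac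 ML\kappa^{n-1}x_n\big)$, $i=1,\dots,n$. Controller. For $\psi\in\mathbb{R}^n$ set $\lambda_0=0$, $\lambda_i=\sigma_i\big(p_i(\kappa^{i-1}\frac ML\psi_i,\dots,\kappa^{n-1}\frac ML\psi_n)+\lambda_{i-1}\big)$ for $i=1,\dots,n$, and $\alpha(\psi)=-\frac{L}{M\kappa^n}\lambda_n$. The control is $u(t)=\alpha(\psi(t))$. Channel. A packet encoding the symbol vector $y(t_k)\in\{0,\pm1\}^n$ is sent at time $t_k$ and received at time $\theta_k=t_k+\theta$. Put $g_{\mathcal E}(x,\xi,\ell)=(4\Phi)^{-1}\mathrm{diag}[\mathrm{sgn}(\Phi(x-\xi))]\,\ell$ and $g_{\mathcal D}(y,\nu)=(4\Phi)^{-1}\mathrm{diag}(y)\,\nu$. Encoder: $\dot\omega(t)=f(\omega(t),\alpha(\omega(t-\theta)))$ for $t\ne\theta_k$; $\dot\xi(t)=f(\xi(t),\alpha(\omega(t)))$ and $\dot\ell(t)=\mathbf 0_n$ for $t\ne t_k$; $\omega(t^+)=\omega(t)+g_{\mathcal E}(x(t-\theta),\xi(t-\theta),\ell(t-\theta))$ for $t=\theta_k$; $\xi(t^+)=\xi(t)+g_{\mathcal E}(x(t),\xi(t),\ell(t))$, $\ell(t^+)=\Lambda\ell(t)$ and $y(t)=\mathrm{sgn}(\Phi(x(t)-\xi(t)))$ for $t=t_k$. Decoder: $\dot\psi(t)=f(\psi(t),\alpha(\psi(t-\theta)))$ and $\dot\nu(t)=\mathbf 0_n$ for $t\ne\theta_k$;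 $\psi(t^+)=\psi(t)+g_{\mathcal D}(y(t-\theta),\nu(t))$ and $\nu(t^+)=\Lambda\nu(t)$ for $t=\theta_k$. Initial conditions of encoder and decoder: $\omega(t)=\psi(t)=\mathbf 0_n$ for $t\in[\theta_0-\theta,\theta_0]=[t_0,\theta_0]$, $\xi(t_0)=\mathbf 0_n$, $\ell(t_0)=2\Phi\bar\ell$, $\nu(\theta_0)=2\Phi\bar\ell$. Data rate. $R_{av}=\limsup_{k\to\infty}\sum_{j=0}^k\frac{N(t_j)}{t_k-t_0}$, where $N(t_j)$ is the number of bits of the packet sent at time $t_j$; each component of $y(t_j)$ is encoded with 2 bits, so $N(t_j)=2n$. *)

(* Defs.v *)
From HB Require Import structures.
From mathcomp Require Import all_boot all_order all_algebra.
From mathcomp Require Import all_classical all_reals all_analysis.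
From mathcomp Require Import complex.

Set Implicit Arguments.
Unset Strict Implicit.
Unset Printing Implicit Defensive.

Import Order.TTheory GRing.Theory Num.Theory numFieldNormedType.Exports.

Local Open Scope classical_set_scope.
Local Open Scope ring_scope.

(* All component indices are 0-based: index [i] below is the mathematical
   index [i + 1].  The library norm [`|v|] on 'cV[R]_m is the max norm, so
   the Euclidean norm is introduced separately; both induce the same
   topology. *)
Definition enorm (R : realType) (m : nat) (v : 'cV[R]_m) : R :=
  Num.sqrt (\sum_i v i 0 ^+ 2).

Fixpoint class_C (R : realType) (k m : nat) (g : 'cV[R]_m -> R) : Prop :=
  continuous g /\
  match k with
  | 0%N => True
  | k'.+1 => forall j : 'I_m,
      (forall v, derivable g v (delta_mx j 0)) /\
      class_C k' (fun v => 'D_(delta_mx j 0) g v)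
  end.

Definition schur_stable (R : realType) (n : nat) (A : 'M[R]_n) : Prop :=
  forall z : R[i], eigenvalue (map_mx (real_complex R) A) z -> `|z| < 1.

Definition is_saturation (R : realType) (sigma : R -> R) : Prop :=
  [/\ (forall s, sigma (- s) = - sigma s),
      (forall s, derivable sigma s 1) /\ continuous (derive1 sigma),
      (forall s, 0 <= derive1 sigma s <= 1),
      (forall s, 21 / 20 <= s -> sigma s = 1) &
      (forall s, 0 <= s <= 19 / 20 -> sigma s = s)].

Lemma add_ord_ltn (n i : nat) (j : 'I_(n - i)) : (i + j < n)%N.
Proof. by rewrite -ltn_subRL. Qed.

Definition tail (R : realType) (n i : nat) (v : 'cV[R]_n) : 'cV[R]_(n - i) :=
  \col_j v (Ordinal (add_ord_ltn j)) 0.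

(* [h i] is h_{i+1}, a function on R^{n-(i+1)}; it is only used when
   i + 1 < n. *)
Definition feedforward (R : realType) (n : nat)
    (h : forall i : nat, 'cV[R]_(n - i.+1) -> R)
    (x : 'cV[R]_n) (u : R) : 'cV[R]_n :=
  \col_(i < n) (if insub i.+1 is Some j then x j 0 + h i (tail i.+1 x) else u).

Definition p_coef (R : realType) (n i j : nat) : R :=
  (n - i.+1)`!%:R / ((n - j.+1)`! * (j - i)`!)%:R.

Definition p_map (R : realType) (n i : nat) (a : 'cV[R]_n) : R :=
  \sum_(j < n | (i <= j)%N) p_coef R n i j * a j 0.

Definition rescale (R : realType) (n : nat) (M L kappa : R) (x : 'cV[R]_n) :
    'cV[R]_n :=
  \col_j (kappa ^+ j * (M / L) * x j 0).

Definition Phi (R : realType) (n : nat) (M L kappa : R) : 'M[R]_n :=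
  \matrix_(i, j) p_map i (rescale M L kappa (delta_mx j 0)).

Lemma PhiE (R : realType) (n : nat) (M L kappa : R) (x : 'cV[R]_n) (i : 'I_n) :
  (Phi n M L kappa *m x) i 0 = p_map i (rescale M L kappa x).
Proof.
rewrite mxE /p_map.
transitivity (\sum_(j < n) \sum_(k < n | (i <= k)%N)
    (if k == j then p_coef R n i k * (kappa ^+ k * (M / L) * x k 0) else 0)).
  apply: eq_bigr => j _; rewrite mxE /p_map mulr_suml; apply: eq_bigr => k _.
  rewrite !mxE eqxx andbT; case: eqP => [->|_]; first by rewrite mulr1 !mulrA.
  by rewrite !mulr0 mul0r.
rewrite exchange_big; apply: eq_bigr => k _ /=.
by rewrite -big_mkcond /= (big_pred1 k) ?mxE // => j; rewrite eq_sym.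
Qed.

Definition sat (R : realType) (sigma : R -> R) (e s : R) : R := e * sigma (s / e).

(* [lam i] is lambda_i, i = 0..n; the mathematical epsilon_{i+1} is
   [eps i]. *)
Fixpoint lam (R : realType) (n : nat) (sigma : R -> R) (eps : nat -> R)
    (a : 'cV[R]_n) (i : nat) : R :=
  if i is i'.+1 then sat sigma (eps i') (p_map i' a + lam sigma eps a i') else 0.

Definition alpha (R : realType) (n : nat) (sigma : R -> R) (eps : nat -> R)
    (M L kappa : R) (psi : 'cV[R]_n) : R :=
  - (L / (M * kappa ^+ n)) * lam sigma eps (rescale M L kappa psi) n.

Definition symbol (R : realType) (n : nat) (P : 'M[R]_n) (x xi : 'cV[R]_n) :
    'cV[R]_n :=
  map_mx Num.sg (P *m (x - xi)).

Definition gD (R : realType) (n : nat) (P : 'M[R]_n) (y nu : 'cV[R]_n) :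
    'cV[R]_n :=
  invmx (4 *: P) *m diag_mx y^T *m nu.

Definition gE (R : realType) (n : nat) (P : 'M[R]_n) (x xi ell : 'cV[R]_n) :
    'cV[R]_n :=
  gD P (symbol P x xi) ell.

(* [z] solves z' = v after time [s0], with jumps allowed only at the times
   in [J].  Since the right-hand sides contain controls that jump, z' = v is
   required at the times where [v] is continuous; elsewhere (a locally finite
   set of times in the closed loop) [z] is only required to be continuous.
   Left-continuity encodes that the value at a jump is the value before it. *)
Definition impulsive_flow (R : realType) (n : nat) (J : set R) (s0 : R)
    (z v : R -> 'cV[R]_n) : Prop :=
  forall s : R, s0 < s ->
    z r @[r --> s^'-] --> z s /\
    (~ J s -> {for s, continuous z} /\
              ({for s, continuous v} -> is_derive s (1 : R) z (v s))).

Definition jumps_to (R : realType) (n : nat) (z : R -> 'cV[R]_n) (s : R)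
    (zp : 'cV[R]_n) : Prop :=
  z r @[r --> s^'+] --> zp.

Record signals (R : realType) (n : nat) := Signals {
  sx : R -> 'cV[R]_n;
  somega : R -> 'cV[R]_n;
  sxi : R -> 'cV[R]_n;
  sell : R -> 'cV[R]_n;
  spsi : R -> 'cV[R]_n;
  snu : R -> 'cV[R]_n }.

Definition state (R : realType) (n : nat) (X : signals R n) (s : R) :
    'cV[R]_(n + (n + (n + (n + (n + n))))) :=
  col_mx (sx X s) (col_mx (somega X s) (col_mx (sxi X s)
    (col_mx (sell X s) (col_mx (spsi X s) (snu X s))))).

Definition history_norm (R : realType) (n : nat) (theta : R)
    (X : signals R n) (T : R) : R :=
  sup [set enorm (state X (T + s)) | s in `[- (2 * theta), 0]].

Section ClosedLoop.
Context (R : realType) (n : nat) (f : 'cV[R]_n -> R -> 'cV[R]_n)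
  (al : 'cV[R]_n -> R) (P Lam : 'M[R]_n) (theta : R) (t : nat -> R)
  (lbar : 'cV[R]_n) (X : signals R n).

Let x := sx X.
Let omega := somega X.
Let xi := sxi X.
Let ell := sell X.
Let psi := spsi X.
Let nu := snu X.
Let rt (k : nat) : R := t k + theta.
Let y (k : nat) : 'cV[R]_n := symbol P (x (t k)) (xi (t k)).

Definition process : Prop :=
  jumps_to x (t 0%N) (x (t 0%N)) /\
  impulsive_flow set0 (t 0%N) x (fun s => f (x s) (al (psi s))).

(* [rt k] is the reception time theta_k, so the delayed values of x, xi, ell
   and y used at [rt k] are those at [t k]. *)
Definition encoder : Prop :=
  [/\ impulsive_flow (range rt) (rt 0%N) omega
        (fun s => f (omega s) (al (omega (s - theta)))),
      impulsive_flow (range t) (t 0%N) xi (fun s => f (xi s) (al (omega s))),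
      impulsive_flow (range t) (t 0%N) ell (fun=> 0),
      (forall k, jumps_to omega (rt k)
         (omega (rt k) + gE P (x (t k)) (xi (t k)) (ell (t k)))) &
      (forall k,
         jumps_to xi (t k) (xi (t k) + gE P (x (t k)) (xi (t k)) (ell (t k))) /\
         jumps_to ell (t k) (Lam *m ell (t k)))].

Definition decoder : Prop :=
  [/\ impulsive_flow (range rt) (rt 0%N) psi
        (fun s => f (psi s) (al (psi (s - theta)))),
      impulsive_flow (range rt) (rt 0%N) nu (fun=> 0) &
      (forall k,
         jumps_to psi (rt k) (psi (rt k) + gD P (y k) (nu (rt k))) /\
         jumps_to nu (rt k) (Lam *m nu (rt k)))].

Definition initial_conditions : Prop :=
  [/\ (forall i, `|x (t 0%N) i 0| <= lbar i 0),
      (forall s, t 0%N <= s <= rt 0%N -> omega s = 0 /\ psi s = 0),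
      xi (t 0%N) = 0,
      ell (t 0%N) = 2 *: (P *m lbar) &
      nu (rt 0%N) = 2 *: (P *m lbar)].

Definition closed_loop : Prop :=
  [/\ process, encoder, decoder & initial_conditions].

End ClosedLoop.

Definition packet_bits (n : nat) : nat := 2 * n.

(* The summand for k = 0 is a division by zero, irrelevant for the limsup. *)
Definition average_data_rate (R : realType) (n : nat) (t : nat -> R) : \bar R :=
  limn_esup (fun k =>
    (\sum_(j < k.+1) (packet_bits n)%:R / (t k - t 0%N))%:E).

(* Main.v *)
Require Import Defs.
From HB Require Import structures.
From mathcomp Require Import all_boot all_order all_algebra.
From mathcomp Require Import all_classical all_reals all_analysis complex.
From mathcomp Require Import ring lra zify.

Import Order.TTheory GRing.Theory Num.Theory numFieldNormedType.Exports.

(* After [theta] time units, psi and omega both equal xi(. - theta), so everything is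
   about x and xi. In the coordinates p = Phi x and q = Phi xi the triangular system
   becomes kappa p_i' = (sum of p_j over j > i) - lambda_n(q(. - theta)) plus a
   nonlinearity that depends on the later coordinates and is quadratically small.
   The error obeys |p_i - q_i| <= ell_i / 2, provided that the range is updated by
   ell_i+ = ell_i / 2 + Delta F_i (sum of ell_j+ over j > i), with Delta the sampling
   period and F_i a Lipschitz constant on the region where the later coordinates live.
   Solving this for ell+ gives an upper triangular Lambda with diagonal 1/2, whatever
   Delta is: sampling rarely enough makes the data rate as small as desired.
   The errors therefore vanish, and the levels of the controller leave saturation one
   after the other from the last to the first, each coordinate being driven below
   eps_i / 2. Then lambda_n is the sum of the q_j, and the resulting triangular linear
   system with small delay decays exponentially. *)

(** The obstacle is a circularity: [F] i needs the region visited by the later coordinates, and that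
    region depends on how well the quantizer tracks them. It is broken because lambda_n never
    exceeds 1/30: the speed of p_i is bounded by data of the later coordinates, while F_i only
    affects the time that p_i needs to settle, hence only the region used at the levels before i.
    Taking Delta = m theta puts all sampling, reception and switching times on one grid. The delayed
    equations can then be treated cell by cell, and the triangular form of f reduces existence and
    uniqueness on a cell to integrating one coordinate at a time. Between grid points there are
    derivatives, at grid points only one-sided information; hence the one-sided mean value
    estimates. The final decay is a barrier argument with exponential weights, in which the barrier
    itself bounds the delayed terms over the last two delays. All constants are fixed before the
    trajectory, so that one choice serves every solution. *)

Local Open Scope classical_set_scope.
Local Open Scope ring_scope.

(** * One-sided mean value estimates *)

Section Calculus.
Context {R : realType}.
Implicit Types (f : R -> R) (a b c s : R).

(** The derivative is bounded only immediately to the right of each time, so that grid times, where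
    the control switches, do no harm. [A] is the right limit at the start, which differs from f a
    after a jump. *)
Lemma le_of_right_derivative f a b c A : a < b ->
  f r @[r --> a^'+] --> A ->
  (forall s, a < s < b -> {for s, continuous f}) ->
  f r @[r --> b^'-] --> f b ->
  (forall s, a <= s < b -> \forall r \near s^'+,
     derivable f r 1 /\ 'D_1 f r <= c) ->
  f b - A <= c * (b - a).
Proof.
move=> ab fA fc fb fd.
pose g r := f r - c * r.
have gd s : derivable f s 1 -> is_derive s (1 : R) g ('D_1 f s - c).
  move=> fs; apply: is_deriveB; first exact: DeriveDef.
  by apply: is_derive_eq; exact: mulr1.
have lc s : {for s, continuous (fun r => c * r)}.
  by apply: cvgM; [exact: cvg_cst|exact: cvg_id].
have key a' : a < a' < b -> g b <= g a'.
  move=> /andP[aa' a'b].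
  have gc s : a < s < b -> {for s, continuous g}.
    by move=> sab; apply: cvgB; [exact: fc|exact: lc].
  have gb : g r @[r --> b^'-] --> g b.
    by apply: cvgB => //; apply: cvg_at_left_filter; exact: lc.
  rewrite leNgt; apply/negP => gab.
  (* If g b exceeded g a', the supremum [s0] of the times with g <= g a' would be attained by
     left-continuity, and the derivative bound just to its right would produce later such times. *)
  pose E : set R := [set s | a' <= s <= b /\ g s <= g a'].
  have Ea' : E a' by split; rewrite ?lexx ?ltW.
  have hsE : has_sup E.
    by split; [exists a'|exists b => s -[/andP[]]].
  set s0 := sup E.
  have a's0 : a' <= s0 by apply: ub_le_sup => //; case: hsE.
  have s0b : s0 <= b by apply: ge_sup; [exists a'|move=> s [/andP[]]].
  have gl : g r @[r --> s0^'-] --> g s0.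
    move: s0b; rewrite le_eqVlt => /predU1P[->//|s0b].
    by apply: cvg_at_left_filter; apply: gc; rewrite (lt_le_trans aa').
  have gs0 : g s0 <= g a'.
    rewrite leNgt; apply/negP => gs0.
    have [e /= e0 he] : \forall r \near s0^'-, g a' < g r by exact: (cvgr_gt _ gl).
    have [s Es] := sup_adherent e0 hsE; rewrite -/s0 => sE.
    case: (Es) => sb gsE.
    have : s <= s0 by apply: ub_le_sup => //; case: hsE.
    rewrite le_eqVlt => /predU1P[ss0|ss0]; first by move: gsE; rewrite ss0 leNgt gs0.
    have : g a' < g s by apply: he => //=; rewrite ger0_norm; lra.
    by rewrite ltNge gsE.
  have {}s0b : s0 < b.
    by rewrite lt_neqAle s0b andbT; apply/eqP => s0b'; move: gs0; rewrite s0b' leNgt gab.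
  have [] := fd s0; first by rewrite (le_trans (ltW aa')).
  move=> e /= e0 he.
  pose s1 := Num.min (s0 + e / 2) ((s0 + b) / 2).
  have s01 : s0 < s1 by rewrite /s1 lt_min; apply/andP; split; lra.
  have s1b : s1 < b by rewrite /s1 gt_min; apply/orP; right; lra.
  have s1e : s1 <= s0 + e / 2 by rewrite /s1 ge_min lexx.
  have [r rs] : exists2 r, r \in `]s0, s1[%R & g s1 - g s0 = ('D_1 f r - c) * (s1 - s0).
    apply: (@MVT R g) => // [x|].
      rewrite in_itv/= => /andP[s0x xs1]; apply: gd.
      have [] // := he x; rewrite /= ltr0_norm; lra.
    apply: continuous_in_subspaceT => x; rewrite inE/= in_itv/= => /andP[? ?].
    by apply: gc; apply/andP; split; lra.
  move: rs; rewrite in_itv/= => /andP[rs0 rs1] grs.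
  have [_ Dr] : derivable f r 1 /\ 'D_1 f r <= c.
    by apply: he => //=; rewrite ltr0_norm; lra.
  have : s1 <= s0.
    apply: ub_le_sup => //; first by case: hsE.
    split; first by apply/andP; split; lra.
    have : ('D_1 f r - c) * (s1 - s0) <= 0 by rewrite mulr_le0_ge0; lra.
    by lra.
  by lra.
have ga : g r @[r --> a^'+] --> A - c * a.
  by apply: cvgB => //; apply: cvg_at_right_filter; exact: lc.
have : g b <= A - c * a.
  rewrite -(cvg_lim _ ga)//; apply: limr_ge; first by apply: cvgP ga.
  by near=> r; apply: key; apply/andP; split; near: r;
    [exact: nbhs_right_gt|exact: nbhs_right_lt].
by rewrite /g; lra.
Unshelve. all: by end_near. Qed.

Lemma le_of_right_derivative_cont f a b c : a <= b ->
  (forall s, a <= s <= b -> {for s, continuous f}) ->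
  (forall s, a <= s < b -> \forall r \near s^'+,
     derivable f r 1 /\ 'D_1 f r <= c) ->
  f b - f a <= c * (b - a).
Proof.
rewrite le_eqVlt => /predU1P[<-|ab] fc fd; first by rewrite !subrr mulr0.
apply: le_of_right_derivative => //.
- by apply: cvg_at_right_filter; apply: fc; rewrite lexx ltW.
- by move=> s /andP[? ?]; apply: fc; rewrite !ltW.
- by apply: cvg_at_left_filter; apply: fc; rewrite lexx ltW.
Qed.

Lemma dist_le_of_right_derivative f a b c A : a < b ->
  f r @[r --> a^'+] --> A ->
  (forall s, a < s < b -> {for s, continuous f}) ->
  f r @[r --> b^'-] --> f b ->
  (forall s, a <= s < b -> \forall r \near s^'+,
     derivable f r 1 /\ `|'D_1 f r| <= c) ->
  `|f b - A| <= c * (b - a).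
Proof.
move=> ab fA fc fb fd; rewrite ler_norml; apply/andP; split; last first.
  apply: le_of_right_derivative => // s /fd; apply: filterS => r [fr].
  by rewrite ler_norml => /andP[].
rewrite lerNl opprB.
have -> : A - f b = (\- f) b - - A by rewrite /= opprK addrC.
apply: le_of_right_derivative.
- exact: ab.
- exact: cvgN.
- by move=> s sab; apply: cvgN; exact: fc.
- exact: cvgN.
move=> s /fd; apply: filterS => r [fr]; rewrite ler_norml => /andP[h _].
by split; [exact: derivableN|rewrite deriveN// lerNl].
Qed.

(** Above m the function loses at least c per unit of time, so it arrives at m within (B - m) / c.
    It cannot leave again, since after the last time with f <= m it would be decreasing. *)
Lemma descent f a B m c : 0 < c ->
  (forall s, a <= s -> {for s, continuous f}) ->
  (forall s, a <= s -> \forall r \near s^'+,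
     derivable f r 1 /\ (m <= f r -> 'D_1 f r <= - c)) ->
  f a <= B ->
  forall s, a <= s -> a + (B - m) / c <= s -> f s <= m.
Proof.
move=> c0 fc fd faB.
have stay s1 s2 : a <= s1 -> s1 <= s2 -> f s1 <= m -> f s2 <= m.
  move=> as1 s12 fs1; rewrite leNgt; apply/negP => fs2.
  pose E : set R := [set s | s1 <= s <= s2 /\ f s <= m].
  have Es1 : E s1 by split; rewrite ?lexx.
  have hsE : has_sup E.
    by split; [exists s1|exists s2 => s -[/andP[]]].
  set s0 := sup E.
  have s10 : s1 <= s0 by apply: ub_le_sup => //; case: hsE.
  have s02 : s0 <= s2 by apply: ge_sup; [exists s1|move=> s [/andP[]]].
  have fs0 : f s0 <= m.
    rewrite leNgt; apply/negP => fs0.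
    have [e /= e0 he] : \forall r \near s0, m < f r.
      by apply: (cvgr_gt (f s0) (fc s0 _) m fs0); lra.
    have [s Es] := sup_adherent e0 hsE; rewrite -/s0 => sE.
    have ss0 : s <= s0 by apply: ub_le_sup => //; case: hsE.
    have : m < f s by apply: he => /=; rewrite ger0_norm; lra.
    by case: Es => _; rewrite leNgt => /negbTE ->.
  suff : f s2 - f s0 <= - c * (s2 - s0).
    have : 0 <= c * (s2 - s0) by rewrite mulr_ge0; lra.
    by lra.
  apply: le_of_right_derivative_cont => //.
    by move=> s /andP[? ?]; apply: fc; lra.
  move=> s /andP[s0s ss2]; have := fd s; have -> : a <= s by lra.
  move=> /(_ isT) h; near=> r.
  have [fr fr'] : derivable f r 1 /\ (m <= f r -> 'D_1 f r <= - c) by near: r.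
  split=> //; apply: fr'.
  have sr : s < r by near: r; exact: nbhs_right_gt.
  have rs2 : r < s2 by near: r; exact: nbhs_right_lt.
  rewrite leNgt; apply/negP => frm.
  have : r <= s0.
    by apply: ub_le_sup; [case: hsE|split; rewrite ?ltW//; lra].
  by lra.
move=> s as' sB; rewrite leNgt; apply/negP => fsm.
have fm r : a <= r <= s -> m < f r.
  by move=> /andP[ar rs]; rewrite ltNge; apply/negP => /(stay _ _ ar rs); lra.
have : f s - f a <= - c * (s - a).
  apply: le_of_right_derivative_cont => // [r /andP[ar _]|r /andP[ar rs]].
    exact: fc.
  have h := fd _ ar; near=> r'.
  have [fr fr'] : derivable f r' 1 /\ (m <= f r' -> 'D_1 f r' <= - c) by near: r'.
  split => //; apply: fr'; apply/ltW/fm.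
  have r1 : r < r' by near: r'; exact: nbhs_right_gt.
  have r2 : r' < s by near: r'; exact: nbhs_right_lt.
  by apply/andP; split; lra.
have : B - m <= c * (s - a).
  have : (B - m) / c <= s - a by lra.
  by rewrite ler_pdivrMr// mulrC.
by lra.
Unshelve. all: by end_near. Qed.

(** A barrier argument in which the sign of a derivative may be deduced from the whole past of all
    components, as a delay requires. Just before the first contact with 0 the touching component
    lies above - e and the past is negative, so it is nonincreasing there and could not have risen
    to 0. *)
Lemma trap (I : finType) (f : I -> R -> R) a e : 0 < e ->
  (forall i s, a <= s -> {for s, continuous (f i)}) ->
  (forall i, f i a < 0) ->
  (forall i s, a <= s -> \forall r \near s^'+, derivable (f i) r 1 /\
     ((forall j r', a <= r' <= r -> f j r' < 0) -> - e <= f i r ->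
      'D_1 (f i) r <= 0)) ->
  forall i s, a <= s -> f i s < 0.
Proof.
move=> e0 fc fa fd.
have [//|/existsNP[i /existsNP[s /not_implyP[as1 fs1]]]] :=
  pselect (forall i s, a <= s -> f i s < 0).
exfalso.
pose E : set R := [set s | a <= s /\ exists i, 0 <= f i s].
have Es : E s by split => //; exists i; move/negP: fs1; rewrite -leNgt.
have hiE : has_inf E by split; [exists s|exists a => ? []].
set s0 := inf E.
have as0 : a <= s0 by apply: lb_le_inf; [exists s|move=> ? []].
have before j r : a <= r < s0 -> f j r < 0.
  move=> /andP[ar rs0]; rewrite ltNge; apply/negP => fjr.
  have : s0 <= r by apply: ge_inf; [case: hiE|split => //; exists j].
  by lra.
have [i0 fi0] : exists i, 0 <= f i s0.
  apply/not_existsP => fn.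
  have /nbhs_ballP[d /= d0 hd] : \forall r \near s0, forall j, f j r < 0.
    apply: (@filter_forall R I (fun j r => f j r < 0) (nbhs s0) _ _) => j.
    apply: (cvgr_lt (f j s0) _ 0); first exact: fc.
    by rewrite ltNge; apply/negP; exact: fn.
  have [r [ar [j fjr]]] := inf_adherent d0 hiE; rewrite -/s0 => rd.
  have s0r : s0 <= r by apply: ge_inf; [case: hiE|split => //; exists j].
  have : f j r < 0 by apply: hd; rewrite /ball/= ler0_norm; lra.
  by lra.
have {as0}as0 : a < s0.
  by rewrite lt_neqAle as0 andbT; apply/eqP => as0'; move: (fa i0); rewrite as0'; lra.
have [d /= d0 hd] : \forall r \near s0, - e < f i0 r.
  by apply: (cvgr_gt (f i0 s0) (fc i0 s0 _) (- e)); lra.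
pose s1 := Num.max (s0 - d / 2) ((a + s0) / 2).
have s10 : s1 < s0 by rewrite /s1 gt_max; apply/andP; split; lra.
have as1' : a < s1 by rewrite /s1 lt_max; apply/orP; right; lra.
have s1e : s0 - d / 2 <= s1 by rewrite /s1 le_max lexx.
have : f i0 s0 - f i0 s1 <= 0 * (s0 - s1).
  apply: le_of_right_derivative_cont; first by lra.
    by move=> r /andP[? ?]; apply: fc; lra.
  move=> r /andP[r1 r2]; have := fd i0 r; have -> : a <= r by lra.
  move=> /(_ isT) h; near=> r'.
  have rr' : r < r' by near: r'; exact: nbhs_right_gt.
  have r's0 : r' < s0 by near: r'; exact: nbhs_right_lt.
  have [fr fr'] : derivable (f i0) r' 1 /\
     ((forall j r'', a <= r'' <= r' -> f j r'' < 0) -> - e <= f i0 r' ->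
      'D_1 (f i0) r' <= 0) by near: r'.
  split=> //; apply: fr'.
    by move=> j r'' /andP[? ?]; apply: before; apply/andP; split; lra.
  by apply/ltW/hd => /=; rewrite ger0_norm; lra.
have : f i0 s1 < 0 by apply: before; apply/andP; split; lra.
by lra.
Unshelve. all: by end_near. Qed.

Lemma is_derive_expR_affine (c a s : R) :
  is_derive s (1 : R) (fun t => expR (c * (t - a))) (c * expR (c * (s - a))).
Proof.
have h : is_derive s (1 : R) (fun t => c * (t - a)) c.
  have -> : (fun t => c * (t - a)) = (fun t => c *: (id t - cst a t)) by [].
  rewrite -[X in is_derive _ _ _ X]mulr1 -[X in _ * X]subr0.
  exact: is_deriveZ.
rewrite mulrC; exact: is_derive1_comp (is_derive_expR _) h.
Qed.

(** Meant for the barrier functions of [exponential_stage]: b is a sign, k a power of 3, and the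
    term c f is the price of the exponential weight. *)
Lemma is_derive_weight (f : R -> R) (f' c a s b k d : R) : is_derive s (1 : R) f f' ->
  is_derive s (1 : R) (fun t => b * (f t * expR (c * (t - a)) / k) - d)
    (b * ((f' + c * f s) * expR (c * (s - a)) / k)).
Proof.
move=> fd.
have ed := is_derive_expR_affine c a s.
have h := is_deriveM fd ed.
have -> : (fun t => b * (f t * expR (c * (t - a)) / k) - d) =
   (fun t => (b / k) *: (f * (fun t => expR (c * (t - a)))) t - cst d t).
  by apply/funext => t /=; rewrite !fctE /GRing.scale/=; ring.
apply: is_derive_eq.
rewrite /GRing.scale/=; ring.
Qed.

End Calculus.

(** * Column vectors and feedforward flows *)

Section ColumnVectors.
Context {R : realType} {n : nat}.
Implicit Types (z : R -> 'cV[R]_n).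

Lemma cvg_cVP {T : Type} (F : set_system T) {FF : Filter F}
    (z : T -> 'cV[R]_n) (l : 'cV[R]_n) :
  z r @[r --> F] --> l <-> forall i, z r i 0 @[r --> F] --> l i 0.
Proof.
split=> [zl i|zl].
  apply: (@cvg_comp _ _ _ z (fun v : 'cV[R]_n => v i 0) _ _ _ zl).
  exact: coord_continuous.
apply/cvgrPdist_le => /= e e0; near=> r.
rewrite /Num.Def.normr/= mx_normrE (bigmax_le _ (ltW e0))//= => -[i j] _.
rewrite !mxE/= ord1.
move: i; near: r.
apply: (@filter_forall T 'I_n (fun i r => `|l i 0 - z r i 0| <= e) F FF).
by move=> i; have /cvgrPdist_le := zl i; exact.
Unshelve. all: by end_near. Qed.

Lemma is_derive_cVP z (s : R) (l : 'cV[R]_n) :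
  is_derive s (1 : R) z l <->
  forall i, is_derive s (1 : R) (fun r => z r i 0) (l i 0).
Proof.
split=> [[zd <-] i|zd].
  have zi : derivable (fun r => z r i 0) s 1 by exact: (derivable_mxP _ _ _).1.
  by apply: DeriveDef => //; rewrite derive_mx// mxE.
have dz : derivable z s 1.
  by apply/derivable_mxP => i j; rewrite (ord1 j); exact: ex_derive.
apply: DeriveDef => //; rewrite derive_mx//; apply/matrixP => i j.
by rewrite mxE (ord1 j); exact: derive_val.
Qed.

Lemma compact_box (B : R) : compact [set v : 'cV[R]_n | forall i, `|v i 0| <= B].
Proof.
have -> : [set v : 'cV[R]_n | forall i, `|v i 0| <= B] =
    trmx @` [set v : 'rV[R]_n | forall i, `[- B, B]%classic (v ord0 i)].
  apply/seteqP; split => [v /= vB|_ /= [w wB <-] i].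
    exists v^T; last by rewrite trmxK.
    by move=> i; rewrite mxE /= in_itv/= -ler_norml.
  by have := wB i; rewrite mxE /= in_itv/= -ler_norml.
have cT : continuous (@trmx R 1 n).
  move=> v; apply: (cvg_cVP (nbhs v) (@trmx R 1 n) v^T).2 => i.
  rewrite /= (_ : (fun r : 'rV[R]_n => _) = fun r : 'rV[R]_n => r 0 i); last first.
    by apply/funext => r; rewrite mxE.
  by rewrite mxE; exact: coord_continuous.
have cB : compact [set v : 'rV[R]_n | forall i, `[- B, B]%classic (v ord0 i)].
  have := @rV_compact R n (fun=> `[- B, B]%classic) (fun=> @segment_compact R (- B) B).
  exact.
exact: (continuous_compact (continuous_subspaceT cT) cB).
Qed.

Lemma continuous_box_bound (g : 'cV[R]_n -> R) (B : R) : continuous g ->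
  exists2 F, 0 <= F & forall v : 'cV[R]_n, (forall i, `|v i 0| <= B) -> `|g v| <= F.
Proof.
move=> gc.
have /compact_bounded[M [_ hM]] : compact (g @` [set v : 'cV[R]_n | forall i, `|v i 0| <= B]).
  exact: (continuous_compact (continuous_subspaceT gc) (compact_box B)).
exists (`|M| + 1); first by rewrite addr_ge0.
move=> v vB; apply: hM; last by exists v.
by rewrite (le_lt_trans (ler_norm _))// ltrDl.
Qed.

Lemma is_derive_line (g : 'cV[R]_n -> R) (a d : 'cV[R]_n) (r : R) :
  derivable g (a + r *: d) d ->
  is_derive r (1 : R) (fun t => g (a + t *: d)) ('D_d g (a + r *: d)).
Proof.
have E : (fun h => h^-1 *: (((fun t : R => g (a + t *: d)) \o shift r) (h *: 1) - g (a + r *: d))) =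
    (fun h => h^-1 *: ((g \o shift (a + r *: d)) (h *: d) - g (a + r *: d))).
  apply/funext => h /=; congr (_ *: (g _ - _)).
  by rewrite scalerDl [h *: 1]mulr1 addrCA addrA.
by move=> gd; split; rewrite /derivable /derive E.
Qed.

Lemma norm_mvt (f : R -> R) (x y F : R) :
  (forall r, derivable f r 1) ->
  (forall r, Num.min x y <= r <= Num.max x y -> `|'D_1 f r| <= F) ->
  `|f x - f y| <= F * `|x - y|.
Proof.
move=> fd; wlog xy : x y / x <= y.
  move=> wl; have [xy|/ltW yx] := leP x y; first by have := wl x y xy; rewrite min_l// max_r.
  have := wl y x yx; rewrite min_l// max_r//= => h.
  by move=> {}/h; rewrite distrC [`|y - x|]distrC.
rewrite min_l// max_r// => fF.
have [c] := MVT_segment xy (fun r _ => DeriveDef (fd r) erefl)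
  (derivable_within_continuous (fun r _ => fd r)).
rewrite in_itv/= => cxy e.
by rewrite distrC e normrM distrC ler_wpM2r// fF.
Qed.

(** Passing from v to w one coordinate at a time never leaves the box. Each move is a
    one-dimensional mean value estimate with a partial derivative that is bounded by compactness. *)
Lemma class_C_lipschitz_box (g : 'cV[R]_n -> R) (B : R) : class_C 1 g ->
  exists2 F, 0 <= F & forall v w : 'cV[R]_n, (forall i, `|v i 0| <= B) ->
    (forall i, `|w i 0| <= B) -> `|g v - g w| <= F * \sum_i `|v i 0 - w i 0|.
Proof.
move=> /= [gc gd].
have /fin_all_exists2[Fb Fb0 FbP] (j : 'I_n) : exists2 F, 0 <= F & forall v : 'cV[R]_n,
    (forall i, `|v i 0| <= B) -> `|'D_(delta_mx j 0) g v| <= F.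
  by apply: continuous_box_bound; have [_ []] := gd j.
exists (\sum_j Fb j); first by rewrite sumr_ge0.
move=> v w vB wB.
pose hyb k : 'cV[R]_n := \col_j (if (j < k)%N then w j 0 else v j 0).
have h0 : hyb 0%N = v by apply/colP => j; rewrite mxE.
have hn : hyb n = w by apply/colP => j; rewrite mxE ltn_ord.
have -> : g v - g w = \sum_(k < n) (g (hyb k) - g (hyb k.+1)).
  rewrite -(big_mkord xpredT (fun k => g (hyb k) - g (hyb k.+1))).
  under eq_bigr do rewrite -opprB.
  by rewrite sumrN (telescope_sumr (fun k => g (hyb k)))// h0 hn opprB.
rewrite mulr_sumr (le_trans (ler_norm_sum _ _ _))// ler_sum// => k _.
pose a : 'cV[R]_n := \col_j (if j == k then 0 else hyb k j 0).
have ak (c : R) : \col_j (if j == k then c else hyb k j 0) = a + c *: delta_mx k 0.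
  apply/colP => j; rewrite !mxE eqxx andbT; case: (j == k); rewrite ?mulr1 ?mulr0 ?add0r ?addr0//.
have -> : hyb k = a + v k 0 *: delta_mx k 0.
  rewrite -ak; apply/colP => j; rewrite !mxE; case: eqP => [->|//].
  by rewrite ltnn.
have -> : hyb k.+1 = a + w k 0 *: delta_mx k 0.
  rewrite -ak; apply/colP => j; rewrite !mxE; case: eqP => [->|/eqP jk].
    by rewrite ltnSn.
  by rewrite ltnS leq_eqVlt -[(j == k :> nat)]/(j == k) (negbTE jk).
apply: le_trans (_ : Fb k * `|v k 0 - w k 0| <= _); last first.
  by rewrite ler_wpM2r// (bigD1 k)//= lerDl sumr_ge0.
have dline r : is_derive r (1 : R) (fun t => g (a + t *: delta_mx k 0))
    ('D_(delta_mx k 0) g (a + r *: delta_mx k 0)).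
  by apply: is_derive_line; have [] := gd k.
apply: (norm_mvt (fun t => g (a + t *: delta_mx k 0))) => [r|r rvw].
  exact: ex_derive.
rewrite derive_val; apply: FbP => i; rewrite -ak mxE.
have [_|_] := eqVneq i k.
  have := vB k; have := wB k; rewrite !ler_norml => /andP[? ?] /andP[? ?].
  move: rvw; rewrite ge_min le_max => /andP[/orP[?|?] /orP[?|?]];
  by apply/andP; split; lra.
by rewrite mxE; case: ifP.
Qed.

End ColumnVectors.

(** * Antiderivatives on the whole line *)

Section Antiderivative.
Context {R : realType}.

Lemma antiderivative_itv (g : R -> R) (N : R) : continuous g -> 0 < N ->
  exists2 G, G 0 = 0 & forall x, - N < x < N -> is_derive x (1 : R) G (g x).
Proof.
move=> gc N0.
pose F x := (\int[@lebesgue_measure R]_(t in [set` `[- N, x]]) g t)%R.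
exists (fun x => F x - F 0); first by rewrite subrr.
move=> x /andP[Nx xN].
have gi : (@lebesgue_measure R).-integrable `[- N, N] (EFin \o g).
  apply: continuous_compact_integrable; first exact: segment_compact.
  exact: continuous_subspaceT.
have [Fd Fx] := @continuous_FTC1_closed R g (- N) x N xN gi Nx (gc x).
have Fd' : is_derive x (1 : R) F (g x).
  by apply: (DeriveDef Fd); rewrite -derive1E; exact: Fx.
have -> : g x = g x - 0 by rewrite subr0.
apply: is_deriveB; exact: Fd'.
Qed.

Lemma zero_derivative_const (f : R -> R) (a b x y : R) :
  (forall r, a < r < b -> is_derive r (1 : R) f 0) ->
  a < x < b -> a < y < b -> f x = f y.
Proof.
move=> fd; wlog xy : x y / x <= y.
  by move=> wl xab yab; have [?|/ltW ?] := leP x y; [exact: wl|apply/esym/wl].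
move=> /andP[ax xb] /andP[ay yb].
have [] := @MVT_segment R f (fun=> 0) x y xy.
- by move=> r; rewrite in_itv/= => /andP[? ?]; apply: fd; apply/andP; split; lra.
- apply: derivable_within_continuous => r; rewrite in_itv/= => /andP[? ?].
  by have [] : is_derive r (1 : R) f 0 by apply: fd; apply/andP; split; lra.
by move=> c _; rewrite mul0r => /eqP; rewrite subr_eq0 => /eqP.
Qed.

(** The antiderivatives on the intervals (-N, N) all vanish at 0, hence agree on overlaps; at x one
    uses any N beyond |x|. *)
Lemma antiderivative (g : R -> R) : continuous g ->
  exists2 G, G 0 = 0 & forall x, is_derive x (1 : R) G (g x).
Proof.
move=> gc.
have /choice[G /all_and2[G0 Gd]] (N : nat) : exists G : R -> R, G 0 = 0 /\
    forall x : R, - N.+1%:R < x < N.+1%:R -> is_derive x (1 : R) G (g x).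
  by have [//|G] := antiderivative_itv g N.+1%:R gc; exists G.
have GE (N M : nat) x : `|x| < N.+1%:R -> `|x| < M.+1%:R -> G N x = G M x.
  wlog NM : N M / (N <= M)%N.
    by move=> wl ? ?; have [/wl|/ltnW/wl] := leqP N M; [exact|move=> ->].
  move=> xN xM; apply/eqP; rewrite -subr_eq0; apply/eqP.
  have <- : G N 0 - G M 0 = 0 by rewrite !G0 subrr.
  apply: (@zero_derivative_const (fun x => G N x - G M x) (- N.+1%:R) N.+1%:R).
  - move=> r rN; have <- : g r - g r = 0 by rewrite subrr.
    apply: is_deriveB; first exact: Gd.
    have NM1 : N.+1%:R <= M.+1%:R :> R by rewrite ler_nat.
    by apply: Gd; case/andP: rN => ? ?; apply/andP; split; lra.
  - by rewrite -ltr_norml.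
  - by rewrite oppr_lt0 ltr0Sn.
pose N (x : R) := Num.bound `|x|.
have NP x : `|x| < (N x).+1%:R.
  by rewrite (lt_trans (archi_boundP (normr_ge0 x)))// ltr_nat.
exists (fun x => G (N x) x); first by rewrite G0.
move=> x; pose M := N x.
apply: (@near_eq_is_derive _ _ _ (G M)); last first.
  by apply: Gd; rewrite -ltr_norml; exact: NP.
near=> y; apply: GE; last exact: NP.
near: y; exact: (cvgr_lt `|x| (@norm_continuous _ R x) _ (NP x)).
Unshelve. all: by end_near. Qed.

End Antiderivative.

Section Feedforward.
Context {R : realType} {n : nat} (h : forall i : nat, 'cV[R]_(n - i.+1) -> R).
Hypothesis h_cont : forall i : nat, (i.+1 < n)%N -> continuous (h i).

(** This is the triangular structure on which every induction from the last coordinate upwards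
    rests. *)
Lemma feedforward_ext (x y : 'cV[R]_n) (u : R) (i : 'I_n) :
  (forall j : 'I_n, (i < j)%N -> x j 0 = y j 0) ->
  feedforward h x u i 0 = feedforward h y u i 0.
Proof.
move=> xy; rewrite !mxE; case: insubP => [j _ ji|//].
rewrite xy ?ji//; congr (_ + h _ _); apply/colP => k; rewrite !mxE.
by apply: xy => /=; rewrite addSn ltnS leq_addr.
Qed.

Lemma cvg_feedforward {T : Type} (F : set_system T) {FF : Filter F}
    (z : T -> 'cV[R]_n) (u : T -> R) (z0 : 'cV[R]_n) (u0 : R) :
  z r @[r --> F] --> z0 -> u r @[r --> F] --> u0 ->
  feedforward h (z r) (u r) @[r --> F] --> feedforward h z0 u0.
Proof.
move=> /cvg_cVP zc uc; apply/cvg_cVP => i; rewrite mxE.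
rewrite (_ : (fun r => _) = fun r => if insub i.+1 is Some j
  then z r j 0 + h i (tail i.+1 (z r)) else u r); last first.
  by apply/funext => r; rewrite mxE.
case: insubP => [j i1n _|//].
apply: cvgD; first exact: zc.
have tc : tail i.+1 (z r) @[r --> F] --> tail i.+1 z0.
  apply/cvg_cVP => k; rewrite mxE.
  rewrite (_ : (fun r => _) = fun r => z r (Ordinal (add_ord_ltn k)) 0); first exact: zc.
  by apply/funext => r; rewrite mxE.
exact: (@cvg_comp _ _ _ (fun r => tail i.+1 (z r)) (h i) _ _ _ tc (h_cont i i1n _)).
Qed.

(** Once the later coordinates are known functions of time, the next one is an antiderivative.
    Solutions are therefore global, with no growth condition on h. *)
Lemma feedforward_flow (u : R -> R) (x0 : 'cV[R]_n) : continuous u ->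
  exists2 z : R -> 'cV[R]_n, z 0 = x0 &
    forall r, is_derive r (1 : R) z (feedforward h (z r) (u r)).
Proof.
move=> uc.
suff H k : (k <= n)%N -> exists z : R -> 'cV[R]_n, [/\ z 0 = x0, continuous z &
    forall i : 'I_n, (n - k <= i)%N ->
    forall r, is_derive r (1 : R) (fun t => z t i 0) (feedforward h (z r) (u r) i 0)].
  have [z [z0 _ zd]] := H n (leqnn n).
  by exists z => // r; apply/is_derive_cVP => i; apply: zd; rewrite subnn.
elim: k => [|k IH kn].
  exists (cst x0); split => //; first by move=> r; exact: cvg_cst.
  by move=> i; rewrite subn0 leqNgt ltn_ord.
have [z [z0 zc zd]] := IH (ltnW kn).
have i0n : (n - k.+1 < n)%N by rewrite ltn_subrL (leq_ltn_trans _ kn).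
pose i0 : 'I_n := Ordinal i0n.
have fc : continuous (fun r => feedforward h (z r) (u r) i0 0).
  move=> r; apply: ((cvg_cVP (nbhs r) (fun t => feedforward h (z t) (u t)) _).1 _ i0).
  exact: (@cvg_feedforward _ (nbhs r) _ z u (z r) (u r) (zc r) (uc r)).
have [G G0 Gd] := antiderivative _ fc.
(* Changing coordinate [i0] leaves the equations of the later coordinates intact, since these do not
   involve it. *)
pose w (r : R) : 'cV[R]_n := \col_i (if i == i0 then x0 i 0 + G r else z r i 0).
have wE r (i : 'I_n) : i != i0 -> w r i 0 = z r i 0.
  by move=> /negbTE ii0; rewrite mxE ii0.
have wE0 r : w r i0 0 = x0 i0 0 + G r by rewrite mxE eqxx.
have w0d r : is_derive r (1 : R) (fun t => w t i0 0) (feedforward h (z r) (u r) i0 0).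
  rewrite (_ : (fun t => _) = fun t => x0 i0 0 + G t); last exact/funext.
  rewrite -[feedforward _ _ _ _ _]add0r; exact: is_deriveD.
have wi (i : 'I_n) : i != i0 -> (fun t => w t i 0) = (fun t => z t i 0).
  by move=> ii0; apply/funext => t; exact: wE.
exists w; split.
- apply/colP => i; rewrite mxE z0; case: eqP => [->|//].
  by rewrite G0 addr0.
- move=> r; apply/(cvg_cVP (nbhs r)) => i; have [->|ii0] := eqVneq i i0.
    by apply: differentiable_continuous; apply/derivable1_diffP; have [] := w0d r.
  by rewrite wE// wi//; exact: ((cvg_cVP (nbhs r) z (z r)).1 (zc r)).
- move=> i ki r.
  have -> : feedforward h (w r) (u r) i 0 = feedforward h (z r) (u r) i 0.
    apply: feedforward_ext => j ij; apply: wE; apply: contraTneq ij => ->.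
    by rewrite -leqNgt.
  have [->|ii0] := eqVneq i i0; first exact: w0d.
  rewrite wi//; apply: zd.
  have : (i : nat) != (n - k.+1)%N by apply: contraNneq ii0 => e; apply/eqP/val_inj.
  by lia.
Qed.

End Feedforward.

(** * Sampling grid and nested saturations *)

Section Grid.
Context {R : realType}.

(* The index [k] with [k * d < s <= k.+1 * d] is [(gridn d s).-1]. *)
Definition gridn (d s : R) : nat := `|Num.ceil (s / d)|%N.

Lemma gridnP (d s : R) (k : nat) : 0 < d ->
  k%:R * d < s <= k.+1%:R * d -> gridn d s = k.+1.
Proof.
move=> d0 /andP[ks sk].
have c : Num.ceil (s / d) = k.+1%:Z.
  apply/eqP; rewrite ceil_eq; apply/andP; split.
    by rewrite ltr_pdivlMr// -addn1 PoszD addrK.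
  by rewrite ler_pdivrMr.
by rewrite /gridn c.
Qed.

Lemma gridn0 (d : R) : gridn d 0 = 0%N.
Proof. by rewrite /gridn mul0r ceil0. Qed.

Lemma ex_grid_cell (d s : R) : 0 < d -> 0 < s ->
  exists k : nat, k%:R * d < s <= k.+1%:R * d.
Proof.
move=> d0 s0; have c0 : 0 < Num.ceil (s / d) by rewrite ceil_gt0 divr_gt0.
exists (gridn d s).-1; rewrite /gridn.
case: (Num.ceil (s / d)) c0 (ceil_itv (s / d)) => // -[//|k] _ /=.
rewrite ltr_pdivlMr// ler_pdivrMr// => /andP[].
by rewrite -addn1 PoszD addrK => -> ->.
Qed.

Lemma gridn_ge (d s : R) : 0 < d -> 0 <= s -> s <= (gridn d s)%:R * d.
Proof.
move=> d0; rewrite le_eqVlt => /predU1P[<-|s0]; first by rewrite gridn0 mul0r.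
by have [k ks] := ex_grid_cell d s d0 s0; rewrite (gridnP d s k)//; case/andP: ks.
Qed.

Lemma near_right_off_grid (d s : R) : 0 < d -> 0 <= s ->
  \forall r \near s^'+, 0 < r /\ forall j : nat, r <> j%:R * d.
Proof.
move=> d0 s0.
have /andP[ks sk] := truncn_itv (divr_ge0 s0 (ltW d0)).
set k := Num.truncn _ in ks sk.
rewrite ler_pdivlMr// in ks; rewrite ltr_pdivrMr// in sk.
near=> r; have sr : s < r by near: r; exact: nbhs_right_gt.
have rk : r < k.+1%:R * d by near: r; exact: nbhs_right_lt.
split; first by rewrite (le_lt_trans s0).
move=> j rj; move: (le_lt_trans ks sr) rk; rewrite rj !ltr_pM2r// !ltr_nat ltnS => kj jk.
by move: (leq_trans kj jk); rewrite ltnn.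
Unshelve. all: by end_near. Qed.

End Grid.

Section NestedSaturation.
Context {R : realType} (n : nat) (sigma : R -> R) (eps : nat -> R).
Hypothesis sigma_sat : is_saturation sigma.

Lemma saturation_nondecreasing : {homo sigma : x y / x <= y}.
Proof.
case: sigma_sat => [_ [sd _] s01 _ _] x y xy.
have := @MVT_segment R sigma (derive1 sigma) x y xy _ (derivable_within_continuous (fun r _ => sd r)).
move=> []; first by move=> r _; rewrite derive1E; exact: derivableP.
move=> c _ e; rewrite -subr_ge0 e mulr_ge0 ?subr_ge0//.
by case/andP: (s01 c).
Qed.

Lemma saturation_bound s : `|sigma s| <= 1.
Proof.
case: (sigma_sat) => [so _ _ s1 _].
have ub r : sigma r <= 1.
  rewrite -(s1 (Num.max r (21 / 20))) ?le_max ?lexx ?orbT//.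
  by apply: saturation_nondecreasing; rewrite le_max lexx.
by rewrite ler_norml ub andbT lerNl -so.
Qed.

Lemma saturation_id s : `|s| <= 19 / 20 -> sigma s = s.
Proof.
case: (sigma_sat) => [so _ _ _ si]; rewrite ler_norml => /andP[s1 s2].
have [s0|/ltW s0] := leP 0 s; first by rewrite si// s0.
apply: oppr_inj; rewrite -so si//; apply/andP; split; lra.
Qed.

Lemma continuous_saturation : continuous sigma.
Proof.
case: sigma_sat => [_ [sd _] _ _ _] x.
by apply: differentiable_continuous; apply/derivable1_diffP.
Qed.

Lemma sat_bound e s : 0 < e -> `|sat sigma e s| <= e.
Proof.
move=> e0; rewrite /sat normrM gtr0_norm//; apply: ler_piMr; first exact: ltW.
exact: saturation_bound.
Qed.

Lemma sat_id e s : 0 < e -> `|s| <= 19 / 20 * e -> sat sigma e s = s.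
Proof.
move=> e0 se; rewrite /sat saturation_id.
  by rewrite mulrC divfK ?gt_eqF.
by rewrite normrM normfV (gtr0_norm e0) ler_pdivrMr.
Qed.

Lemma sat_nondecreasing e : 0 < e -> {homo sat sigma e : x y / x <= y}.
Proof.
move=> e0 x y xy; rewrite /sat ler_pM2l//; apply: saturation_nondecreasing.
by rewrite ler_pM2r// invr_gt0.
Qed.

(** This is [lam] with the linear forms already evaluated: it shows that the control depends on psi
    through Phi psi alone. *)
Fixpoint nested (q : nat -> R) (i : nat) : R :=
  if i is i'.+1 then sat sigma (eps i') (q i' + nested q i') else 0.

Lemma lam_nested (a : 'cV[R]_n) i :
  lam sigma eps a i = nested (fun j => p_map j a) i.
Proof. by elim: i => //= i ->. Qed.

Lemma nested0 i : nested (fun=> 0) i = 0.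
Proof.
elim: i => //= i ->; rewrite addr0 /sat mul0r saturation_id ?mulr0// normr0.
by rewrite divr_ge0.
Qed.

(** While levels i to k - 1 stay in the linear range of sigma, the nesting above level i collapses
    to a sum. *)
Lemma nested_linear (q : nat -> R) i k : (forall j, (i <= j < k)%N -> 0 < eps j) ->
  (forall j, (i <= j < k)%N -> `|q j + nested q j| <= 19 / 20 * eps j) ->
  (i <= k)%N -> nested q k = \sum_(i <= j < k) q j + nested q i.
Proof.
move=> ep; elim: k ep => [|k IH] ep qk ik.
  by move: ik; rewrite leqn0 => /eqP ->; rewrite big_geq// add0r.
move: ik; rewrite leq_eqVlt => /predU1P[->|ik]; first by rewrite big_geq// add0r.
have kk : (i <= k < k.+1)%N by rewrite -ltnS ik /=.
rewrite /= sat_id ?ep ?qk// big_nat_recr//= IH//.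
- by rewrite addrCA addrA.
- by move=> j /andP[ij jk]; apply: ep; rewrite ij (leq_trans jk).
- by move=> j /andP[ij jk]; apply: qk; rewrite ij (leq_trans jk).
Qed.

End NestedSaturation.

(** * Geometric decay of the quantization ranges *)

Section Quantizer.
Context {R : realType} (n : nat).

(** The last range is exactly halved. Each earlier one is halved and driven by ranges already known
    to decay like (3/4)^k; the slack between 1/2 and 3/4 absorbs this coupling, however large F is,
    at the cost of a larger constant. That constant is fixed before the sequence and its initial
    size [A]. *)
Lemma halving_recurrence_decay (F : nat -> R) (i : nat) : (forall j, 0 <= F j) ->
  exists2 C, 0 <= C & forall (L : nat -> nat -> R) A,
    (forall k j, (i <= j < n)%N ->
       L k.+1 j = L k j / 2 + F j * \sum_(j.+1 <= l < n) L k.+1 l) ->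
    (forall j, (i <= j < n)%N -> 0 <= L 0%N j <= A) ->
    forall k j, (i <= j < n)%N -> 0 <= L k j <= C * A * (3 / 4) ^+ k.
Proof.
move=> F0.
have [d] := ubnP (n - i); elim: d i => // d IH i nid.
have [ni|ltin] := leqP n i.
  exists 0 => // L A _ _ k j /andP[ij jn].
  by have := leq_trans (leq_ltn_trans ij jn) ni; rewrite ltnn.
have [|C C0 HC] := IH i.+1; first by lia.
(* The factor 4 makes the coupling at most 3/16 of C' A (3/4)^k, and 1/2 + 3/16 < 3/4; the 1 takes
   care of k = 0. *)
pose C' := Num.max 1 (4 * (F i * (n%:R * C))).
have C'1 : 1 <= C' by rewrite le_max lexx.
have C'D : 4 * (F i * (n%:R * C)) <= C' by rewrite le_max lexx orbT.
exists (C + C'); first by rewrite addr_ge0// (le_trans ler01).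
move=> L A LL L0 k j /andP[ij jn].
have A0 : 0 <= A by case/andP: (L0 j (introT andP (conj ij jn))) => /le_trans; exact.
have rk k' : 0 <= (3 / 4 : R) ^+ k' by rewrite exprn_ge0.
have {}HC k' l : (i.+1 <= l < n)%N -> 0 <= L k' l <= C * A * (3 / 4) ^+ k'.
  apply: HC => [k2 j2 /andP[ij2 j2n]|j2 /andP[ij2 j2n]].
    by apply: LL; rewrite ltnW.
  by apply: L0; rewrite ltnW.
have HS k' : 0 <= \sum_(i.+1 <= l < n) L k' l <= n%:R * (C * A * (3 / 4) ^+ k').
  apply/andP; split.
    by rewrite big_seq sumr_ge0// => l; rewrite mem_index_iota => /(HC k')/andP[].
  apply: le_trans (_ : \sum_(i.+1 <= l < n) (C * A * (3 / 4) ^+ k') <= _).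
    rewrite big_seq [leRHS]big_seq ler_sum// => l.
    by rewrite mem_index_iota => /(HC k')/andP[].
  rewrite big_const_nat iter_addr_0 -[leLHS]mulr_natl ler_wpM2r ?mulr_ge0//.
  by rewrite ler_nat leq_subr.
have Hi k' : 0 <= L k' i <= C' * A * (3 / 4) ^+ k'.
  elim: k' => [|k' IHk].
    rewrite expr0 mulr1; have /andP[-> L0A] : 0 <= L 0%N i <= A by apply: L0; rewrite leqnn.
    by rewrite (le_trans L0A)//= ler_peMl.
  rewrite LL ?leqnn//; case/andP: IHk => Lk0 LkC; case/andP: (HS k'.+1) => S0 SC.
  apply/andP; split; first by rewrite addr_ge0 ?divr_ge0 ?mulr_ge0.
  have h1 : F i * \sum_(i.+1 <= l < n) L k'.+1 l <=
      F i * (n%:R * (C * A * (3 / 4) ^+ k'.+1)) by rewrite ler_wpM2l.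
  have h2 : 4 * (F i * (n%:R * C)) * (A * (3 / 4) ^+ k') <= C' * (A * (3 / 4) ^+ k').
    by rewrite ler_wpM2r// mulr_ge0.
  apply: le_trans (lerD (ler_wpM2r _ LkC) h1) _ => //.
  rewrite exprS; move: h2; set r := (3 / 4) ^+ k' => h2.
  have -> : F i * (n%:R * (C * A * (3 / 4 * r))) =
    3 / 16 * (4 * (F i * (n%:R * C)) * (A * r)) by field.
  have : 3 / 16 * (4 * (F i * (n%:R * C)) * (A * r)) <= 3 / 16 * (C' * (A * r)).
    by rewrite ler_pM2l.
  have : 0 <= C' * (A * r) by rewrite !mulr_ge0// ?rk// (le_trans ler01).
  have -> : C' * A * r / 2 = C' * (A * r) / 2 by field.
  have -> : C' * A * (3 / 4 * r) = 3 / 4 * (C' * (A * r)) by field.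
  by lra.
have CC c c' : 0 <= c' -> (c * A * (3 / 4) ^+ k) <= ((c + c') * A * (3 / 4) ^+ k).
  by move=> c'0; rewrite ler_wpM2r// ler_wpM2r// lerDl.
move: ij; rewrite leq_eqVlt => /predU1P[<-|ij].
  case/andP: (Hi k) => -> /le_trans; apply; rewrite (addrC C); exact: CC.
have /andP[-> /le_trans] : 0 <= L k j <= C * A * (3 / 4) ^+ k by apply: HC; rewrite ij.
by apply; apply: CC; rewrite (le_trans ler01).
Qed.

End Quantizer.

(** * The loop in p-coordinates *)

Lemma norm_sum_nat_le {R : realType} (n a : nat) (f : nat -> R) (c : R) : 0 <= c ->
  (forall j, (a <= j < n)%N -> `|f j| <= c) ->
  `|\sum_(a <= j < n) f j| <= n%:R * c.
Proof.
move=> c0 fc; apply: le_trans (ler_norm_sum _ _ _) _.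
apply: le_trans (_ : \sum_(a <= j < n) c <= _).
  by rewrite big_seq [leRHS]big_seq ler_sum// => j; rewrite mem_index_iota => /fc.
by rewrite big_const_nat iter_addr_0 -[leLHS]mulr_natl ler_wpM2r// ler_nat leq_subr.
Qed.

Section ReducedLoop.
Context {R : realType} (n m : nat) (theta kappa : R) (sigma : R -> R)
  (eps : nat -> R) (Lip : nat -> R -> R) (A : R).
Hypothesis n0 : (0 < n)%N.
Hypothesis m0 : (0 < m)%N.
Hypothesis theta0 : 0 < theta.
Hypothesis kappa0 : 0 < kappa.
Hypothesis sigma_sat : is_saturation sigma.
Hypothesis eps_gt0 : forall i, (i < n)%N -> 0 < eps i.
Hypothesis eps_step : forall i, (i.+1 < n)%N -> eps i.+1 = 30 * eps i.
Hypothesis eps_top : forall i, (i < n)%N -> eps i <= 1 / 30.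
Hypothesis eps_bot : forall i, (i < n)%N -> eps 0%N <= eps i.
Hypothesis small_delay : 180 * (n%:R * (n%:R + 1)) * theta <= kappa * eps 0%N.
Hypothesis eps_pow : 3 ^+ n * eps 0%N <= 1 / 10.
Hypothesis Lip_ge0 : forall i B, 0 <= Lip i B.
Hypothesis A_ge0 : 0 <= A.

(* [lra] inspects every hypothesis, and fails if a section hypothesis was cleared. *)
Ltac linear :=
  repeat match goal with H : forall _, _ |- _ =>
    assert_fails (first [constr_eq H eps_gt0 | constr_eq H eps_step | constr_eq H eps_top
      | constr_eq H eps_bot | constr_eq H Lip_ge0]); clear H end; lra.

Local Notation Delta := (m%:R * theta).

Definition off_grid (s : R) : Prop := forall j : nat, s <> j%:R * theta.

(** The value of lambda_n at psi, which is zero up to the first reception at theta and xi(. - theta)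
    afterwards. *)
Definition delayed_control (q : nat -> R -> R) (s : R) : R :=
  if s <= theta then 0 else nested sigma eps (fun j => q j (s - theta)) n.

Definition p_rate (p q g : nat -> R -> R) (i : nat) (s : R) : R :=
  kappa^-1 * (\sum_(i.+1 <= j < n) p j s - delayed_control q s) + g i s.

(* [p] and [q] are the coordinates Phi x and Phi xi, [L k] is the quantization
   range ell just before the sampling time t_k, [g] and [g'] collect the nonlinear
   terms along x and xi, and [p - q] is the error that the quantizer corrects. *)
Record reduced_loop (F : nat -> R) (p q g g' : nat -> R -> R)
    (L : nat -> nat -> R) : Prop := ReducedLoop {
  rl_p0 : forall i, (i < n)%N -> p i r @[r --> 0^'+] --> p i 0;
  rl_pc : forall i s, (i < n)%N -> 0 < s -> {for s, continuous (p i)};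
  rl_pd : forall i s, (i < n)%N -> 0 < s -> off_grid s ->
    is_derive s (1 : R) (p i) (p_rate p q g i s);
  rl_zc : forall i s, (i < n)%N -> 0 < s -> (forall k : nat, s <> k%:R * Delta) ->
    {for s, continuous (fun r => p i r - q i r)};
  rl_zl : forall i s, (i < n)%N -> 0 < s ->
    p i r - q i r @[r --> s^'-] --> p i s - q i s;
  rl_zd : forall i s, (i < n)%N -> 0 < s -> off_grid s ->
    is_derive s (1 : R) (fun r => p i r - q i r)
      (kappa^-1 * \sum_(i.+1 <= j < n) (p j s - q j s) + (g i s - g' i s));
  rl_zj : forall i (k : nat), (i < n)%N ->
    p i r - q i r @[r --> (k%:R * Delta)^'+] -->
    (p i (k%:R * Delta) - q i (k%:R * Delta)) -
    Num.sg (p i (k%:R * Delta) - q i (k%:R * Delta)) * L k i / 4;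
  rl_p_init : forall i, (i < n)%N -> `|p i 0| <= L 0%N i;
  rl_z_init : forall i, (i < n)%N -> `|p i 0 - q i 0| <= L 0%N i / 2;
  rl_L0 : forall i, (i < n)%N -> 0 <= L 0%N i <= A;
  rl_L : forall k i, (i < n)%N ->
    L k.+1 i = L k i / 2 + Delta * F i * \sum_(i.+1 <= l < n) L k.+1 l;
  rl_g_small : forall i s c, (i < n)%N -> 0 <= s -> 0 <= c <= 1 ->
    (forall j, (i < j < n)%N -> `|p j s| <= c) ->
    kappa * `|g i s| <= eps 0%N * (c ^+ 2 / 20);
  rl_g_bound : forall i s B, (i < n)%N -> 0 <= s ->
    (forall j, (i < j < n)%N -> `|p j s| <= B) -> `|g i s| <= Lip i B;
  rl_g_lip : forall i s B, (i < n)%N -> 0 <= s ->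
    (forall j, (i < j < n)%N -> `|p j s| <= B /\ `|q j s| <= B) ->
    `|g i s - g' i s| <= Lip i B * \sum_(i.+1 <= j < n) `|p j s - q j s| }.

Section Trajectory.
Variables (F : nat -> R) (p q g g' : nat -> R -> R) (L : nat -> nat -> R).
Hypothesis rl : reduced_loop F p q g g' L.

Let z i s := p i s - q i s.
Let l i s := L (gridn Delta s) i.

Let Delta0 : 0 < Delta.
Proof. by rewrite mulr_gt0// ltr0n. Qed.

Lemma p_dist_le i a b c : (i < n)%N -> 0 <= a <= b ->
  (forall s, a < s < b -> off_grid s -> `|p_rate p q g i s| <= c) ->
  `|p i b - p i a| <= c * (b - a).
Proof.
move=> ltin /andP[a0]; rewrite le_eqVlt => /predU1P[<-|ab] pc.
  by rewrite !subrr normr0 mulr0.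
apply: dist_le_of_right_derivative => //.
- move: a0; rewrite le_eqVlt => /predU1P[<-|a0]; first exact: (rl_p0 _ _ _ _ _ _ rl).
  by apply: cvg_at_right_filter; exact: (rl_pc _ _ _ _ _ _ rl).
- by move=> s /andP[? ?]; apply: (rl_pc _ _ _ _ _ _ rl) => //; linear.
- by apply: cvg_at_left_filter; apply: (rl_pc _ _ _ _ _ _ rl) => //; linear.
move=> s /andP[as1 sb]; have s0 := le_trans a0 as1.
have h := near_right_off_grid theta s theta0 s0.
near=> r; have [r0 rg] : 0 < r /\ off_grid r by near: r.
have sr : s < r by near: r; exact: nbhs_right_gt.
have rb : r < b by near: r; exact: nbhs_right_lt.
have [pd pD] := rl_pd _ _ _ _ _ _ rl i r ltin r0 rg.
by split => //; rewrite pD; apply: pc => //; apply/andP; split; linear.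
Unshelve. all: by end_near. Qed.

(* The correction at a sampling time leaves an error of at most a quarter of the
   range, and the drift until the next one is at most half of the [F i] term in the
   update of the range. *)
Lemma tracking_error i B : (i < n)%N -> kappa^-1 + Lip i B <= F i ->
  (forall j s, (i < j < n)%N -> 0 <= s ->
     [/\ `|p j s| <= B, `|q j s| <= B & `|z j s| <= l j s / 2]) ->
  forall s, 0 <= s -> `|z i s| <= l i s / 2.
Proof.
move=> ltin Fi IH.
have F0 : 0 <= F i by rewrite (le_trans _ Fi)// addr_ge0// invr_ge0 ltW.
have step k : `|z i (k%:R * Delta)| <= L k i / 2 -> forall s,
    k%:R * Delta < s <= k.+1%:R * Delta -> `|z i s| <= L k.+1 i / 2.
  move=> zk s /andP[ks sk].
  have kD0 : 0 <= k%:R * Delta by rewrite mulr_ge0// ltW.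
  pose w := z i (k%:R * Delta) - Num.sg (z i (k%:R * Delta)) * L k i / 4.
  have wL : `|w| <= L k i / 4.
    rewrite /w; move: zk; set y := z i _; have [y0|y0|->] := ltrgt0P y.
    - by rewrite gtr0_sg// => yk; rewrite ler_norml; apply/andP; split; linear.
    - by rewrite ltr0_sg// => yk; rewrite ler_norml; apply/andP; split; linear.
    - by rewrite sgr0 !mul0r subr0 normr0; linear.
  pose S := \sum_(i.+1 <= j < n) L k.+1 j.
  have : `|z i s - w| <= F i * (S / 2) * (s - k%:R * Delta).
    have kg r : k%:R * Delta < r < s -> forall k' : nat, r <> k'%:R * Delta.
      move=> /andP[kr rs] k' rk'; move: kr (lt_le_trans rs sk).
      by rewrite rk' !ltr_pM2r// !ltr_nat ltnS => kk' /(leq_trans kk'); rewrite ltnn.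
    apply: dist_le_of_right_derivative => //.
    - exact: (rl_zj _ _ _ _ _ _ rl).
    - by move=> r rks; apply: (rl_zc _ _ _ _ _ _ rl) => //; [case/andP: rks; linear|exact: kg].
    - by apply: (rl_zl _ _ _ _ _ _ rl) => //; linear.
    move=> r /andP[kr rs]; have r0 := le_trans kD0 kr.
    have h := near_right_off_grid theta r theta0 r0.
    near=> r'; have [r'0 rg] : 0 < r' /\ off_grid r' by near: r'.
    have rr' : r < r' by near: r'; exact: nbhs_right_gt.
    have r's : r' < s by near: r'; exact: nbhs_right_lt.
    have [zd zD] := rl_zd _ _ _ _ _ _ rl i r' ltin r'0 rg.
    split => //; rewrite zD.
    (* Inside the cell the range already has its updated value. This is why the update of level i is
       implicit, with the new ranges of the later levels on its right-hand side. *)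
    have lr' j : l j r' = L k.+1 j.
      by rewrite /l (gridnP _ _ k)//; apply/andP; split; linear.
    have Sz : \sum_(i.+1 <= j < n) `|z j r'| <= S / 2.
      rewrite /S mulr_suml big_seq [leRHS]big_seq ler_sum// => j.
      rewrite mem_index_iota => ij; rewrite -lr'.
      by case: (IH j r' ij (ltW r'0)).
    have gl : `|g i r' - g' i r'| <= Lip i B * \sum_(i.+1 <= j < n) `|z j r'|.
      apply: (rl_g_lip _ _ _ _ _ _ rl) => //; first exact: ltW.
      by move=> j ij; case: (IH j r' ij (ltW r'0)).
    apply: le_trans (_ : (kappa^-1 + Lip i B) * \sum_(i.+1 <= j < n) `|z j r'| <= _).
      rewrite mulrDl; apply: le_trans (ler_normD _ _) _; apply: lerD => //.
      rewrite normrM gtr0_norm ?invr_gt0//; apply: ler_wpM2l.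
        by rewrite invr_ge0 ltW.
      exact: ler_norm_sum.
    by apply: ler_pM => //; [rewrite addr_ge0// invr_ge0 ltW|rewrite sumr_ge0].
  have S0 : 0 <= S.
    rewrite /S big_seq sumr_ge0// => j; rewrite mem_index_iota => ij.
    have ks0 : 0 <= k.+1%:R * Delta by rewrite mulr_ge0// ltW.
    have [_ _] := IH j (k.+1%:R * Delta) ij ks0.
    rewrite /l (gridnP _ _ k)// ?lexx ?ltr_pM2r ?ltr_nat ?ltnSn//.
    by move=> /(le_trans (normr_ge0 _)); linear.
  have sD : s - k%:R * Delta <= Delta.
    by move: sk; rewrite -natr1 mulrDl mul1r; linear.
  have : F i * (S / 2) * (s - k%:R * Delta) <= F i * (S / 2) * Delta.
    by rewrite ler_wpM2l// mulr_ge0// divr_ge0.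
  rewrite (rl_L _ _ _ _ _ _ rl k i ltin) -/S => h1 h2.
  have -> : z i s = w + (z i s - w) by ring.
  apply: le_trans (ler_normD _ _) _.
  have -> : (L k i / 2 + Delta * F i * S) / 2 = L k i / 4 + F i * (S / 2) * Delta by field.
  by linear.
have all_k k : `|z i (k%:R * Delta)| <= L k i / 2.
  elim: k => [|k IHk]; first by rewrite mul0r; exact: (rl_z_init _ _ _ _ _ _ rl).
  by apply: step => //; rewrite lexx ltr_pM2r// ltr_nat ltnSn.
move=> s; rewrite le_eqVlt => /predU1P[<-|s0].
  by rewrite /l gridn0; exact: (rl_z_init _ _ _ _ _ _ rl).
have [k ks] := ex_grid_cell Delta s Delta0 s0.
by rewrite /l (gridnP _ _ k)//; exact: step.
Unshelve. all: by end_near. Qed.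

(** The outermost saturation below level j has height eps_(j-1). The ratio 30 thus makes all inner
    levels together a small perturbation of level j. *)
Lemma nested_bound (x : nat -> R) j : (j < n)%N ->
  `|nested sigma eps x j| <= eps j / 30.
Proof.
case: j => [|j] jn; first by rewrite /= normr0 divr_ge0 ?ltW// eps_gt0.
rewrite eps_step// [30 * _]mulrC mulfK//.
by apply: sat_bound => //; apply: eps_gt0; exact: ltnW.
Qed.

Lemma delayed_control_bound s : `|delayed_control q s| <= 1 / 30.
Proof.
rewrite /delayed_control; case: ifP => _; first by rewrite normr0.
case: n n0 eps_gt0 eps_top => // n' _ e0 e1 /=.
by apply: le_trans (e1 n' (ltnSn _)); apply: sat_bound => //; exact: e0.
Qed.

Lemma g_small i s : (i < n)%N -> 0 <= s ->
  (forall j, (i < j < n)%N -> `|p j s| <= eps j / 2) ->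
  kappa * `|g i s| <= eps 0%N / 1000.
Proof.
move=> ltin s0 ps.
have e0 : 0 < eps 0%N by exact: eps_gt0.
apply: (@le_trans _ _ (eps 0%N * ((1 / 60) ^+ 2 / 20))); last by rewrite ler_pM2l//; linear.
apply: (rl_g_small _ _ _ _ _ _ rl) => // [|j ij]; first by linear.
by apply: le_trans (ps j ij) _; have := eps_top j; case/andP: ij => _ -> /(_ isT); linear.
Qed.

Lemma p_rate_bound i s : (i < n)%N -> 0 <= s ->
  (forall j, (i < j < n)%N -> `|p j s| <= eps j / 2) ->
  `|p_rate p q g i s| <= n%:R / kappa.
Proof.
move=> ltin s0 ps; rewrite ler_pdivlMr// mulrC.
have n1 : 1 <= n%:R :> R by rewrite ler1n.
have gs := g_small i s ltin s0 ps.
have Us := delayed_control_bound s.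
have Ss : `|\sum_(i.+1 <= j < n) p j s| <= n%:R * (1 / 60).
  apply: norm_sum_nat_le => // j ij; apply: le_trans (ps j ij) _.
  by have := eps_top j; case/andP: ij => _ -> /(_ isT); linear.
have e1 := eps_top 0 n0.
rewrite -[kappa]gtr0_norm// -normrM /p_rate mulrDr mulrA divff ?gt_eqF// mul1r.
apply: le_trans (ler_normD _ _) _; rewrite normrM (gtr0_norm kappa0).
have := ler_normB (\sum_(i.+1 <= j < n) p j s) (delayed_control q s).
by linear.
Qed.

Lemma p_delay_le i s T0 : (i < n)%N -> 0 <= T0 -> T0 + theta <= s ->
  (forall j r, (i < j < n)%N -> T0 <= r -> `|p j r| <= eps j / 2) ->
  `|p i s - p i (s - theta)| <= n%:R / kappa * theta.
Proof.
move=> ltin T00 Ts ps.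
have -> : n%:R / kappa * theta = n%:R / kappa * (s - (s - theta)) by rewrite subKr.
apply: p_dist_le => // [|r /andP[sr rs] _].
  by apply/andP; split; have := theta0; linear.
apply: p_rate_bound => // [|j ij]; first by linear.
by apply: ps => //; linear.
Qed.

(** [d] bounds the displacement of a coordinate during one delay. The lower bound on kappa / theta
    keeps it, even summed over all coordinates, a small fraction of the lowest saturation level. *)
Lemma delay_constants : let d := n%:R / kappa * theta in
  [/\ 0 <= d, n%:R * d <= eps 0%N / 180 & d <= eps 0%N / 180].
Proof.
have n1 : 1 <= n%:R :> R by rewrite ler1n.
have d0 : 0 <= n%:R / kappa * theta.
  by apply: mulr_ge0; [apply: divr_ge0 => //; exact: ltW|exact: ltW].
have nd : n%:R * (n%:R / kappa * theta) <= eps 0%N / 180.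
  have -> : n%:R * (n%:R / kappa * theta) = n%:R * n%:R * theta / kappa by ring.
  rewrite ler_pdivrMr//.
  have : 0 <= n%:R * theta by apply: mulr_ge0 => //; exact: ltW.
  by move: small_delay; linear.
split => //; apply: le_trans nd.
by rewrite ler_peMl.
Qed.

(* As soon as the later levels are unsaturated, their contributions telescope and
   only the i-th saturation is left in the dynamics of [p i]. *)
Lemma control_rate i s T0 : (i < n)%N -> 0 < T0 -> T0 + theta <= s ->
  (forall j r, (i < j < n)%N -> T0 <= r -> `|p j r| <= eps j / 2) ->
  (forall j r, (i <= j < n)%N -> T0 <= r -> `|z j r| <= eps 0%N / (100 * n%:R)) ->
  `|kappa * p_rate p q g i s +
     sat sigma (eps i) (q i (s - theta) + nested sigma eps (fun j => q j (s - theta)) i)|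
    <= eps 0%N / 50.
Proof.
move=> ltin T00 Ts ps zs.
have n1 : 1 <= n%:R :> R by rewrite ler1n.
have e0 : 0 < eps 0%N by exact: eps_gt0.
have th0 := theta0.
have s0 : 0 < s by linear.
have [d0 nd _] := delay_constants; set d := _ * theta in d0 nd.
have gs : kappa * `|g i s| <= eps 0%N / 1000.
  by apply: g_small => // [|j ij]; [exact: ltW|apply: ps => //; linear].
set e := eps 0%N / (100 * n%:R) in zs.
have ne : n%:R * e = eps 0%N / 100 by rewrite /e; field; rewrite gt_eqF// (lt_le_trans _ n1).
have e_ge0 : 0 <= e by rewrite /e divr_ge0 ?ltW// mulr_gt0// (lt_le_trans _ n1).
have ele : e <= eps 0%N / 100 by rewrite -ne ler_peMl.
rewrite /p_rate /delayed_control; have -> : (s <= theta) = false by apply/negbTE; rewrite -ltNge; linear.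
set x := fun j => q j (s - theta).
have xb j : (i <= j < n)%N -> `|p j s - x j| <= d + e.
  move=> ij; have jn : (j < n)%N by case/andP: ij.
  have -> : p j s - x j = (p j s - p j (s - theta)) + z j (s - theta) by rewrite /x /z; ring.
  apply: le_trans (ler_normD _ _) _; apply: lerD; last by apply: zs => //; linear.
  apply: (p_delay_le j s T0) => // [|k r /andP[jk kn] Tr]; first exact: ltW.
  by apply: ps => //; rewrite kn andbT (leq_ltn_trans _ jk)//; case/andP: ij.
(* Above level i the argument of each saturation is at most eps_j / 2 + e + eps_j / 30, well inside
   the linear range 19/20 eps_j. *)
rewrite (@nested_linear R sigma eps sigma_sat x i.+1 n) //; last first.
- move=> j /andP[ij jn]; apply: le_trans (ler_normD _ _) _.
  have ej := eps_bot j jn.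
  have e0j := eps_gt0 j jn.
  have nj := nested_bound x j jn.
  have pj : `|p j (s - theta)| <= eps j / 2 by apply: ps; [rewrite ij|linear].
  have zj : `|z j (s - theta)| <= e by apply: zs; [rewrite ltnW|linear].
  have : `|x j| <= eps j / 2 + e.
    have -> : x j = p j (s - theta) - z j (s - theta) by rewrite /x /z; ring.
    by apply: le_trans (ler_normB _ _) _; linear.
  by linear.
- by move=> j /andP[_ jn]; exact: eps_gt0.
rewrite [nested _ _ _ i.+1]/=; set w := sat _ _ _.
(* The later p_j cancel their delayed and quantized copies up to n (d + e), which is at most eps_0 /
   180 + eps_0 / 100; with the nonlinear term this stays below eps_0 / 50. *)
have -> : kappa * (kappa^-1 * (\sum_(i.+1 <= j < n) p j s -
     (\sum_(i.+1 <= j < n) x j + w)) + g i s) + w =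
   \sum_(i.+1 <= j < n) (p j s - x j) + kappa * g i s.
  by rewrite mulrDr mulrA divff ?gt_eqF// mul1r sumrB; ring.
have : `|\sum_(i.+1 <= j < n) (p j s - x j)| <= n%:R * (d + e).
  apply: norm_sum_nat_le => [|j /andP[ij jn]]; first by rewrite addr_ge0.
  by apply: xb; rewrite ltnW.
have := ler_normD (\sum_(i.+1 <= j < n) (p j s - x j)) (kappa * g i s).
rewrite normrM (gtr0_norm kappa0) mulrDr.
by linear.
Qed.

(** Outside [- eps_i / 2, eps_i / 2] the i-th saturation pushes p_i back at speed at least 2/5 eps_i
    / kappa; [descent], applied to p_i and to - p_i, turns this into an arrival time. *)
Lemma stage i T0 B : (i < n)%N -> 0 < T0 ->
  (forall j r, (i < j < n)%N -> T0 <= r -> `|p j r| <= eps j / 2) ->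
  (forall j r, (i <= j < n)%N -> T0 <= r -> `|z j r| <= eps 0%N / (100 * n%:R)) ->
  let T1 := T0 + theta in
  `|p i T1| <= B -> forall s, T1 <= s ->
  T1 + (B - eps i / 2) / (2 / 5 * eps i / kappa) <= s -> `|p i s| <= eps i / 2.
Proof.
move=> ltin T00 ps zs T1 pB s T1s Bs.
have th0 := theta0.
have n1 : 1 <= n%:R :> R by rewrite ler1n.
have e0 : 0 < eps 0%N by exact: eps_gt0.
have ei0 := eps_gt0 i ltin.
have e0i := eps_bot i ltin.
have [d0 _ dle] := delay_constants; set d := _ * theta in d0 dle.
have ele : eps 0%N / (100 * n%:R) <= eps 0%N / 100.
  by rewrite ler_pM2l// lef_pV2 ?posrE ?mulr_gt0// ?(lt_le_trans _ n1)// ler_peMr.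
have c0 : 0 < 2 / 5 * eps i / kappa by rewrite divr_gt0// mulr_gt0.
have main r : T1 <= r ->
    (eps i / 2 <= p i r -> p_rate p q g i r <= - (2 / 5 * eps i / kappa)) /\
    (p i r <= - (eps i / 2) -> 2 / 5 * eps i / kappa <= p_rate p q g i r).
  move=> T1r.
  have := control_rate i r T0 ltin T00 T1r ps zs.
  have qd : `|p i r - q i (r - theta)| <= d + eps 0%N / 100.
    have -> : p i r - q i (r - theta) =
      (p i r - p i (r - theta)) + z i (r - theta) by rewrite /z; ring.
    apply: le_trans (ler_normD _ _) _; apply: lerD.
      by apply: (p_delay_le i r T0) => //; exact: ltW.
    by apply: le_trans ele; apply: zs; [rewrite leqnn|rewrite /T1 in T1r; linear].
  have := nested_bound (fun j => q j (r - theta)) i ltin.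
  set v := nested _ _ _ i; set y := q i (r - theta).
  rewrite -/y in qd; move: qd.
  rewrite !ler_norml => /andP[qd1 qd2] /andP[v1 v2] /andP[w1 w2].
  (* Delay, quantization and inner levels take at most 1/180, 1/100 and 1/30 of eps_i from eps_i /
     2, which leaves more than 11/25. After the eps_0 / 50 of [control_rate] at least 2/5 remain. *)
  have sid : `|11 / 25 * eps i| <= 19 / 20 * eps i.
    by rewrite ger0_norm; [rewrite ler_pM2r//; linear|rewrite mulr_ge0// ltW].
  have sid' : `|- (11 / 25 * eps i)| <= 19 / 20 * eps i by rewrite normrN.
  split => h.
    have : 11 / 25 * eps i <= sat sigma (eps i) (y + v).
      rewrite -[leLHS](sat_id sigma sigma_sat (eps i) _ ei0 sid).
      by apply: sat_nondecreasing => //; linear.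
    move=> sy; rewrite lerNr ler_pdivrMr//; linear.
  have : sat sigma (eps i) (y + v) <= - (11 / 25 * eps i).
    rewrite -[leRHS](sat_id sigma sigma_sat (eps i) _ ei0 sid').
    by apply: sat_nondecreasing => //; linear.
  by move=> sy; rewrite ler_pdivrMr//; linear.
have T10 : 0 < T1 by rewrite /T1; linear.
rewrite ler_norml; apply/andP; split.
  rewrite lerNl.
  apply: (@descent R (fun r => - p i r) T1 B (eps i / 2) _ c0) => //.
  - by move=> r T1r; apply: cvgN; apply: (rl_pc _ _ _ _ _ _ rl) => //; linear.
  - move=> r T1r; have r0 : 0 <= r by linear.
    have h := near_right_off_grid theta r theta0 r0.
    near=> r'; have [r'0 rg] : 0 < r' /\ off_grid r' by near: r'.
    have rr' : r < r' by near: r'; exact: nbhs_right_gt.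
    have [pd pD] := rl_pd _ _ _ _ _ _ rl i r' ltin r'0 rg.
    split; first exact: derivableN.
    rewrite deriveN// pD lerNr => h2.
    by rewrite lerN2; apply: (main r' _).2; linear.
  - by apply: le_trans pB; rewrite -normrN ler_norm.
apply: (@descent R (p i) T1 B (eps i / 2) _ c0) => //.
- by move=> r T1r; apply: (rl_pc _ _ _ _ _ _ rl) => //; linear.
- move=> r T1r; have r0 : 0 <= r by linear.
  have h := near_right_off_grid theta r theta0 r0.
  near=> r'; have [r'0 rg] : 0 < r' /\ off_grid r' by near: r'.
  have rr' : r < r' by near: r'; exact: nbhs_right_gt.
  have [pd pD] := rl_pd _ _ _ _ _ _ rl i r' ltin r'0 rg.
  by split => //; rewrite pD; apply: (main r' _).1; linear.
- by apply: le_trans pB; rewrite ler_norm.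
Unshelve. all: by end_near. Qed.

Lemma sum_exp3_le (i : nat) : \sum_(0 <= j < i) 3 ^+ j <= 3 ^+ i / 2 :> R.
Proof.
elim: i => [|i IH]; first by rewrite big_geq//; linear.
by rewrite big_nat_recr//= exprS; linear.
Qed.

(* With every level unsaturated, the system is kappa p_i' = - (p_0 + .. + p_i) up to
   terms that are small relative to the recent past. *)
Lemma linear_rate i (s T0 dl Y : R) : (i < n)%N -> 0 < T0 -> T0 + 2 * theta <= s ->
  expR (2 * dl * theta) <= 2 -> 0 <= dl ->
  (forall j (r : R), (j < n)%N -> T0 <= r -> `|p j r| <= eps j / 2) ->
  (forall j (r : R), (j < n)%N -> T0 <= r -> `|z j r| <= eps 0%N / (100 * n%:R)) ->
  (forall j (r : R), (j < n)%N -> s - 2 * theta <= r <= s ->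
     `|p j r| <= 3 ^+ j * (Y * expR (dl * (s - r)))) ->
  (forall j (r : R), (j < n)%N -> s - 2 * theta <= r <= s ->
     `|z j r| <= Y * expR (dl * (s - r)) / (100 * n%:R)) ->
  `|kappa * p_rate p q g i s + \sum_(0 <= j < i.+1) p j s| <= Y / 40.
Proof.
move=> ltin T00 Ts e2 dl0 pT zT pY zY.
have th0 := theta0.
have n1 : 1 <= n%:R :> R by rewrite ler1n.
have ngt0 : 0 < n%:R :> R by rewrite (lt_le_trans _ n1).
have e0 : 0 < eps 0%N by exact: eps_gt0.
have Y0 : 0 <= Y.
  have := pY 0%N s n0; rewrite expr0 subrr mulr0 expR0 mulr1 mul1r => h.
  by apply: le_trans (h _) => //; apply/andP; split; linear.
(* Over the last two delays the exponential weight is at most 2, so [d] bounds every coordinate and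
   c / (100 n) every error. *)
set c := 2 * Y; pose d := 3 ^+ n * c.
have c0 : 0 <= c by rewrite /c mulr_ge0.
have pw j : (j < n)%N -> 1 <= (3 ^+ j : R) <= 3 ^+ n.
  move=> jn; rewrite exprn_ege1 ?ler1n//= ler_weXn2l ?ler1n//; exact: ltnW.
have E2 r : s - 2 * theta <= r <= s -> Y * expR (dl * (s - r)) <= c.
  move=> /andP[r1 r2]; rewrite /c mulrC ler_wpM2r//; apply: le_trans e2.
  rewrite ler_expR [leRHS]mulrAC mulrC ler_wpM2r//; linear.
have pd j r : (j < n)%N -> s - 2 * theta <= r <= s -> `|p j r| <= d.
  move=> jn rs; apply: le_trans (pY j r jn rs) _; rewrite /d.
  apply: ler_pM; [by rewrite exprn_ge0|by rewrite mulr_ge0 ?expR_ge0| |exact: E2].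
  by case/andP: (pw j jn).
have zd j r : (j < n)%N -> s - 2 * theta <= r <= s -> `|z j r| <= c / (100 * n%:R).
  move=> jn rs; apply: le_trans (zY j r jn rs) _.
  by apply: ler_wpM2r (E2 r rs); rewrite invr_ge0 mulr_ge0// ltW.
have epd : eps 0%N * d <= c / 10.
  rewrite /d mulrA [eps _ * _]mulrC; have -> : c / 10 = 1 / 10 * c by ring.
  by rewrite ler_wpM2r.
have gd j r : (j < n)%N -> s - 2 * theta <= r <= s -> kappa * `|g j r| <= Y / 1000.
  move=> jn rs; case/andP: (rs) => r1 r2.
  (* The nonlinearity is quadratic: one factor is bounded by the absolute size 1/60, the other by
     [d]. This makes it linear in Y, and eps_0 3^n <= 1/10 absorbs the factor 3^n in [d]. *)
  pose a := Num.min (1 / 60) d.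
  have d0 : 0 <= d by rewrite /d mulr_ge0// exprn_ge0.
  have a0 : 0 <= a by rewrite /a le_min d0 andbT; linear.
  have a60 : a <= 1 / 60 by rewrite /a ge_min lexx.
  have ad : a <= d by rewrite /a ge_min lexx orbT.
  apply: (@le_trans _ _ (eps 0%N * (a ^+ 2 / 20))).
    apply: (rl_g_small _ _ _ _ _ _ rl) => //; [by linear|by linear|].
    move=> k /andP[_ kn]; rewrite /a le_min pd// andbT.
    apply: le_trans (pT k r kn _) _; first by linear.
    by have := eps_top k kn; linear.
  have : a ^+ 2 <= 1 / 60 * d by rewrite expr2 ler_pM.
  rewrite -(ler_pM2l e0) => h; move: epd; rewrite /c => h'; linear.
have delay_q r j : (j < n)%N -> s - theta <= r <= s -> `|q j (r - theta)| <= d + c / (100 * n%:R).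
  move=> jn /andP[r1 r2].
  have -> : q j (r - theta) = p j (r - theta) - z j (r - theta) by rewrite /z; ring.
  have rs : s - 2 * theta <= r - theta <= s by apply/andP; split; linear.
  by apply: le_trans (ler_normB _ _) _; apply: lerD; [exact: pd|exact: zd].
have lin r : s - theta <= r <= s ->
    delayed_control q r = \sum_(0 <= j < n) q j (r - theta).
  move=> /andP[r1 r2]; rewrite /delayed_control.
  have -> : (r <= theta) = false by apply/negbTE; rewrite -ltNge; linear.
  rewrite (@nested_linear R sigma eps sigma_sat _ 0%N n) ?addr0//.
  move=> j jn; apply: le_trans (ler_normD _ _) _.
  have ej := eps_bot j jn.
  have e0j := eps_gt0 j jn.
  have nj := nested_bound (fun k => q k (r - theta)) j jn.
  have pj : `|p j (r - theta)| <= eps j / 2 by apply: pT => //; linear.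
  have zj : `|z j (r - theta)| <= eps 0%N / (100 * n%:R) by apply: zT => //; linear.
  have ele : eps 0%N / (100 * n%:R) <= eps 0%N / 100.
    by rewrite ler_pM2l// lef_pV2 ?posrE ?mulr_gt0// ler_peMr.
  have : `|q j (r - theta)| <= eps j / 2 + eps 0%N / 100.
    have -> : q j (r - theta) = p j (r - theta) - z j (r - theta) by rewrite /z; ring.
    by apply: le_trans (ler_normB _ _) _; linear.
  by linear.
have nc : n%:R * (c / (100 * n%:R)) = c / 100 by field; rewrite gt_eqF.
have cd : c <= d.
  by rewrite /d ler_peMl// exprn_ege1 // ler1n.
(* A crude speed bound over the last delay, needed to compare p(s) with p(s - theta). Its own
   control term reaches back to s - 2 theta, which is why histories are two delays long. *)
have rate j r : (j < n)%N -> s - theta <= r <= s ->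
    `|p_rate p q g j r| <= (3 * n%:R * d) / kappa.
  move=> jn rs; case/andP: (rs) => r1 r2.
  have rs2 : s - 2 * theta <= r <= s by apply/andP; split; linear.
  rewrite ler_pdivlMr// mulrC -[kappa]gtr0_norm// -normrM /p_rate.
  rewrite mulrDr mulrA divff ?gt_eqF// mul1r lin//.
  have S1 : `|\sum_(j.+1 <= k < n) p k r| <= n%:R * d.
    apply: norm_sum_nat_le => [|k /andP[_ kn]]; last exact: pd.
    by rewrite (le_trans c0).
  have S2 : `|\sum_(0 <= k < n) q k (r - theta)| <= n%:R * (d + c / (100 * n%:R)).
    apply: norm_sum_nat_le => [|k /andP[_ kn]]; last exact: delay_q.
    by apply: addr_ge0; [exact: (le_trans c0)|rewrite divr_ge0// mulr_ge0// ltW].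
  rewrite mulrDr nc in S2.
  have gr := gd j r jn rs2.
  apply: le_trans (ler_normD _ _) _; rewrite normrM (gtr0_norm kappa0).
  apply: le_trans (lerD (ler_normB _ _) (lexx _)) _.
  have nd : d <= n%:R * d by rewrite ler_peMl// (le_trans c0).
  have Yc : Y <= c by rewrite /c; linear.
  by linear.
have pdel j : (j < n)%N -> `|p j s - q j (s - theta)| <=
    3 * n%:R * d / kappa * theta + c / (100 * n%:R).
  move=> jn.
  have -> : p j s - q j (s - theta) = (p j s - p j (s - theta)) + z j (s - theta) by rewrite /z; ring.
  apply: le_trans (ler_normD _ _) _; apply: lerD; last first.
    by apply: zd => //; apply/andP; split; linear.
  have -> : 3 * n%:R * d / kappa * theta = 3 * n%:R * d / kappa * (s - (s - theta)) by rewrite subKr.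
  apply: p_dist_le => // [|r /andP[r1 r2] _]; first by apply/andP; split; linear.
  by apply: rate => //; apply/andP; split; linear.
(* The control subtracts all levels and the chain adds those after i, so p_0 + .. + p_i is what must
   be compensated. The remainder is at most c / 600 + c / 100 + Y / 1000 <= Y / 40. *)
have -> : kappa * p_rate p q g i s + \sum_(0 <= j < i.+1) p j s =
    \sum_(0 <= j < n) (p j s - q j (s - theta)) + kappa * g i s.
  rewrite /p_rate mulrDr mulrA divff ?gt_eqF// mul1r lin; last by apply/andP; split; linear.
  rewrite sumrB (@big_cat_nat _ _ _ i.+1 0 n (fun=> true) (fun j => p j s))//=; ring.
have S : `|\sum_(0 <= j < n) (p j s - q j (s - theta))| <=
    n%:R * (3 * n%:R * d / kappa * theta + c / (100 * n%:R)).
  apply: norm_sum_nat_le => [|j /andP[_ jn]]; last exact: pdel.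
  by apply: le_trans (pdel 0%N n0).
rewrite mulrDr nc in S.
have [_ nd _] := delay_constants.
have S2 : n%:R * (3 * n%:R * d / kappa * theta) <= c / 600.
  have -> : n%:R * (3 * n%:R * d / kappa * theta) = 3 * (n%:R * (n%:R / kappa * theta)) * d.
    by field; rewrite gt_eqF.
  apply: le_trans (_ : 3 * (eps 0%N / 180) * d <= _); last by linear.
  by rewrite ler_wpM2r ?ler_pM2l// (le_trans c0).
have gs : kappa * `|g i s| <= Y / 1000 by apply: gd => //; apply/andP; split; linear.
apply: le_trans (ler_normD _ _) _; rewrite normrM (gtr0_norm kappa0).
by move: S S2; rewrite /c; linear.
Qed.

(* Since the sum of 3^j over j < i is at most 3^i / 2, the term - p_i dominates its
   predecessors in the norm max_j |p_j| / 3^j. *)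
Lemma exponential_stage (T0 T1 dl C N : R) : 0 < T0 -> T0 + 2 * theta <= T1 ->
  expR (2 * dl * theta) <= 2 -> 0 <= dl -> dl <= 3 / 10 / kappa -> 0 <= C -> 0 <= N ->
  (forall j (r : R), (j < n)%N -> T0 <= r -> `|p j r| <= eps j / 2) ->
  (forall j (r : R), (j < n)%N -> T0 <= r -> `|z j r| <= eps 0%N / (100 * n%:R)) ->
  (forall j (r : R), (j < n)%N -> T1 - 2 * theta <= r <= T1 ->
     `|p j r| <= N /\ `|q j r| <= N) ->
  (forall j (r : R), (j < n)%N -> T1 <= r -> `|z j r| <= C * N * expR (- (dl * (r - T1)))) ->
  forall j s, (j < n)%N -> T1 <= s ->
    `|p j s| <= 3 ^+ n * (100 * n%:R * (C + 2)) * N * expR (- (dl * (s - T1))).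
Proof.
move=> T00 T01 e2 dl0 dlk C0 N0 pT zT hist zC.
have th0 := theta0.
have n1 : 1 <= n%:R :> R by rewrite ler1n.
have ngt0 : 0 < n%:R :> R by rewrite (lt_le_trans _ n1).
(* [linear_rate] tolerates errors of size Y / (100 n). With this K the tolerance is (C + 2) N: it
   covers the decaying errors C N after T1 and the crude bound |p| + |q| <= 2 N before. *)
set K := 100 * n%:R * (C + 2).
have K200 : 200 <= K.
  have : 0 <= (n%:R - 1) * (C + 2) by rewrite mulr_ge0 ?subr_ge0// addr_ge0.
  by rewrite /K; linear.
(* [trap] starts from strict inequalities, which would fail for N = 0; hence N is enlarged to N1,
   and N1 tends to N. *)
suff main N1 : N < N1 -> forall (j : 'I_n) s, T1 <= s ->
    `|p j s| < 3 ^+ j * (K * N1 * expR (- (dl * (s - T1)))).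
  move=> j s jn T1s; apply/ler_addgt0Pl => e e0.
  set E := expR _.
  have E0 : 0 < E by exact: expR_gt0.
  have P0 : 0 < 3 ^+ n * K * E by rewrite !mulr_gt0 ?exprn_gt0//; linear.
  pose N1 := N + e / (3 ^+ n * K * E).
  have N1N : N < N1 by rewrite ltrDl divr_gt0.
  have := main N1 N1N (Ordinal jn) s T1s; rewrite -/E /= => /ltW /le_trans; apply.
  apply: le_trans (_ : 3 ^+ n * (K * N1 * E) <= _).
    rewrite ler_wpM2r//; first by rewrite !mulr_ge0 ?ltW//; linear.
    by rewrite ler_weXn2l ?ler1n// ltnW.
  have -> : 3 ^+ n * (K * N1 * E) = N1 * (3 ^+ n * K * E) by ring.
  rewrite /N1 mulrDl divfK ?gt_eqF//.
  by rewrite [leLHS](_ : _ = e + 3 ^+ n * K * N * E)//; ring.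
move=> N1N.
have N10 : 0 < N1 by exact: le_lt_trans N1N.
have KN200 : 200 * N1 <= K * N1 by rewrite ler_pM2r.
have KN : 0 < K * N1 by rewrite mulr_gt0//; linear.
pose E s := expR (dl * (s - T1)).
have E0 s : 0 < E s by exact: expR_gt0.
have Ed s := is_derive_expR_affine dl T1 s.
pose w j s := p j s * E s / 3 ^+ j.
have three j : 0 < 3 ^+ j :> R by rewrite exprn_gt0.
pose sgb (b : bool) : R := if b then 1 else -1.
pose phi (jb : 'I_n * bool) s := sgb jb.2 * w jb.1 s - K * N1.
have EV s : expR (- (dl * (s - T1))) = (E s)^-1 by rewrite expRN.
have E1 s : T1 <= s -> 1 <= E s.
  by move=> T1s; rewrite /E -expR0 ler_expR mulr_ge0// subr_ge0.
have phi0 jb s : phi jb s < 0 -> sgb jb.2 * p jb.1 s < 3 ^+ jb.1 * (K * N1 / E s).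
  rewrite /phi /w subr_lt0 => h.
  have -> : sgb jb.2 * p jb.1 s = sgb jb.2 * (p jb.1 s * E s / 3 ^+ jb.1) * (3 ^+ jb.1 / E s).
    by field; rewrite !gt_eqF.
  have -> : 3 ^+ jb.1 * (K * N1 / E s) = K * N1 * (3 ^+ jb.1 / E s) by ring.
  by rewrite ltr_pM2r// divr_gt0.
suff H jb s : T1 <= s -> phi jb s < 0.
  move=> j s T1s; rewrite EV ltr_norml ltrNl.
  have := phi0 (j, true) s (H _ _ T1s); have := phi0 (j, false) s (H _ _ T1s).
  by rewrite /= mul1r mulN1r => -> ->.
(* With this margin the derivative matters only where a weighted coordinate is at least 9/10 of the
   barrier. *)
apply: (@trap R _ phi T1 (K * N1 / 10)) => //.
- by rewrite divr_gt0.
- move=> [j b] {}s T1s /=; apply: cvgB; last exact: cvg_cst.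
  apply: cvgM; first exact: cvg_cst.
  apply: cvgM; last exact: cvg_cst.
  apply: cvgM; first by apply: (rl_pc _ _ _ _ _ _ rl) => //; linear.
  by apply: differentiable_continuous; apply/derivable1_diffP; have [] := Ed s.
- move=> [j b] /=; rewrite /phi /w /E subrr mulr0 expR0 mulr1 subr_lt0 /=.
  have T1T1 : T1 - 2 * theta <= T1 <= T1 by apply/andP; split; linear.
  have [pN _] := hist j T1 (ltn_ord j) T1T1.
  have sp : sgb b * (p j T1 / 3 ^+ j) <= N.
    apply: le_trans (ler_norm _) _; rewrite normrM.
    have -> : `|sgb b| = 1 by rewrite /sgb; case: b; rewrite ?normrN normr1.
    rewrite mul1r normrM normfV (gtr0_norm (three _)); apply: (le_trans _ pN).
    by rewrite ler_pdivrMr// ler_peMr// exprn_ege1// ler1n.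
  by linear.
move=> {jb s} [j b] r T1r; have r0 : 0 <= r by linear.
have h := near_right_off_grid theta r theta0 r0.
near=> s; have [s0 sg] : 0 < s /\ off_grid s by near: s.
have rs : r < s by near: s; exact: nbhs_right_gt.
have T1s : T1 <= s by linear.
have pds := rl_pd _ _ _ _ _ _ rl j s (ltn_ord j) s0 sg.
have phid : is_derive s (1 : R) (phi (j, b))
    (sgb b * ((p_rate p q g j s + dl * p j s) * E s / 3 ^+ j)).
  exact: is_derive_weight.
split; first by have [] := phid.
move=> neg low; rewrite derive_val.
have EE (r' : R) : K * N1 / E s * expR (dl * (s - r')) = K * N1 / E r'.
  have -> : E s = E r' * expR (dl * (s - r')).
    by rewrite /E -expRD; congr expR; ring.
  by field; rewrite !gt_eqF ?expR_gt0.
have E2 (r' : R) : r' < T1 -> 1 <= (E r')^-1.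
  by move=> r'T; rewrite invf_ge1// /E -expR0 ler_expR mulr_ge0_le0// subr_le0 ltW.
(* After T1 the barrier, not yet crossed, gives the bound; before T1 the history bound N does,
   because the barrier only grows when followed backwards. *)
have pY k (r' : R) : (k < n)%N -> s - 2 * theta <= r' <= s ->
    `|p k r'| <= 3 ^+ k * (K * N1 / E s * expR (dl * (s - r'))).
  move=> kn /andP[r'1 r'2].
  rewrite EE//; have [Tr'|r'T] := leP T1 r'.
    have rr : T1 <= r' <= s by rewrite Tr'.
    rewrite ler_norml lerNl; apply/andP; split; apply: ltW.
      by have := phi0 (Ordinal kn, false) r' (neg _ _ rr); rewrite /= mulN1r.
    by have := phi0 (Ordinal kn, true) r' (neg _ _ rr); rewrite /= mul1r.
  have [pN _] : `|p k r'| <= N /\ `|q k r'| <= N by apply: hist => //; apply/andP; split; linear.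
  apply: le_trans pN _; apply: le_trans (_ : K * N1 <= _).
    by linear.
  apply: le_trans (_ : K * N1 / E r' <= _); first by apply: ler_peMr; [exact: ltW|exact: E2].
  by apply: ler_peMl; [apply: divr_ge0; exact: ltW|rewrite exprn_ege1// ler1n].
have zY k (r' : R) : (k < n)%N -> s - 2 * theta <= r' <= s ->
    `|z k r'| <= K * N1 / E s * expR (dl * (s - r')) / (100 * n%:R).
  move=> kn /andP[r'1 r'2]; rewrite EE.
  have -> : K * N1 / E r' / (100 * n%:R) = (C + 2) * N1 * (E r')^-1.
    by rewrite /K; field; rewrite !gt_eqF.
  have CN : 0 <= C * N1 by apply: mulr_ge0 => //; exact: ltW.
  have CNN : C * N <= C * N1 by rewrite ler_wpM2l// ltW.
  have [Tr'|r'T] := leP T1 r'.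
    apply: le_trans (zC k r' kn Tr') _; rewrite EV.
    by apply: ler_wpM2r; [rewrite invr_ge0 ltW|linear].
  have [pN qN] : `|p k r'| <= N /\ `|q k r'| <= N by apply: hist => //; apply/andP; split; linear.
  apply: le_trans (_ : (C + 2) * N1 <= _).
    by apply: le_trans (ler_normB _ _) _; linear.
  by apply: ler_peMr; [apply: mulr_ge0; [exact: addr_ge0|exact: ltW]|exact: E2].
have lr : `|kappa * p_rate p q g j s + \sum_(0 <= k < j.+1) p k s| <= K * N1 / E s / 40.
  by apply: (linear_rate j s T0 dl) => //; linear.
set Y := K * N1 / E s in lr pY zY.
have Y0 : 0 < Y by rewrite divr_gt0.
have pYs k : (k < n)%N -> `|p k s| <= 3 ^+ k * Y.
  move=> kn; have := pY k s kn; rewrite subrr mulr0 expR0 mulr1; apply.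
  by apply/andP; split; linear.
have sgb1 : `|sgb b| = 1 by rewrite /sgb; case: b {low phid}; rewrite ?normrN normr1.
have low' : 9 / 10 * (3 ^+ j * Y) <= sgb b * p j s.
  have -> : sgb b * p j s = sgb b * (p j s * E s / 3 ^+ j) * (3 ^+ j / E s).
    by field; rewrite !gt_eqF.
  have -> : 9 / 10 * (3 ^+ j * Y) = 9 / 10 * (K * N1) * (3 ^+ j / E s).
    by rewrite /Y; ring.
  apply: ler_wpM2r; first by apply: divr_ge0; exact: ltW.
  by move: low; rewrite /phi /w /=; linear.
have S : `|\sum_(0 <= k < j) p k s| <= 3 ^+ j * Y / 2.
  apply: le_trans (ler_norm_sum _ _ _) _.
  apply: le_trans (_ : \sum_(0 <= k < j) 3 ^+ k * Y <= _).
    rewrite big_seq [leRHS]big_seq ler_sum// => k; rewrite mem_index_iota => /andP[_ kj].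
    by apply: pYs; exact: ltn_trans (ltn_ord j).
  by rewrite -mulr_suml mulrAC; apply: ler_wpM2r; [exact: ltW|exact: sum_exp3_le].
have k40 : Y / 40 <= 3 ^+ j * Y / 40.
  by rewrite ler_pM2r//; apply: ler_peMl; [exact: ltW|rewrite exprn_ege1// ler1n].
have dlk' : dl * kappa <= 3 / 10 by rewrite -ler_pdivlMr.
have top : kappa * (dl * (sgb b * p j s)) <= 3 / 10 * (3 ^+ j * Y).
  rewrite mulrA [kappa * _]mulrC; apply: le_trans (_ : dl * kappa * (3 ^+ j * Y) <= _).
    apply: ler_wpM2l; first by apply: mulr_ge0 => //; exact: ltW.
    apply: le_trans (ler_norm _) _.
    by rewrite normrM sgb1 mul1r pYs.
  by apply: ler_wpM2r => //; apply: mulr_ge0; exact: ltW.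
rewrite big_nat_recr//= in lr.
(* In units of 3^j Y the coordinate contributes at least 9/10, its predecessors at most 1/2 and the
   perturbation at most 1/40. The remaining decrease exceeds 3/10, which pays for the weight since
   dl kappa <= 3/10. *)
have key : kappa * (sgb b * p_rate p q g j s) <= - (3 / 10 * (3 ^+ j * Y)).
  have h1 : sgb b * (kappa * p_rate p q g j s + (\sum_(0 <= k < j) p k s + p j s)) <= Y / 40.
    by apply: le_trans (ler_norm _) _; rewrite normrM sgb1 mul1r.
  have h2 : - (sgb b * \sum_(0 <= k < j) p k s) <= 3 ^+ j * Y / 2.
    by rewrite -mulrN; apply: le_trans (ler_norm _) _; rewrite normrM sgb1 mul1r normrN.
  linear.
have -> : sgb b * ((p_rate p q g j s + dl * p j s) * E s / 3 ^+ j) =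
  sgb b * (p_rate p q g j s + dl * p j s) * (E s / 3 ^+ j) by ring.
by rewrite pmulr_lle0 ?divr_gt0// -(pmulr_rle0 _ kappa0); linear.
Unshelve. all: by end_near. Qed.

End Trajectory.

Lemma geometric_small (c e : R) : 0 < e -> exists K : nat, forall k, (K <= k)%N -> c * (3 / 4) ^+ k <= e.
Proof.
move=> e0.
have h : c * (3 / 4 : R) ^+ k @[k --> \oo] --> c * 0.
  apply: cvgM; first exact: cvg_cst.
  by apply: cvg_expr; rewrite ger0_norm; linear.
have ce : c * 0 < e by rewrite mulr0.
have [K _ hK] := cvgr_lt _ h _ ce.
by exists K => k Kk; apply/ltW/hK.
Qed.

(* [F] is chosen downwards: the equation of index i involves later coordinates only,
   so that their bound is known when [F i] must be fixed. *)
Lemma attraction (i : nat) : (i <= n)%N -> exists (F : nat -> R) (B T C : R),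
  [/\ (forall j, 0 <= F j), 0 <= B, 0 < T, 0 <= C &
  forall (F' : nat -> R) p q g g' L, (forall j, (i <= j < n)%N -> F' j = F j) ->
    (forall j, 0 <= F' j) -> reduced_loop F' p q g g' L ->
    forall j, (i <= j < n)%N ->
    [/\ forall s, 0 <= s -> [/\ `|p j s| <= B, `|q j s| <= B &
                              `|p j s - q j s| <= L (gridn Delta s) j / 2],
        forall k, 0 <= L k j <= C * (3 / 4) ^+ k &
        forall s, T <= s -> `|p j s| <= eps j / 2]].
Proof.
have th0 := theta0.
have D0 : 0 < Delta by rewrite mulr_gt0// ltr0n.
have e0 : 0 < eps 0%N by exact: eps_gt0.
have n1 : 1 <= n%:R :> R by rewrite ler1n.
have ngt0 : 0 < n%:R :> R by rewrite (lt_le_trans _ n1).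
have [d] := ubnP (n - i)%N; elim: d i => // d IH i nid ltin.
have [ni|{}ltin] := leqP n i.
  exists (fun=> 0), 0, 1, 0; split => // F' p q g g' L _ _ _ j /andP[ij jn].
  by have := leq_trans (leq_ltn_trans ij jn) ni; rewrite ltnn.
have [|//|F [B [T [C [F0 B0 T0 C0 HP]]]]] := IH i.+1;
  first by rewrite subnS prednK ?subn_gt0// -ltnS.
pose F2 j := if j == i then kappa^-1 + Lip i B else F j.
have F20 j : 0 <= F2 j.
  by rewrite /F2; case: ifP => // _; rewrite addr_ge0// invr_ge0 ltW.
have [|C2 C20 HC2] := @halving_recurrence_decay R n (fun j => Delta * F2 j) i.
  by move=> j; rewrite mulr_ge0// ltW.
pose C' := C2 * A.
have C'0 : 0 <= C' by rewrite mulr_ge0.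
pose e := eps 0%N / (100 * n%:R).
have e_gt0 : 0 < e by rewrite divr_gt0// mulr_gt0.
have [K HK] := geometric_small C' e e_gt0.
(* By then the later levels have settled, and K samples have brought all ranges from level i on
   below the tolerance [e] of [stage]. *)
pose T0' := T + K%:R * Delta.
have T0'0 : 0 < T0' by rewrite ltr_wpDr// mulr_ge0// ltW.
(* A speed bound for p_i that holds from time 0 on, whatever the saturations do. It limits the drift
   of p_i until [stage] applies. *)
pose D := (n%:R * B + 1 / 30) / kappa + Lip i B.
have Dge0 : 0 <= D.
  apply: addr_ge0 => //; apply: divr_ge0; last exact: ltW.
  by apply: addr_ge0; [exact: mulr_ge0|linear].
pose T1 := T0' + theta.
pose BB := A + D * T1.
pose c := 2 / 5 * eps i / kappa.
have c0 : 0 < c by rewrite divr_gt0// mulr_gt0// eps_gt0.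
have T10 : 0 < T1 by rewrite /T1; linear.
have BB0 : 0 <= BB by rewrite addr_ge0// mulr_ge0// ltW.
pose Tf := T1 + BB / c.
have Tf1 : T1 <= Tf by rewrite lerDl divr_ge0// ltW.
(* Drift up to [Tf], and the 1 for the bound eps_i / 2 afterwards. *)
pose B2 := A + D * Tf + 1.
have Tf0 : 0 < Tf by linear.
have B20 : 0 <= B2 by rewrite !addr_ge0// mulr_ge0// ltW.
exists F2, (B + B2 + C'), Tf, (C + C'); split => //.
- by apply: addr_ge0 => //; apply: addr_ge0.
- by apply: addr_ge0.
move=> F' p q g g' L F'F F'0 rl.
have {}HP := HP F' p q g g' L _ F'0 rl.
have {}HP j : (i < j < n)%N -> [/\ forall s, 0 <= s -> [/\ `|p j s| <= B, `|q j s| <= B &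
                              `|p j s - q j s| <= L (gridn Delta s) j / 2],
        forall k, 0 <= L k j <= C * (3 / 4) ^+ k &
        forall s, T <= s -> `|p j s| <= eps j / 2].
  move=> ij; apply: HP => // l /andP[il ln].
  by rewrite F'F ?ln ?(ltnW il)// /F2 gtn_eqF.
have {}HC2 k j : (i <= j < n)%N -> 0 <= L k j <= C' * (3 / 4) ^+ k.
  apply: HC2 => [k' j' ij'|j' /andP[_ j'n]].
    by rewrite (rl_L _ _ _ _ _ _ rl) ?F'F//; case/andP: ij'.
  exact: (rl_L0 _ _ _ _ _ _ rl).
have F'i : F' i = kappa^-1 + Lip i B by rewrite F'F ?leqnn// /F2 eqxx.
have zi s : 0 <= s -> `|p i s - q i s| <= L (gridn Delta s) i / 2.
  apply: (tracking_error F' p q g g' L rl i B) => //; first by rewrite F'i.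
  by move=> j {}s ij s0; have [H _ _] := HP j ij; exact: H.
have zj j s : (i <= j < n)%N -> 0 <= s -> `|p j s - q j s| <= L (gridn Delta s) j / 2.
  move=> /andP[]; rewrite leq_eqVlt => /predU1P[<- _|ij jn]; first exact: zi.
  by move=> s0; have [|H _ _] := HP j; rewrite ?ij//; have [] := H s s0.
have zsmall j s : (i <= j < n)%N -> T0' <= s -> `|p j s - q j s| <= e.
  move=> ij Ts; have s0 : 0 <= s by linear.
  apply: le_trans (zj j s ij s0) _.
  have Kg : (K <= gridn Delta s)%N.
    rewrite -(ler_nat R) -(ler_pM2r D0); apply: le_trans (gridn_ge _ _ D0 s0).
    by rewrite /T0' in Ts; linear.
  have /andP[? ?] := HC2 (gridn Delta s) j ij; have := HK _ Kg.
  by linear.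
have growth s : 0 <= s -> `|p i s| <= A + D * s.
  move=> s0.
  have pA : `|p i 0| <= A.
    apply: le_trans (rl_p_init _ _ _ _ _ _ rl i ltin) _.
    by case/andP: (rl_L0 _ _ _ _ _ _ rl i ltin).
  have : `|p i s - p i 0| <= D * (s - 0).
    apply: (p_dist_le F' p q g g' L rl) => // [|r /andP[r0 _] _]; first by rewrite lexx.
    have pB j : (i < j < n)%N -> `|p j r| <= B.
      by move=> ij; have [H _ _] := HP j ij; have [] := H r (ltW r0).
    rewrite /p_rate /D; apply: le_trans (ler_normD _ _) _; apply: lerD.
      rewrite normrM gtr0_norm ?invr_gt0// mulrC ler_pM2r ?invr_gt0//.
      apply: le_trans (ler_normB _ _) _; apply: lerD.
        exact: norm_sum_nat_le.
      exact: delayed_control_bound.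
    exact: (rl_g_bound _ _ _ _ _ _ rl _ _ _ ltin (ltW r0)).
  rewrite subr0 => h; have -> : p i s = p i 0 + (p i s - p i 0) by ring.
  by apply: le_trans (ler_normD _ _) _; linear.
have final s : Tf <= s -> `|p i s| <= eps i / 2.
  move=> Tfs; apply: (stage F' p q g g' L rl i T0' BB) => //.
  - move=> j r ij Tr; have [_ _] := HP j ij; apply.
    by apply: le_trans Tr; rewrite lerDl mulr_ge0// ltW.
  - by apply: growth; rewrite /T1; linear.
  - by rewrite -/T1; linear.
  rewrite -/T1 -/c; apply: le_trans Tfs; rewrite lerD2l ler_pM2r ?invr_gt0//.
  by have := eps_gt0 i ltin; linear.
have p_all s : 0 <= s -> `|p i s| <= B2.
  move=> s0; have [sT|/ltW Ts] := leP s Tf.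
    apply: le_trans (growth s s0) _; rewrite /B2.
    have : D * s <= D * Tf by rewrite ler_wpM2l.
    by linear.
  apply: le_trans (final s Ts) _; rewrite /B2.
  have : 0 <= D * Tf by rewrite mulr_ge0// ltW.
  by have := A_ge0; have := eps_top i ltin; linear.
move=> j ij; case/andP: (ij) => + jn; rewrite leq_eqVlt => /predU1P[<-|{}ij].
  split => // [s s0|k].
    have z1 := zi s s0; have p1 := p_all s s0.
    have /andP[L0 L1] := HC2 (gridn Delta s) i (introT andP (conj (leqnn i) ltin)).
    have LC : L (gridn Delta s) i <= C'.
      apply: le_trans L1 _; rewrite ler_piMr// exprn_ile1//; linear.
    split => //; first by linear.
    have -> : q i s = p i s - (p i s - q i s) by ring.
    by apply: le_trans (ler_normB _ _) _; linear.
  have /andP[-> L1] := HC2 k i (introT andP (conj (leqnn i) ltin)).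
  by apply: le_trans L1 _; rewrite ler_wpM2r ?exprn_ge0// lerDr.
have ijn : (i < j < n)%N by rewrite ij.
have [H1 H2 H3] := HP j ijn.
split => [s s0|k|s Ts].
- by have [? ? ?] := H1 s s0; split => //; linear.
- have /andP[-> L1] := H2 k.
  by apply: le_trans L1 _; rewrite ler_wpM2r ?exprn_ge0// lerDl.
- apply: H3; apply: le_trans Ts; apply: le_trans Tf1; rewrite /T1 /T0'.
  have : 0 <= K%:R * Delta by rewrite mulr_ge0// ltW.
  by linear.
Qed.

(** Besides boundedness, the decay must be linear in the size [N] of the recent past, since the
    final estimate is relative to the history norm at T and not to the initial data. *)
Lemma reduced_stability : exists (F : nat -> R) (B K T dl : R),
  [/\ [/\ (forall j, 0 <= F j), 0 <= B, 0 <= K, 0 < dl & 4 * theta <= T] &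
  forall p q g g' L, reduced_loop F p q g g' L ->
    (forall j s, (j < n)%N -> 0 <= s ->
       [/\ `|p j s| <= B, `|q j s| <= B & 0 <= L (gridn Delta s) j <= B]) /\
    forall N : R, 0 <= N ->
    (forall j r, (j < n)%N -> T - 2 * theta <= r <= T ->
       [/\ `|p j r| <= N, `|q j r| <= N & L (gridn Delta r) j <= N]) ->
    forall j s, (j < n)%N -> T <= s ->
      [/\ `|p j s| <= K * N * expR (- (dl * (s - T))),
          `|q j s| <= K * N * expR (- (dl * (s - T))) &
          L (gridn Delta s) j <= K * N * expR (- (dl * (s - T)))]].
Proof.
have th0 := theta0.
have D0 : 0 < Delta by rewrite mulr_gt0// ltr0n.
have Dth : theta <= Delta by rewrite ler_peMl ?ler1n// ltW.
have e0 : 0 < eps 0%N by exact: eps_gt0.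
have n1 : 1 <= n%:R :> R by rewrite ler1n.
have ngt0 : 0 < n%:R :> R by rewrite (lt_le_trans _ n1).
have [F [B [T [C [F0 B0 T0 C0 HP]]]]] := attraction 0 (leq0n n).
have [|C2 C20 HC2] := @halving_recurrence_decay R n (fun j => Delta * F j) 0.
  by move=> j; rewrite mulr_ge0// ltW.
pose e := eps 0%N / (100 * n%:R).
have e_gt0 : 0 < e by rewrite divr_gt0// mulr_gt0.
have [K0 HK0] := geometric_small C e e_gt0.
have KD0 : 0 <= K0%:R * Delta by rewrite mulr_ge0// ltW.
pose T0' := T + K0%:R * Delta.
have T0'0 : 0 < T0' by rewrite /T0'; linear.
(* T1 is made a sampling time, so that the range recurrence can be restarted there. *)
pose K1 := gridn Delta (T0' + 4 * theta).
pose T1 := K1%:R * Delta.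
have T1T0 : T0' + 4 * theta <= T1 by apply: gridn_ge => //; linear.
(* The first bound gives 3/4 <= 1 - dl Delta <= expR (- dl Delta), so that the ranges decay at least
   at rate dl; the second is required by [exponential_stage]. *)
pose dl := Num.min (1 / 4 / Delta) (3 / 10 / kappa).
have dl0 : 0 < dl by rewrite lt_min !divr_gt0.
have dlk : dl <= 3 / 10 / kappa by rewrite /dl ge_min lexx orbT.
have dlD : dl * Delta <= 1 / 4 by rewrite -ler_pdivlMr// /dl ge_min lexx.
have dlth : dl * theta <= 1 / 4 by apply: le_trans dlD; rewrite ler_pM2l.
have e2 : expR (2 * dl * theta) <= 2.
  apply: le_trans (_ : expR (1 / 2) <= _); first by rewrite ler_expR; linear.
  have := expR_ge1Dx (- (1 / 2) : R); rewrite expRN => h.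
  by rewrite -[leLHS]invrK -[leRHS]invrK lef_pV2 ?posrE ?invr_gt0 ?expR_gt0//; linear.
pose K := 3 ^+ n * (100 * n%:R * (C2 + 2)) + C2 + 2.
have P0 : 0 <= 3 ^+ n * (100 * n%:R * (C2 + 2)).
  by rewrite mulr_ge0 ?exprn_ge0// mulr_ge0// ?addr_ge0// mulr_ge0.
exists F, (B + C), K, T1, dl; split.
  split => //; [exact: addr_ge0|by rewrite /K !addr_ge0|by linear].
move=> p q g g' L rl.
have {}HP j : (j < n)%N -> _ := fun jn => HP F p q g g' L (fun _ _ => erefl) F0 rl j jn.
split.
  move=> j s jn s0; have [/(_ s s0)[pB qB _] LC _] := HP j jn.
  have /andP[L0 L1] := LC (gridn Delta s).
  split; [by linear|by linear|rewrite L0/=].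
  by apply: le_trans L1 _; apply: le_trans (_ : C <= _);
    [rewrite ler_piMr// exprn_ile1//; linear|linear].
move=> N N0 hist.
have T10 : 0 <= T1 by linear.
have Ldecay j s : (j < n)%N -> T1 <= s ->
    0 <= L (gridn Delta s) j <= C2 * N * expR (- (dl * (s - T1))).
  move=> jn Ts.
  have sg := gridn_ge Delta s D0 (le_trans T10 Ts).
  have K1s : (K1 <= gridn Delta s)%N.
    by rewrite -(ler_nat R) -(ler_pM2r D0); apply: le_trans sg.
  (* Restarted at index K1, the recurrence has initial size N, taken from the history at T1, in
     place of A. *)
  have : 0 <= L (K1 + (gridn Delta s - K1))%N j <=
      C2 * N * (3 / 4) ^+ (gridn Delta s - K1).
    apply: (HC2 (fun k => L (K1 + k)%N)) => // [k l /andP[_ ln]|l /andP[_ ln]].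
      by rewrite addnS (rl_L _ _ _ _ _ _ rl).
    rewrite addn0; have [_ LC _] := HP l ln; have /andP[-> _] := LC K1.
    have [|_ _] := hist l T1 ln; first by apply/andP; split; linear.
    rewrite /T1; case: (K1) => [|k]; first by rewrite mul0r gridn0.
    by rewrite (gridnP _ _ k)// lexx andbT ltr_pM2r// ltr_nat.
  rewrite subnKC// => /andP[-> h]; apply: le_trans h _.
  rewrite ler_wpM2l//; first exact: mulr_ge0.
  apply: le_trans (_ : expR (- (dl * Delta)) ^+ (gridn Delta s - K1) <= _).
    rewrite lerXn2r ?nnegrE ?expR_ge0//.
    by apply: le_trans (expR_ge1Dx _); linear.
  rewrite -expRM_natl ler_expR mulrN lerN2 mulrCA ler_pM2l//.
  by rewrite natrB// mulrBl -/T1; linear.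
have zdecay j s : (j < n)%N -> T1 <= s ->
    `|p j s - q j s| <= C2 * N * expR (- (dl * (s - T1))).
  move=> jn Ts; have [H _ _] := HP j jn.
  have [_ _ h] := H s (le_trans T10 Ts).
  by apply: le_trans h _; have /andP[? ?] := Ldecay j s jn Ts; linear.
have pdecay j s : (j < n)%N -> T1 <= s ->
    `|p j s| <= 3 ^+ n * (100 * n%:R * (C2 + 2)) * N * expR (- (dl * (s - T1))).
  apply: (exponential_stage F p q g g' L rl T0' T1 dl C2 N) => //.
  - by linear.
  - exact: ltW.
  - move=> {}j r jn Tr; have [_ _ H] := HP j jn; apply: H.
    by apply: le_trans Tr; rewrite /T0'; linear.
  - move=> {}j r jn Tr; have r0 : 0 <= r by linear.
    have [H LC _] := HP j jn; have [_ _ h] := H r r0; apply: le_trans h _.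
    have Kg : (K0 <= gridn Delta r)%N.
      rewrite -(ler_nat R) -(ler_pM2r D0); apply: le_trans (gridn_ge _ _ D0 r0).
      by rewrite /T0' in Tr; linear.
    have /andP[? ?] := LC (gridn Delta r); have := HK0 _ Kg; rewrite /e.
    by linear.
  - by move=> {}j r jn rT; have [] := hist j r jn rT.
move=> j s jn Ts.
have NE : 0 <= N * expR (- (dl * (s - T1))) by rewrite mulr_ge0 ?expR_ge0.
have leK c : c <= K -> c * N * expR (- (dl * (s - T1))) <= K * N * expR (- (dl * (s - T1))).
  by move=> cK; rewrite -!(mulrA _ N) ler_wpM2r.
have pd := pdecay j s jn Ts; have zd := zdecay j s jn Ts.
have /andP[_ Ld] := Ldecay j s jn Ts.
split; first by apply: le_trans pd _; apply: leK; rewrite /K -addrA lerDl addr_ge0.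
  have -> : q j s = p j s - (p j s - q j s) by ring.
  apply: le_trans (ler_normB _ _) _; apply: le_trans (lerD pd zd) _.
  by rewrite -!mulrDl; apply: leK; rewrite /K lerDl.
by apply: le_trans Ld _; apply: leK; rewrite /K addrAC lerDr addr_ge0.
Qed.

End ReducedLoop.

(** * The linear change of coordinates *)

Section PCoordinates.
Context {R : realType}.

(** The coefficients of p_i are the binomials C(n - i, j - i), so p_i is an iterated sum of
    neighbours. In this form Pascal's rule relates p_i, p_(i+1) and the shifted sequence. *)
Fixpoint pascal (a : nat -> R) (d j : nat) : R :=
  if d is d'.+1 then pascal a d' j + pascal a d' j.+1 else a j.

Lemma pascal_bin a d j : pascal a d j = \sum_(e < d.+1) 'C(d, e)%:R * a (j + e)%N.
Proof.
elim: d j => [|d IH] j; first by rewrite big_ord1 bin0 mul1r addn0.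
rewrite /= !IH [RHS]big_ord_recl bin0 mul1r addn0.
under [in RHS]eq_bigr => e _ do rewrite /= /bump leq0n add1n binS natrD mulrDl.
rewrite big_split/= addrA [in RHS]big_ord_recr/= bin_small// mul0r addr0.
congr (_ + _); last by apply: eq_bigr => e _; rewrite addSnnS.
by rewrite big_ord_recl bin0 mul1r addn0.
Qed.

Lemma pascalS a d j : pascal (fun k => a k.+1) d j = pascal a d j.+1.
Proof. by elim: d j => //= d IH j; rewrite !IH. Qed.

Lemma pascalD a b d j : pascal (fun k => a k + b k) d j = pascal a d j + pascal b d j.
Proof. by elim: d j => //= d IH j; rewrite !IH; ring. Qed.

Lemma pascalZ c a d j : pascal (fun k => c * a k) d j = c * pascal a d j.
Proof. by elim: d j => //= d IH j; rewrite !IH; ring. Qed.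

Lemma eq_pascal a b d j : (forall k, (j <= k <= j + d)%N -> a k = b k) ->
  pascal a d j = pascal b d j.
Proof.
elim: d j => [|d IH] j ab /=; first by apply: ab; rewrite addn0 leqnn.
by congr (_ + _); apply: IH => k /andP[k1 k2]; apply: ab; lia.
Qed.

Lemma pascal_le a d j c : (forall k, (j <= k <= j + d)%N -> `|a k| <= c) ->
  `|pascal a d j| <= 2 ^+ d * c.
Proof.
elim: d j => [|d IH] j ac /=; first by rewrite mul1r; apply: ac; rewrite addn0 leqnn.
rewrite exprS -mulrA mulr2n mulrDl mul1r; apply: le_trans (ler_normD _ _) _.
by apply: lerD; apply: IH => k /andP[k1 k2]; apply: ac; lia.
Qed.

(** The last entry has weight one in every form p_i, so the input enters all p_i' alike. *)
Lemma pascal_last n c d j : (d + j < n)%N ->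
  pascal (fun k => if k.+1 == n then c else 0) d j = if (d + j).+1 == n then c else 0.
Proof.
elim: d j => //= d IH j dj; rewrite !IH; [|lia..].
have -> : ((d + j).+1 == n) = false by apply/eqP; lia.
by rewrite add0r addnS addSn.
Qed.

(** The reason for the choice of p_i: applied to the shifted sequence, which is what the chain of
    integrators produces, p_i is the sum of all later p_j. Each summand is one application of
    Pascal's rule. *)
Lemma sum_pascal n a i : a n = 0 -> (i < n)%N ->
  \sum_(i.+1 <= j < n) pascal a (n - j.+1) j = pascal a (n - i.+1) i.+1.
Proof.
move=> an; have [d] := ubnP (n - i)%N; elim: d i => // d IH i nid ltin.
have [ni|i1n] := leqP n i.+1.
  have -> : i.+1 = n by lia.
  by rewrite subnn big_geq//= an.
rewrite big_ltn// IH//; last by lia.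
by have -> : (n - i.+1 = (n - i.+2).+1)%N by lia.
Qed.

(* Undoing the Pascal differences one level at a time at most doubles the bound. *)
Lemma pascal_inv n a j c : 0 <= c -> (j < n)%N ->
  (forall l, (j <= l < n)%N -> `|pascal a (n - l.+1) l| <= c) ->
  `|a j| <= 2 ^+ (n - j.+1) * c.
Proof.
move=> c0 jn H.
suff {j jn H} K k j : (j + k < n)%N ->
    (forall l, (j <= l < n)%N -> `|pascal a (n - l.+1) l| <= c) ->
    `|pascal a (n - j.+1 - k) j| <= 2 ^+ k * c.
  have := K (n - j.+1)%N j; rewrite subnn /=; apply => //; lia.
elim: k j => [|k IH] j jk H; first by rewrite subn0 expr0 mul1r; apply: H; lia.
have -> : pascal a (n - j.+1 - k.+1) j =
    pascal a (n - j.+1 - k) j - pascal a (n - j.+2 - k) j.+1.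
  have -> : (n - j.+1 - k = (n - j.+1 - k.+1).+1)%N by lia.
  rewrite /=; have -> : (n - j.+2 - k = n - j.+1 - k.+1)%N by lia.
  by rewrite addrK.
rewrite exprS -mulrA; have -> : 2 * (2 ^+ k * c) = 2 ^+ k * c + 2 ^+ k * c by ring.
apply: le_trans (ler_normB _ _) _.
have h1 : `|pascal a (n - j.+1 - k) j| <= 2 ^+ k * c by apply: IH => //; lia.
have h2 : `|pascal a (n - j.+2 - k) j.+1| <= 2 ^+ k * c.
  by apply: IH => [|l l1]; [lia|apply: H; lia].
exact: lerD.
Qed.

Definition entry (n : nat) (v : 'cV[R]_n) (j : nat) : R :=
  if insub j is Some k then v k 0 else 0.

Lemma entryE n (v : 'cV[R]_n) (j : 'I_n) : entry n v j = v j 0.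
Proof. by rewrite /entry valK. Qed.

Lemma entry_out n (v : 'cV[R]_n) j : (n <= j)%N -> entry n v j = 0.
Proof. by move=> nj; rewrite /entry insubF// ltnNge nj. Qed.

Lemma p_mapE n i (v : 'cV[R]_n) : (i < n)%N -> p_map i v = pascal (entry n v) (n - i.+1) i.
Proof.
move=> ltin; rewrite pascal_bin /p_map.
rewrite -(big_mkord (fun _ => true) (fun e => 'C(n - i.+1, e)%:R * entry n v (i + e)%N)).
have -> : (n - i.+1).+1 = (n - i)%N by lia.
transitivity (\sum_(i <= j < n) 'C(n - i.+1, j - i)%:R * entry n v j); last first.
  rewrite -{1}(add0n i) big_addn; apply: eq_bigr => e _.
  by rewrite addnK addnC.
rewrite (@big_nat_widenl _ _ _ i 0 n)// big_mkord; apply: eq_big => [j|j ij] //=.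
rewrite entryE /p_coef; congr (_ * _).
have jn := ltn_ord j.
have e : 'C(n - i.+1, j - i) * ((j - i)`! * (n - j.+1)`!) = (n - i.+1)`!.
  have := @bin_fact (n - i.+1) (j - i); have -> : (n - i.+1 - (j - i) = n - j.+1)%N by lia.
  by apply; lia.
rewrite -e [((n - j.+1)`! * _)%N]mulnC (natrM _ 'C(_, _)) mulfK//.
by rewrite pnatr_eq0 -lt0n muln_gt0 !fact_gt0.
Qed.

End PCoordinates.

Ltac nonneg := repeat first
  [ assumption | apply: ltW; assumption | done | exact: ler0n | apply: divr_ge0 | apply: mulr_ge0
  | apply: exprn_ge0 | apply: addr_ge0 ].

Section FeedforwardCoordinates.
Context {R : realType} (n : nat) (h : forall i : nat, 'cV[R]_(n - i.+1) -> R)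
  (M L kappa : R).
Hypothesis n0 : (0 < n)%N.
Hypothesis M0 : 0 < M.
Hypothesis L0 : 0 < L.
Hypothesis kappa1 : 1 <= kappa.
Hypothesis h_C2 : forall i : nat, (i.+1 < n)%N -> class_C 2 (h i).
Hypothesis h_bound : forall i : nat, (i.+1 < n)%N ->
  forall v : 'cV[R]_(n - i.+1), `|v| <= 1 -> `|h i v| <= M * enorm v ^+ 2.
Hypothesis L_small : L <= kappa / (20 * 30 ^+ n * n%:R ^+ 4 * n`!%:R ^+ 3).
Hypothesis L_small' : L <= M * kappa / (n.+1)`!%:R.

Implicit Types x y : 'cV[R]_n.

Definition pcoord x (i : nat) : R := p_map i (rescale M L kappa x).

(** The form p_i applied to the rescaled vector of the h_j, that is, their contribution to p_i'. *)
Definition nonlinearity (i : nat) x : R :=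
  pascal (fun j => if (j.+1 < n)%N then kappa ^+ j * (M / L) * h j (tail j.+1 x) else 0)
    (n - i.+1) i.

Let kappa0 : 0 < kappa. Proof. exact: lt_le_trans kappa1. Qed.

Lemma pcoord_pascal x i : (i < n)%N ->
  pcoord x i = pascal (entry n (rescale M L kappa x)) (n - i.+1) i.
Proof. exact: p_mapE. Qed.

Lemma pcoord_Phi x (i : 'I_n) : pcoord x i = (Phi n M L kappa *m x) i 0.
Proof. by rewrite PhiE. Qed.

Lemma pcoordB x y i : pcoord (x - y) i = pcoord x i - pcoord y i.
Proof.
rewrite /pcoord /p_map -sumrB; apply: eq_bigr => j _.
by rewrite !mxE; ring.
Qed.

Lemma pcoord0 i : pcoord 0 i = 0.
Proof. by rewrite -(subrr (0 : 'cV_n)) pcoordB subrr. Qed.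

(** The weights kappa^j turn x_(j+1) into the next rescaled coordinate divided by kappa, and
    [sum_pascal] sums these up. *)
Lemma pcoord_feedforward x u i : (i < n)%N ->
  pcoord (feedforward h x u) i =
  kappa^-1 * \sum_(i.+1 <= j < n) pcoord x j + nonlinearity i x +
  kappa ^+ n.-1 * (M / L) * u.
Proof.
move=> ltin; rewrite pcoord_pascal//.
pose a := entry n (rescale M L kappa x).
pose b := fun k => (kappa^-1 * a k.+1 +
  (if (k.+1 < n)%N then kappa ^+ k * (M / L) * h k (tail k.+1 x) else 0)) +
  (if k.+1 == n then kappa ^+ n.-1 * (M / L) * u else 0).
rewrite (@eq_pascal _ _ b) => [|k /andP[ik kn]].
  rewrite /b !pascalD pascalZ pascalS pascal_last; last by lia.
  have -> : ((n - i.+1 + i).+1 == n) by apply/eqP; lia.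
  rewrite -sum_pascal//; last by rewrite /a entry_out.
  congr (_ * _ + _ + _); apply: eq_big_nat => j /andP[_ jn].
  by rewrite pcoord_pascal.
have ltkn : (k < n)%N by lia.
rewrite /b -[k]/(nat_of_ord (Ordinal ltkn)) entryE !mxE/=.
case: insubP => [j k1n jk|]; last first.
  rewrite -leqNgt => nk.
  have -> : (k.+1 < n)%N = false by apply/negbTE; rewrite -leqNgt.
  have -> : (k.+1 == n) = true by apply/eqP; lia.
  rewrite /a entry_out// mulr0 !add0r.
  by have -> : n.-1 = k by lia.
have ak : a k.+1 = kappa ^+ k.+1 * (M / L) * x j 0 by rewrite /a -jk entryE mxE.
rewrite k1n ltn_eqF// addr0 ak exprS mulrDr; congr (_ + _).
by field; rewrite ?gt_eqF.
Qed.

(** The gain L / (M kappa^n) in [alpha] is the one that leaves the factor 1 / kappa before lambda_n,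
    matching the other linear terms. *)
Lemma pcoord_closed_loop sigma eps x psi i : (i < n)%N ->
  pcoord (feedforward h x (alpha sigma eps M L kappa psi)) i =
  kappa^-1 * (\sum_(i.+1 <= j < n) pcoord x j - nested sigma eps (pcoord psi) n)
  + nonlinearity i x.
Proof.
move=> ltin; rewrite pcoord_feedforward// /alpha lam_nested -/(pcoord psi).
set w := nested _ _ _ n.
have -> : kappa ^+ n = kappa * kappa ^+ n.-1 by rewrite -exprS prednK.
by field; rewrite ?gt_eqF// exprn_gt0.
Qed.

Lemma coord_le_pcoord x i c : 0 <= c ->
  (forall j, (i < j < n)%N -> `|pcoord x j| <= c) ->
  forall j : 'I_n, (i < j)%N -> `|x j 0| <= 2 ^+ (n - j.+1) * c * (L / M / kappa ^+ j).
Proof.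
move=> c0 xc j ij.
have -> : x j 0 = entry n (rescale M L kappa x) j * (L / M / kappa ^+ j).
  by rewrite entryE mxE; field; rewrite ?gt_eqF// exprn_gt0.
have k0 : 0 <= L / M / kappa ^+ j by rewrite !divr_ge0 ?exprn_ge0// ltW.
rewrite normrM (ger0_norm k0); apply: ler_wpM2r => //.
apply: pascal_inv => // l /andP[jl ln]; rewrite -pcoord_pascal//.
by apply: xc; rewrite ln (leq_trans ij).
Qed.

Lemma nonlinearity_lipschitz : exists Lip : nat -> R -> R, (forall i B, 0 <= Lip i B) /\
  forall i x y B, (i < n)%N ->
    (forall j, (i < j < n)%N -> `|pcoord x j| <= B /\ `|pcoord y j| <= B) ->
    `|nonlinearity i x - nonlinearity i y| <=
      Lip i B * \sum_(i.+1 <= j < n) `|pcoord x j - pcoord y j|.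
Proof.
pose box (B : R) : R := 2 ^+ n * `|B| * (L / M).
have LM0 : 0 <= L / M by rewrite divr_ge0 ?ltW.
have kp j : 1 <= kappa ^+ j by rewrite exprn_ege1.
have to_box x i (B : R) (j : 'I_n) : (i < j)%N -> 0 <= B ->
    (forall j, (i < j < n)%N -> `|pcoord x j| <= B) -> `|x j 0| <= 2 ^+ n * B * (L / M).
  move=> ij B0 xB; apply: le_trans (coord_le_pcoord x i B B0 xB j ij) _.
  apply: ler_pM.
  - by apply: mulr_ge0 => //; rewrite exprn_ge0.
  - by apply: divr_ge0 => //; rewrite exprn_ge0// ltW.
  - by apply: ler_wpM2r => //; rewrite ler_weXn2l ?ler1n// leq_subr.
  by rewrite ler_pdivrMr ?exprn_gt0// ler_peMr.
have /choice[Fb FbP] (jB : nat * R) : exists F : R, 0 <= F /\ ((jB.1.+1 < n)%N ->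
    forall v w : 'cV[R]_(n - jB.1.+1), (forall i, `|v i 0| <= box jB.2) ->
    (forall i, `|w i 0| <= box jB.2) ->
    `|h jB.1 v - h jB.1 w| <= F * \sum_i `|v i 0 - w i 0|).
  have [jn|] := ltnP jB.1.+1 n; last by exists 0.
  have [gc gd] := h_C2 _ jn.
  have C1 : class_C 1 (h jB.1).
    by split => // j; have [d1 [c1 _]] := gd j; split.
  by have [F F0 FP] := class_C_lipschitz_box (h jB.1) (box jB.2) C1; exists F.
pose S (B : R) := \sum_(0 <= j < n) Fb (j, B).
have S0 B : 0 <= S B by rewrite sumr_ge0// => j _; case: (FbP (j, B)).
(* One 2^n comes from applying the Pascal sums and the other from inverting them, kappa^n M / L and
   L / M from rescaling and back, and n from the number of entries. *)
pose D : R := 2 ^+ n * (kappa ^+ n * (M / L)) * (n%:R * (2 ^+ n * (L / M))).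
have ML0 : 0 <= M / L by rewrite divr_ge0 ?ltW.
have D0 : 0 <= D by rewrite /D; nonneg.
exists (fun (i : nat) (B : R) => D * S B); split; first by move=> i B; rewrite mulr_ge0.
move=> i x y B ltin xyB.
set E := \sum_(_ <= _ < _) _.
have E0 : 0 <= E by rewrite sumr_ge0.
have -> : nonlinearity i x - nonlinearity i y = pascal (fun j =>
    if (j.+1 < n)%N then kappa ^+ j * (M / L) * (h j (tail j.+1 x) - h j (tail j.+1 y)) else 0)
    (n - i.+1) i.
  rewrite /nonlinearity -[X in _ - X]mul1r -mulNr -pascalZ -pascalD.
  by apply: eq_pascal => k _; case: ifP => _; ring.
pose c := kappa ^+ n * (M / L) * (S B * (n%:R * (2 ^+ n * E * (L / M)))).
apply: le_trans (_ : 2 ^+ (n - i.+1) * c <= _); last first.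
  have -> : D * S B * E = 2 ^+ n * c by rewrite /c /D; ring.
  apply: ler_wpM2r; last by rewrite ler_weXn2l ?ler1n// leq_subr.
  by have SB0 := S0 B; rewrite /c; nonneg.
have c0 : 0 <= c by have SB0 := S0 B; rewrite /c; nonneg.
apply: pascal_le => j /andP[ij _]; case: ifP => [j1n|_]; last by rewrite normr0.
rewrite normrM ger0_norm; last by nonneg.
have B0 : 0 <= B.
  have [|xB _] := xyB j.+1; first by rewrite j1n ltnS ij.
  exact: le_trans xB.
apply: ler_pM => //; first by nonneg.
  by apply: ler_wpM2r => //; rewrite ler_weXn2l// ltnW// ltnW.
have [Fb0 /(_ j1n)FP] := FbP (j, B).
apply: le_trans (FP (tail j.+1 x) (tail j.+1 y) _ _) _ => /=.
- move=> k; rewrite mxE /box (ger0_norm B0); apply: (to_box x i) => //.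
    by rewrite /= addSn ltnS (leq_trans ij)// leq_addr.
  by move=> l /xyB[].
- move=> k; rewrite mxE /box (ger0_norm B0); apply: (to_box y i) => //.
    by rewrite /= addSn ltnS (leq_trans ij)// leq_addr.
  by move=> l /xyB[].
apply: ler_pM => //; first by rewrite sumr_ge0.
  rewrite /S (bigD1_seq j) ?mem_index_iota ?iota_uniq ?(ltnW j1n)//=.
  by rewrite lerDl sumr_ge0// => l _; case: (FbP (l, B)).
apply: le_trans (_ : \sum_(k < n - j.+1) 2 ^+ n * E * (L / M) <= _).
  apply: ler_sum => k _; rewrite !mxE.
  (* By linearity [to_box] also applies to x - y, with the sum [E] of coordinate differences as
     radius. *)
  have -> : x (Ordinal (add_ord_ltn k)) 0 - y (Ordinal (add_ord_ltn k)) 0 =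
    (x - y) (Ordinal (add_ord_ltn k)) 0 by rewrite !mxE.
  apply: (to_box (x - y) i) => //.
    by rewrite /= addSn ltnS (leq_trans ij)// leq_addr.
  move=> l iln; rewrite pcoordB /E.
  rewrite (bigD1_seq l) ?mem_index_iota ?iota_uniq//= lerDl sumr_ge0//.
rewrite sumr_const card_ord -[leLHS]mulr_natl; apply: ler_wpM2r.
  by nonneg.
by rewrite ler_nat leq_subr.
Qed.

(** In original coordinates the arguments of h_j are at most 2^(n-1) c L / (M kappa^(j+1)). Squaring
    and rescaling leaves 2^(3(n-1)) n c^2 L / kappa: M cancels and one factor L survives. Since
    2^(n-1) <= n!, the cube of n! in the bound on L absorbs the powers of 2. *)
Lemma nonlinearity_small i x c : (i < n)%N -> 0 <= c <= 1 ->
  (forall j, (i < j < n)%N -> `|pcoord x j| <= c) ->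
  kappa * `|nonlinearity i x| <= 1 / 30 ^+ n * (c ^+ 2 / 20).
Proof.
move=> ltin /andP[c0 c1] xc.
have fact2 : 2 ^+ n.-1 <= n`!%:R :> R.
  rewrite -natrX ler_nat; case: (n) n0 => // k _ /=.
  by elim: k => // k IH; rewrite expnS factS leq_mul.
have kp j : 1 <= kappa ^+ j by rewrite exprn_ege1.
have LM0 : 0 <= L / M by rewrite divr_ge0 ?ltW.
have f0 : 0 < n`!%:R :> R by rewrite ltr0n fact_gt0.
have f1 : 0 < (n.+1)`!%:R :> R by rewrite ltr0n fact_gt0.
have nn : 1 <= n%:R :> R by rewrite ler1n.
have t2 : 0 <= 2 ^+ n.-1 :> R by rewrite exprn_ge0.
have tb (j : nat) (k : 'I_n) : (i <= j)%N -> (j < k)%N ->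
    `|x k 0| <= 2 ^+ n.-1 * c * (L / M / kappa ^+ j.+1).
  move=> ij jk.
  have ik : (i < k)%N by exact: leq_ltn_trans jk.
  apply: le_trans (coord_le_pcoord x i c c0 xc k ik) _.
  apply: ler_pM.
  - by apply: mulr_ge0 => //; rewrite exprn_ge0.
  - by apply: divr_ge0 => //; rewrite exprn_ge0// ltW.
  - by apply: ler_wpM2r => //; rewrite ler_weXn2l ?ler1n// -subn1 leq_sub2l.
  rewrite ler_wpM2l// lef_pV2 ?posrE ?exprn_gt0//.
  by rewrite ler_weXn2l.
pose b := 2 ^+ n.-1 * c * (L / M).
have b0 : 0 <= b by rewrite /b; nonneg.
pose d := n%:R * b ^+ 2 * (M / L) * M / kappa / kappa.
have d0 : 0 <= d.
  by rewrite /d; nonneg.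
have hj j : (i <= j)%N -> (j.+1 < n)%N ->
    kappa ^+ j * (M / L) * `|h j (tail j.+1 x)| <= d.
  move=> ij j1n.
  have txb k : `|tail j.+1 x k 0| <= b / kappa ^+ j.+1.
    rewrite mxE; apply: le_trans (tb j _ ij _) _; last by rewrite /b; lra.
    by rewrite /= addSn ltnS leq_addr.
  have bk1 : b / kappa ^+ j.+1 <= 1.
    have k1 : kappa <= kappa ^+ j.+1 by rewrite exprS ler_peMr// ltW.
    rewrite ler_pdivrMr ?exprn_gt0// mul1r; apply: le_trans k1.
    apply: le_trans (_ : n`!%:R * 1 * (L / M) <= _).
      by apply: ler_wpM2r => //; apply: ler_pM.
    rewrite mulr1 mulrA ler_pdivrMr// [kappa * M]mulrC.
    move: L_small'; rewrite ler_pdivlMr//; apply: le_trans.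
    by rewrite mulrC ler_pM2l// ler_nat factS leq_pmull.
  have t1 : `|tail j.+1 x| <= 1.
    rewrite /Num.Def.normr/= mx_normrE (bigmax_le _ ler01)//= => -[k l] _.
    by rewrite ord1/=; apply: le_trans (txb k) _.
  have en : enorm (tail j.+1 x) ^+ 2 <= n%:R * (b / kappa ^+ j.+1) ^+ 2.
    rewrite /enorm sqr_sqrtr; last by rewrite sumr_ge0// => k _; rewrite sqr_ge0.
    apply: le_trans (_ : \sum_(k < n - j.+1) (b / kappa ^+ j.+1) ^+ 2 <= _).
      apply: ler_sum => k _; rewrite -real_normK ?num_real// lerXn2r ?nnegrE//.
      by rewrite divr_ge0// exprn_ge0 // ltW.
    rewrite sumr_const card_ord -[leLHS]mulr_natl ler_wpM2r ?sqr_ge0//.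
    by rewrite ler_nat leq_subr.
  have hb := h_bound j j1n _ t1.
  have km0 : 0 <= kappa ^+ j * (M / L) by nonneg.
  apply: le_trans (ler_wpM2l km0 hb) _.
  apply: le_trans (ler_wpM2l km0 (ler_wpM2l (ltW M0) en)) _.
  have -> : kappa ^+ j * (M / L) * (M * (n%:R * (b / kappa ^+ j.+1) ^+ 2)) =
     d / kappa ^+ j.
    have : kappa ^+ j != 0 by rewrite gt_eqF// exprn_gt0.
    by rewrite /d (exprS kappa); set kj := kappa ^+ j => kj0; field; rewrite kj0 !gt_eqF.
  by rewrite ler_pdivrMr ?exprn_gt0// ler_peMr// exprn_ege1.
have Gd : `|nonlinearity i x| <= 2 ^+ n.-1 * d.
  apply: le_trans (_ : 2 ^+ (n - i.+1) * d <= _).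
    apply: pascal_le => j /andP[ij _]; case: ifP => [j1n|_]; last by rewrite normr0.
    rewrite normrM ger0_norm; first exact: hj.
    by nonneg.
  by apply: ler_wpM2r => //; rewrite ler_weXn2l ?ler1n// -subn1 leq_sub2l.
have kG : kappa * `|nonlinearity i x| <= kappa * (2 ^+ n.-1 * d) by rewrite ler_pM2l.
apply: le_trans kG _.
have -> : kappa * (2 ^+ n.-1 * d) = (2 ^+ n.-1) ^+ 3 * n%:R * c ^+ 2 * (L / kappa).
  by rewrite /d /b; set w := 2 ^+ n.-1; field; rewrite !gt_eqF.
have cube : (2 ^+ n.-1) ^+ 3 <= n`!%:R ^+ 3 :> R by rewrite lerXn2r// nnegrE ltW.
have n4 : n%:R <= n%:R ^+ 4 :> R by rewrite -[leLHS]expr1 ler_weXn2l.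
have p30 : 0 < 30 ^+ n :> R by rewrite exprn_gt0.
have Lk : L / kappa <= (20 * 30 ^+ n * n%:R ^+ 4 * n`!%:R ^+ 3)^-1.
  by rewrite ler_pdivrMr// mulrC.
have q0 : 0 <= (2 ^+ n.-1) ^+ 3 * n%:R * c ^+ 2 :> R.
  by have n00 := le_trans ler01 nn; nonneg.
apply: le_trans (ler_wpM2l q0 Lk) _.
have nf : 0 < n%:R ^+ 4 * n`!%:R ^+ 3 :> R by rewrite mulr_gt0 ?exprn_gt0// ltr0n.
have -> : (2 ^+ n.-1) ^+ 3 * n%:R * c ^+ 2 / (20 * 30 ^+ n * n%:R ^+ 4 * n`!%:R ^+ 3) =
    1 / 30 ^+ n * (c ^+ 2 / 20) *
    ((2 ^+ n.-1) ^+ 3 * n%:R / (n%:R ^+ 4 * n`!%:R ^+ 3)).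
  by set w := 2 ^+ n.-1; field; rewrite !gt_eqF// ltr0n.
apply: ler_piMr; first by nonneg.
rewrite ler_pdivrMr// mul1r [leRHS]mulrC; apply: ler_pM => //; exact: exprn_ge0.
Qed.

End FeedforwardCoordinates.

(** * Signals of the closed loop *)

Section Uniqueness.
Context {R : realType}.

Lemma zero_derivative_from_right (f : R -> R) (a b c : R) : a < b ->
  f r @[r --> a^'+] --> c ->
  (forall s, a < s < b -> is_derive s (1 : R) f 0) ->
  f r @[r --> b^'-] --> f b ->
  forall s, a < s <= b -> f s = c.
Proof.
move=> ab fa fd fb s /andP[as1 sb].
have fc r : a < r < b -> {for r, continuous f}.
  move=> /fd h; apply: differentiable_continuous; apply/derivable1_diffP.
  by case: h.
apply/eqP; rewrite -subr_eq0 -normr_le0; apply: le_trans (_ : 0 * (s - a) <= _); last by rewrite mul0r.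
apply: dist_le_of_right_derivative => //.
- by move=> r /andP[? ?]; apply: fc; apply/andP; split; lra.
- move: sb; rewrite le_eqVlt => /predU1P[->//|sb].
  by apply: cvg_at_left_filter; apply: fc; apply/andP; split.
move=> r /andP[ar rs]; near=> t.
have tr : r < t by near: t; exact: nbhs_right_gt.
have ts : t < s by near: t; exact: nbhs_right_lt.
have [h ->] : is_derive t (1 : R) f 0 by apply: fd; apply/andP; split; lra.
by rewrite normr0.
Unshelve. all: by end_near. Qed.

Context {n : nat}.

Lemma cV_zero_derivative_from_right (z : R -> 'cV[R]_n) (a b : R) (c : 'cV[R]_n) :
  a < b -> z r @[r --> a^'+] --> c ->
  (forall s, a < s < b -> is_derive s (1 : R) z (0 : 'cV[R]_n)) ->
  z r @[r --> b^'-] --> z b ->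
  forall s, a < s <= b -> z s = c.
Proof.
move=> ab za zd zb s sab; apply/colP => i.
apply: (zero_derivative_from_right (fun r => z r i 0) a b) => //.
- exact: (cvg_cVP _ _ _).1.
- by move=> r /zd /is_derive_cVP /(_ i); rewrite mxE.
- exact: (cvg_cVP _ _ _).1 zb i.
Qed.

Variable h : forall i : nat, 'cV[R]_(n - i.+1) -> R.

(** Once the later coordinates agree, the difference of the i-th ones has zero derivative and tends
    to 0 at the start. *)
Lemma feedforward_unique (z1 z2 : R -> 'cV[R]_n) (w : R -> R) (a b : R) (c : 'cV[R]_n) :
  a < b -> z1 r @[r --> a^'+] --> c -> z2 r @[r --> a^'+] --> c ->
  (forall r, a < r < b -> is_derive r (1 : R) z1 (feedforward h (z1 r) (w r))) ->
  (forall r, a < r < b -> is_derive r (1 : R) z2 (feedforward h (z2 r) (w r))) ->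
  z1 r @[r --> b^'-] --> z1 b -> z2 r @[r --> b^'-] --> z2 b ->
  forall s, a < s <= b -> z1 s = z2 s.
Proof.
move=> ab z1a z2a z1d z2d z1b z2b s sab; apply/colP => i.
have [k] := ubnP (n - i)%N; elim: k i s sab => // k IH i s sab ik.
apply/eqP; rewrite -subr_eq0; apply/eqP.
apply: (zero_derivative_from_right (fun r => z1 r i 0 - z2 r i 0) a b) => //.
- rewrite -(subrr (c i 0)); apply: cvgB; exact: (cvg_cVP _ _ _).1.
- move=> r rab; have -> : 0 = feedforward h (z1 r) (w r) i 0 - feedforward h (z2 r) (w r) i 0.
    apply/esym/eqP; rewrite subr_eq0; apply/eqP/feedforward_ext => j ij.
    apply: IH; first by case/andP: rab => ar rb; rewrite ar ltW.
    have := ltn_ord j; have := ltn_ord i; clear -ij ik; lia.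
  apply: is_deriveB; last exact: (is_derive_cVP _ _ _).1 (z2d r rab) i.
  exact: (is_derive_cVP _ _ _).1 (z1d r rab) i.
- apply: cvgB; [exact: (cvg_cVP _ _ _).1 z1b i|exact: (cvg_cVP _ _ _).1 z2b i].
Qed.

End Uniqueness.

Section Shift.
Context {R : realType} {V : normedModType R}.

Lemma is_derive_translate (z : R -> V) (c r : R) (v : V) :
  is_derive (r - c) (1 : R) z v -> is_derive r (1 : R) (fun s => z (s - c)) v.
Proof.
have E : (fun h => h^-1 *: (((fun s : R => z (s - c)) \o shift r) (h *: 1) - z (r - c))) =
    (fun h => h^-1 *: ((z \o shift (r - c)) (h *: 1) - z (r - c))).
  by apply/funext => k /=; rewrite addrA.
by move=> [zd zv]; split; rewrite /derivable /derive E.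
Qed.

Lemma cvg_at_right_translate (z : R -> V) (c r : R) (l : V) :
  z s @[s --> (r - c)^'+] --> l -> z (s - c) @[s --> r^'+] --> l.
Proof.
move=> zl; apply: (@cvg_comp _ _ _ (fun s => s - c) z) zl => A [e /= e0 he].
exists e => //= s rs sr; apply: he => /=; last by rewrite ltrD2r.
by have -> : r - c - (s - c) = r - s by ring.
Qed.

Lemma cvg_at_left_translate (z : R -> V) (c r : R) (l : V) :
  z s @[s --> (r - c)^'-] --> l -> z (s - c) @[s --> r^'-] --> l.
Proof.
move=> zl; apply: (@cvg_comp _ _ _ (fun s => s - c) z) zl => A [e /= e0 he].
exists e => //= s rs sr; apply: he => /=; last by rewrite ltrD2r.
by have -> : r - c - (s - c) = r - s by ring.
Qed.

End Shift.

Section ResetSequence.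
Context {R : realType} {n : nat}.

Lemma reset_sequence (Lam : 'M[R]_n) (z : R -> 'cV[R]_n) (a d : R) : 0 < d ->
  impulsive_flow (range (fun k : nat => k%:R * d + a)) a z (fun=> 0) ->
  (forall k : nat, jumps_to z (k%:R * d + a) (Lam *m z (k%:R * d + a))) ->
  forall k : nat, z (k%:R * d + a) = iter k (mulmx Lam) (z a) /\
    forall s, k%:R * d < s - a <= k.+1%:R * d -> z s = iter k.+1 (mulmx Lam) (z a).
Proof.
move=> d0 zf zj.
have cell k s : k%:R * d < s - a <= k.+1%:R * d -> z s = Lam *m z (k%:R * d + a).
  move=> /andP[ks sk].
  have kd : 0 <= k%:R * d by rewrite mulr_ge0// ltW.
  apply: (cV_zero_derivative_from_right z (k%:R * d + a) (k.+1%:R * d + a)) => //.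
  - by rewrite ltrD2r ltr_pM2r// ltr_nat.
  - exact: zj.
  - move=> r /andP[kr rk].
    have [|_ rf] := zf r; first by lra.
    have [|_] := rf; last by apply; exact: cvg_cst.
    move=> [j _ jr]; move: kr rk; rewrite -jr !ltrD2r !ltr_pM2r// !ltr_nat ltnS.
    by move=> kj /(leq_trans kj); rewrite ltnn.
  - have [|//] := zf (k.+1%:R * d + a).
    by rewrite ltrDr mulr_gt0.
  - by apply/andP; split; lra.
have all_k k : z (k%:R * d + a) = iter k (mulmx Lam) (z a).
  elim: k => [|k IH]; first by rewrite mul0r add0r.
  rewrite (cell k) ?IH// addrK lexx andbT ltr_pM2r// ltr_nat//.
by move=> k; split => // s ks; rewrite (cell k)//= all_k.
Qed.

End ResetSequence.

Section LoopSignals.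
Context {R : realType} {n : nat} (h : forall i : nat, 'cV[R]_(n - i.+1) -> R)
  (al : 'cV[R]_n -> R) (P Lam : 'M[R]_n) (theta : R) (m : nat) (lbar : 'cV[R]_n)
  (X : signals R n).
Hypothesis h_cont : forall i : nat, (i.+1 < n)%N -> continuous (h i).
Hypothesis al_cont : continuous al.
Hypothesis theta0 : 0 < theta.
Hypothesis m0 : (0 < m)%N.

Local Notation Delta := (m%:R * theta).
Local Notation t := (fun k : nat => k%:R * Delta).
Local Notation f := (feedforward h).

Hypothesis loop : closed_loop f al P Lam theta t lbar X.

Let x := sx X.
Let omega := somega X.
Let xi := sxi X.
Let ell := sell X.
Let psi := spsi X.
Let nu := snu X.
Let ell0 := 2 *: (P *m lbar).

Let Delta0 : 0 < Delta. Proof. by rewrite mulr_gt0// ltr0n. Qed.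

Lemma ellE s : 0 <= s -> ell s = iter (gridn Delta s) (mulmx Lam) ell0.
Proof.
have [_ [_ _ ellf _ ellj] _ [_ _ _ ell00 _]] := loop.
have tE : (fun k : nat => k%:R * Delta + 0) = t by apply/funext => k; rewrite addr0.
have H := @reset_sequence _ _ Lam ell 0 Delta Delta0.
rewrite tE in H; rewrite mul0r in ellf ell00.
have e0 : ell 0 = ell0 by [].
have {}H k : ell (k%:R * Delta) = iter k (mulmx Lam) ell0 /\
    forall s, k%:R * Delta < s <= k.+1%:R * Delta -> ell s = iter k.+1 (mulmx Lam) ell0.
  have [|H1 H2] := H ellf _ k; first by move=> k'; rewrite addr0; have [] := ellj k'.
  rewrite addr0 e0 in H1; split => // r kr.
  by rewrite -e0; apply: H2; rewrite subr0.
rewrite le_eqVlt => /predU1P[<-|s0].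
  by have [] := H 0%N; rewrite mul0r gridn0.
have [k ks] := ex_grid_cell Delta s Delta0 s0.
by rewrite (gridnP _ _ k)//; have [_] := H k; exact.
Qed.

Lemma nuE s : theta <= s -> nu s = iter (gridn Delta (s - theta)) (mulmx Lam) ell0.
Proof.
have [_ _ [_ nuf nuj] [_ _ _ _ nu0]] := loop.
rewrite mul0r add0r in nuf nu0.
have e0 : nu theta = ell0 by [].
have H := @reset_sequence _ _ Lam nu theta Delta Delta0 nuf (fun k => (nuj k).2).
rewrite -subr_ge0 le_eqVlt => /predU1P[e|s0].
  have [+ _] := H 0%N; rewrite mul0r add0r /= -e gridn0 /=.
  by rewrite e0 -[s](subrK theta) -e add0r.
have [k ks] := ex_grid_cell Delta _ Delta0 s0.
by rewrite (gridnP _ _ k)//; have [_ ->] := H k => //; rewrite -e0.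
Qed.

Lemma zero_history s : 0 <= s <= theta -> omega s = 0 /\ psi s = 0.
Proof.
have [_ _ _ [_ z0 _ _ _]] := loop; rewrite !mul0r add0r in z0.
exact: z0.
Qed.

Lemma xi0 : xi 0 = 0.
Proof. by have [_ _ _ [_ _ + _ _]] := loop; rewrite mul0r. Qed.

(** As Delta is a multiple of theta, every sampling, reception and delayed switching time is a
    multiple of theta. Elsewhere the right-hand sides are continuous, which is when [impulsive_flow]
    provides a derivative. *)
Let off s := forall j : nat, s <> j%:R * theta.

Let off_t s : off s -> ~ range t s.
Proof.
move=> os [k _ ks]; apply: (os (k * m)%N).
by rewrite -ks natrM mulrA.
Qed.

Let off_rt s : off s -> ~ range (fun k => t k + theta) s.
Proof.
move=> os [k _ ks]; apply: (os (k * m).+1).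
by rewrite -ks -natr1 mulrDl mul1r natrM mulrA.
Qed.

Let off_shift s : off s -> off (s - theta).
Proof.
move=> os j e; apply: (os j.+1).
by rewrite -natr1 mulrDl mul1r -e subrK.
Qed.

Lemma cell_off (j : nat) s : j%:R * theta < s < j.+1%:R * theta -> off s.
Proof.
move=> /andP[js sj] k sk; move: js sj; rewrite sk !ltr_pM2r// !ltr_nat ltnS.
by move=> jk /(leq_trans jk); rewrite ltnn.
Qed.

Lemma omega_psi_continuous s : 0 < s -> off s ->
  {for s, continuous omega} /\ {for s, continuous psi}.
Proof.
move=> s0 os; have [_ [of_ _ _ _ _] [pf _ _] _] := loop.
rewrite mul0r add0r in of_ pf.
have [st|ts] := ltP s theta.
  have near0 : \forall r \near s, 0 <= r <= theta.
    have sin : s \in `]0, theta[ by rewrite in_itv/= s0 st.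
    have := near_in_itvoo sin; apply: filterS => r.
    by rewrite in_itv/= => /andP[/ltW-> /ltW->].
  have [|o0 p0] := zero_history s; first by rewrite (ltW s0) ltW.
  split; rewrite /continuous_at ?o0 ?p0; apply: cvg_near_cst; apply: filterS near0 => r r0.
    by have [e _] := zero_history r r0; rewrite e.
  by have [_ e] := zero_history r r0; rewrite e.
have {}ts : theta < s.
  rewrite lt_neqAle ts andbT; apply/eqP => e; apply: (os 1%N).
  by rewrite mul1r.
have [_ /(_ (off_rt s os))[oc _]] := of_ s ts.
have [_ /(_ (off_rt s os))[pc _]] := pf s ts.
by split; [exact: oc|exact: pc].
Qed.

Let comp_al (z : R -> 'cV[R]_n) s : {for s, continuous z} ->
  {for s, continuous (fun r => al (z r))}.
Proof. by move=> zc; exact: (@cvg_comp _ _ _ z al _ _ _ zc (al_cont (z s))). Qed.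

Let shift_cont (u : R -> R) s : {for s - theta, continuous u} ->
  {for s, continuous (fun r => u (r - theta))}.
Proof.
move=> uc.
have sc : (fun r : R => r - theta) r @[r --> s] --> s - theta.
  by apply: cvgB; [exact: cvg_id|exact: cvg_cst].
exact: (@cvg_comp _ _ _ (fun r => r - theta) u _ _ _ sc uc).
Qed.

Lemma x_derive s : 0 < s -> off s -> is_derive s (1 : R) x (f (x s) (al (psi s))).
Proof.
move=> s0 os; have [[_ xf] _ _ _] := loop; rewrite mul0r in xf.
have [_ /(_ (fun h => h))[xc]] := xf s s0; apply.
have [oo pp] := omega_psi_continuous s s0 os.
apply: cvg_feedforward; [exact: h_cont|exact: xc|exact: (comp_al psi s pp)].
Qed.

Lemma x_continuous s : 0 < s -> {for s, continuous x}.
Proof.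
move=> s0; have [[_ xf] _ _ _] := loop; rewrite mul0r in xf.
by have [_ /(_ (fun h => h))[]] := xf s s0.
Qed.

Lemma x_right0 : x r @[r --> 0^'+] --> x 0.
Proof. by have [[+ _] _ _ _] := loop; rewrite mul0r. Qed.

Lemma xi_continuous s : 0 < s -> (forall k, s <> t k) -> {for s, continuous xi}.
Proof.
move=> s0 os; have [_ [_ xf _ _ _] _ _] := loop; rewrite mul0r in xf.
have [_] := xf s s0; case => // -[k _ e]; exact: (os k).
Qed.

Lemma xi_left s : 0 < s -> xi r @[r --> s^'-] --> xi s.
Proof.
by move=> s0; have [_ [_ xf _ _ _] _ _] := loop; rewrite mul0r in xf; have [] := xf s s0.
Qed.

Lemma xi_jump k : xi r @[r --> (t k)^'+] --> xi (t k) + gE P (x (t k)) (xi (t k)) (ell (t k)).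
Proof. by have [_ [_ _ _ _ H] _ _] := loop; exact: (H k).1. Qed.

Lemma xi_derive s : 0 < s -> off s -> is_derive s (1 : R) xi (f (xi s) (al (omega s))).
Proof.
move=> s0 os; have [_ [_ xf _ _ _] _ _] := loop; rewrite mul0r in xf.
have [_ /(_ (off_t s os))[xc]] := xf s s0; apply.
have [oo pp] := omega_psi_continuous s s0 os.
apply: cvg_feedforward; [exact: h_cont|exact: xc|exact: (comp_al omega s oo)].
Qed.

Lemma omega_derive s : theta < s -> off s ->
  is_derive s (1 : R) omega (f (omega s) (al (omega (s - theta)))).
Proof.
move=> ts os; have [_ [of_ _ _ _ _] _ _] := loop; rewrite mul0r add0r in of_.
have s0 : 0 < s by exact: lt_trans ts.
have [_ /(_ (off_rt s os))[oc]] := of_ s ts; apply.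
have st : 0 < s - theta by rewrite subr_gt0.
have [oo pp] := omega_psi_continuous (s - theta) st (off_shift s os).
apply: cvg_feedforward; [exact: h_cont|exact: oc|].
by apply: (shift_cont (fun r => al (omega r))); exact: (comp_al omega (s - theta) oo).
Qed.

Lemma psi_derive s : theta < s -> off s ->
  is_derive s (1 : R) psi (f (psi s) (al (psi (s - theta)))).
Proof.
move=> ts os; have [_ _ [pf _ _] _] := loop; rewrite mul0r add0r in pf.
have s0 : 0 < s by exact: lt_trans ts.
have [_ /(_ (off_rt s os))[oc]] := pf s ts; apply.
have st : 0 < s - theta by rewrite subr_gt0.
have [oo pp] := omega_psi_continuous (s - theta) st (off_shift s os).
apply: cvg_feedforward; [exact: h_cont|exact: oc|].
by apply: (shift_cont (fun r => al (psi r))); exact: (comp_al psi (s - theta) pp).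
Qed.

(* On the cell (j theta, (j+1) theta] all three signals solve the same equation, whose
   input is already known to coincide on the previous cell. *)
Lemma omega_psi_xi s : theta <= s -> omega s = xi (s - theta) /\ psi s = xi (s - theta).
Proof.
suff H j s' : theta <= s' <= j.+1%:R * theta ->
    omega s' = xi (s' - theta) /\ psi s' = xi (s' - theta).
  move=> ts; apply: (H (gridn theta s)); rewrite ts /=.
  apply: le_trans (gridn_ge theta s theta0 (le_trans (ltW theta0) ts)) _.
  by rewrite ler_pM2r// ler_nat.
elim: j s' => [|j IH] {}s /andP[ts sj].
  have -> : s = theta by apply/eqP; rewrite eq_le ts andbT; rewrite mul1r in sj.
  have [|-> ->] := zero_history theta; first by rewrite lexx ltW.
  by rewrite subrr xi0.
have [sj1|js] := leP s (j.+1%:R * theta); first by apply: IH; rewrite ts.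
pose a := j.+1%:R * theta; pose b := j.+2%:R * theta.
have ab : a < b by rewrite ltr_pM2r// ltr_nat.
have ta : theta <= a by apply: ler_peMl; [exact: ltW|rewrite ler1n].
have ath : a - theta = j%:R * theta by rewrite /a -natr1 mulrDl mul1r addrK.
have bth : b - theta = j.+1%:R * theta by rewrite /b -natr1 mulrDl mul1r addrK.
have off_ab r : a < r < b -> off r by exact: (cell_off j.+1).
have past r : a < r < b -> psi (r - theta) = omega (r - theta).
  move=> /andP[ar rb].
  have [rt|tr] := leP theta (r - theta).
    by have [|-> ->] := IH (r - theta); rewrite // rt/= -bth lerD2r ltW.
  by have [|-> ->] := zero_history (r - theta); rewrite // (ltW tr) andbT; lra.
have [oa pa] : omega a = xi (a - theta) /\ psi a = xi (a - theta).
  by apply: IH; rewrite ta /a lexx.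
have xid r : a < r < b -> is_derive r (1 : R) (fun r => xi (r - theta))
    (f (xi (r - theta)) (al (omega (r - theta)))).
  move=> rab; apply: is_derive_translate; apply: xi_derive; last exact: off_shift (off_ab r rab).
  by case/andP: rab => ar _; rewrite subr_gt0; exact: le_lt_trans ar.
have xil : xi (r - theta) @[r --> b^'-] --> xi (b - theta).
  by apply: cvg_at_left_translate; apply: xi_left; rewrite bth mulr_gt0.
have [_ [of_ _ _ oj _] [pf _ pj] _] := loop; rewrite mul0r add0r in of_ pf.
have tb : theta < b by apply: le_lt_trans ab.
have ol : omega r @[r --> b^'-] --> omega b by have [] := of_ b tb.
have pl : psi r @[r --> b^'-] --> psi b by have [] := pf b tb.
(* At the start of the cell the three signals either all continue or all jump by the same amount: nu
   at a reception time is ell at the sampling time theta earlier, so the decoder rebuilds the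
   encoder's correction from the symbols. *)
have [c [oc pc xc]] : exists c : 'cV[R]_n, [/\ omega r @[r --> a^'+] --> c,
    psi r @[r --> a^'+] --> c & xi (r - theta) @[r --> a^'+] --> c].
  have [[k _ ka]|na] := pselect (range (fun k => t k + theta) a).
    have tk : t k = a - theta by rewrite -ka addrK.
    exists (omega a + gE P (x (t k)) (xi (t k)) (ell (t k))); split.
    - by rewrite -ka; exact: oj.
    - have [pjk _] := pj k; rewrite /jumps_to ka in pjk.
      suff -> : omega a + gE P (x (t k)) (xi (t k)) (ell (t k)) =
        psi a + gD P (symbol P (x (t k)) (xi (t k))) (nu a) by [].
      rewrite oa pa /gE nuE// ellE; last by rewrite mulr_ge0// ltW.
      by rewrite tk.
    - by apply: cvg_at_right_translate; rewrite oa -tk; exact: xi_jump.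
  have ta' : theta < a.
    rewrite lt_neqAle ta andbT; apply/eqP => e; apply: na.
    by exists 0%N; rewrite // mul0r add0r.
  exists (omega a); split.
  - by have [_ /(_ na)[oc _]] := of_ a ta'; exact: cvg_at_right_filter.
  - rewrite oa -pa; have [_ /(_ na)[pc _]] := pf a ta'; exact: cvg_at_right_filter.
  - apply: cvg_at_right_translate; rewrite oa; apply: cvg_at_right_filter.
    apply: xi_continuous; first by rewrite subr_gt0.
    by move=> k e; apply: na; exists k; rewrite // -e subrK.
have sab : a < s <= b by rewrite js sj.
have od r : a < r < b -> is_derive r (1 : R) omega (f (omega r) (al (omega (r - theta)))).
  by move=> rab; apply: omega_derive; [case/andP: rab => ar _; exact: le_lt_trans ar|exact: off_ab].
have pd r : a < r < b -> is_derive r (1 : R) psi (f (psi r) (al (omega (r - theta)))).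
  move=> rab; rewrite -past//; apply: psi_derive; last exact: off_ab.
  by case/andP: rab => ar _; exact: le_lt_trans ar.
split.
  exact: (feedforward_unique h omega (fun r => xi (r - theta))
    (fun r => al (omega (r - theta))) a b c ab oc xc od xid ol xil s sab).
exact: (feedforward_unique h psi (fun r => xi (r - theta))
  (fun r => al (omega (r - theta))) a b c ab pc xc pd xid pl xil s sab).
Qed.

End LoopSignals.

(** * The matrix that updates the ranges *)

Section RangeMatrix.
Context {R : realType} (n : nat) (F : nat -> R).

Let U : 'M[R]_n := 1%:M - \matrix_(i, j) (if (i < j)%N then F i else 0).

Let U_unit : U \in unitmx.
Proof.
rewrite unitmxE -det_tr det_trig; last first.
  apply/is_trig_mxP => i j ij; rewrite !mxE gt_eqF//= ?subr0//.
  by rewrite ltnNge ltnW// subr0.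
by rewrite big1 ?unitr1// => i _; rewrite !mxE eqxx ltnn subr0.
Qed.

(* With [U] unitriangular, this solves the implicit update [range_matrixE] and has 1/2
   as its only eigenvalue. *)
Definition range_matrix : 'M[R]_n := 2^-1 *: invmx U.

Lemma range_matrixE (v : 'cV[R]_n) (i : 'I_n) :
  (range_matrix *m v) i 0 = v i 0 / 2 +
    F i * \sum_(j < n | (i < j)%N) (range_matrix *m v) j 0.
Proof.
have : U *m (range_matrix *m v) = 2^-1 *: v.
  by rewrite mulmxA -scalemxAr mulmxV// -scalemxAl mul1mx.
move: (range_matrix *m v) => w; rewrite mulmxBl mul1mx => /colP /(_ i).
rewrite !mxE => /(canRL (subrK _)) ->; rewrite mulrC; congr (_ + _).
rewrite mulr_sumr [RHS]big_mkcond/=; apply: eq_bigr => j _.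
by rewrite mxE; case: ifP => // _; rewrite mul0r.
Qed.

(** For a row eigenvector v, multiplying by U gives z v U = v / 2. Since U is unit upper triangular,
    comparing entries from left to right forces v = 0 unless z = 1/2. *)
Lemma range_matrix_schur : schur_stable range_matrix.
Proof.
move=> z /eigenvalueP[v vz v0].
have zU : (z *: v) *m map_mx (real_complex R) U = 2^-1 *: v.
  rewrite -vz -mulmxA -map_mxM /range_matrix -scalemxAl mulVmx//.
  rewrite map_mxZ map_mx1 -scalemxAr mulmx1; congr (_ *: _).
  by rewrite fmorphV rmorph_nat.
suff -> : z = 2^-1 by rewrite normfV normr_nat invf_lt1// ltr1n.
apply/eqP; apply: contraNT v0 => z2; apply/eqP/rowP => j.
rewrite mxE; have [k] := ubnP j; elim: k j => // k IH j jk.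
have := congr1 (fun w : 'rV_n => w 0 j) zU.
rewrite !mxE (bigD1 j)//= big1 ?addr0; last first.
  move=> l lj; rewrite !mxE; have [ltlj|] := ltnP l j.
    by rewrite IH ?mulr0 ?mul0r//; exact: leq_trans ltlj jk.
  by move=> _; rewrite (negbTE lj) subr0 rmorph0 mulr0.
rewrite !mxE eqxx ltnn subr0 rmorph1 mulr1 => /eqP.
by rewrite -subr_eq0 -mulrBl mulf_eq0 subr_eq0 (negbTE z2)/= => /eqP.
Qed.

End RangeMatrix.

(** * Limits, derivatives and norms in p-coordinates *)

Section PCoordinateCalculus.
Context {R : realType} {n : nat} (M L kappa : R).

Definition pweight (i : nat) (j : 'I_n) : R :=
  if (i <= j)%N then p_coef R n i j * (kappa ^+ j * (M / L)) else 0.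

Lemma pcoord_sum (v : 'cV[R]_n) i : pcoord n M L kappa v i = \sum_j pweight i j * v j 0.
Proof.
rewrite /pcoord /p_map big_mkcond; apply: eq_bigr => j _.
by rewrite /pweight; case: ifP => _; rewrite ?mul0r// mxE mulrA.
Qed.

Lemma cvg_pcoord {T : Type} (F : set_system T) {FF : Filter F}
    (z : T -> 'cV[R]_n) (l : 'cV[R]_n) i :
  z r @[r --> F] --> l -> pcoord n M L kappa (z r) i @[r --> F] --> pcoord n M L kappa l i.
Proof.
move=> zl; rewrite pcoord_sum; under eq_fun do rewrite pcoord_sum.
apply: cvg_big => // [|j _]; first exact: add_continuous.
by apply: cvgM; [exact: cvg_cst|exact: (cvg_cVP _ _ _).1 zl j].
Qed.

Lemma is_derive_pcoord (z : R -> 'cV[R]_n) (s : R) (v : 'cV[R]_n) i :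
  is_derive s (1 : R) z v ->
  is_derive s (1 : R) (fun r => pcoord n M L kappa (z r) i) (pcoord n M L kappa v i).
Proof.
move=> /is_derive_cVP zd; rewrite pcoord_sum.
have -> : (fun r => pcoord n M L kappa (z r) i) = \sum_j (fun r => pweight i j * z r j 0).
  by apply/funext => r; rewrite pcoord_sum fct_sumE.
exact: is_derive_sum.
Qed.

Hypothesis M0 : 0 < M.
Hypothesis L0 : 0 < L.
Hypothesis kappa0 : 0 < kappa.

Lemma pweight_ge0 i j : 0 <= pweight i j.
Proof.
rewrite /pweight; case: ifP => // _; rewrite /p_coef.
by rewrite mulr_ge0 ?divr_ge0 ?ler0n// mulr_ge0 ?exprn_ge0 ?divr_ge0// ltW.
Qed.

(** Holds because Phi has nonnegative entries. It explains the initial range 2 Phi lbar: half of it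
    bounds Phi x_0, which is the initial error. *)
Lemma pcoord_norm_le (v w : 'cV[R]_n) i : (forall j, `|v j 0| <= w j 0) ->
  `|pcoord n M L kappa v i| <= pcoord n M L kappa w i.
Proof.
move=> vw; rewrite !pcoord_sum; apply: le_trans (ler_norm_sum _ _ _) _.
apply: ler_sum => j _; rewrite normrM ger0_norm ?pweight_ge0//.
by rewrite ler_wpM2l ?pweight_ge0.
Qed.

Lemma Phi_unit : Phi n M L kappa \in unitmx.
Proof.
rewrite unitmxE -det_tr det_trig; last first.
  apply/is_trig_mxP => i j ij; rewrite mxE mxE -/(pcoord _ _ _ _ _ _) pcoord_sum.
  rewrite big1// => k _; rewrite mxE eqxx andbT /pweight.
  case: ifP => [jk|_]; last by rewrite mul0r.
  have -> : (k == i) = false by apply/negbTE; apply: contraTneq jk => ->; rewrite -ltnNge.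
  by rewrite mulr0.
rewrite unitfE; apply/prodf_neq0 => i _.
rewrite mxE mxE -/(pcoord _ _ _ _ _ _) pcoord_sum (bigD1 i)//= big1 ?addr0.
  rewrite mxE !eqxx mulr1 /pweight leqnn /p_coef subnn.
  rewrite gt_eqF// mulr_gt0//; last by rewrite mulr_gt0 ?exprn_gt0 ?divr_gt0.
by move=> j ji; rewrite mxE (negbTE ji) mulr0.
Qed.

(** In p-coordinates the quantizer decouples: each component is corrected by its symbol times a
    quarter of its range. *)
Lemma pcoord_gD (y nu : 'cV[R]_n) (i : 'I_n) :
  pcoord n M L kappa (gD (Phi n M L kappa) y nu) i = y i 0 * nu i 0 / 4.
Proof.
have four : (4 : R) \is a GRing.unit by rewrite unitfE.
rewrite pcoord_Phi /gD invmxZ ?unitmxZ ?Phi_unit//.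
rewrite -!scalemxAl -scalemxAr !mulmxA mulmxV ?Phi_unit// mul1mx.
by rewrite mul_diag_mx !mxE; field.
Qed.

Lemma entry_le (v : 'cV[R]_n) (c : R) : 0 <= c ->
  (forall i, (i < n)%N -> `|pcoord n M L kappa v i| <= c) ->
  forall j : 'I_n, `|v j 0| <= (\sum_k `|invmx (Phi n M L kappa) j k|) * c.
Proof.
move=> c0 vc j.
have -> : v = invmx (Phi n M L kappa) *m (Phi n M L kappa *m v).
  by rewrite mulmxA mulVmx ?Phi_unit// mul1mx.
rewrite mxE mulr_suml; apply: le_trans (ler_norm_sum _ _ _) _.
apply: ler_sum => k _; rewrite normrM ler_wpM2l// -pcoord_Phi; exact: vc.
Qed.

End PCoordinateCalculus.

(** * From the closed loop to the reduced loop *)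

Section LoopReduction.
Context {R : realType} {n : nat} (h : forall i : nat, 'cV[R]_(n - i.+1) -> R)
  (M L kappa : R) (sigma : R -> R) (eps : nat -> R) (theta : R) (m : nat)
  (lbar : 'cV[R]_n) (Lip : nat -> R -> R).
Hypothesis n0 : (0 < n)%N.
Hypothesis M0 : 0 < M.
Hypothesis L0 : 0 < L.
Hypothesis kappa1 : 1 <= kappa.
Hypothesis h_C2 : forall i : nat, (i.+1 < n)%N -> class_C 2 (h i).
Hypothesis h_bound : forall i : nat, (i.+1 < n)%N ->
  forall v : 'cV[R]_(n - i.+1), `|v| <= 1 -> `|h i v| <= M * enorm v ^+ 2.
Hypothesis L_small : L <= kappa / (20 * 30 ^+ n * n%:R ^+ 4 * n`!%:R ^+ 3).
Hypothesis L_small' : L <= M * kappa / (n.+1)`!%:R.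
Hypothesis sigma_sat : is_saturation sigma.
Hypothesis eps0 : eps 0%N = 1 / 30 ^+ n.
Hypothesis theta0 : 0 < theta.
Hypothesis m0 : (0 < m)%N.
Hypothesis lbar_ge0 : forall i, 0 <= lbar i 0.
Hypothesis LipP : forall i x y B, (i < n)%N ->
  (forall j, (i < j < n)%N ->
     `|pcoord n M L kappa x j| <= B /\ `|pcoord n M L kappa y j| <= B) ->
  `|nonlinearity n h M L kappa i x - nonlinearity n h M L kappa i y| <=
    Lip i B * \sum_(i.+1 <= j < n) `|pcoord n M L kappa x j - pcoord n M L kappa y j|.

Local Notation Delta := (m%:R * theta).
Local Notation pc := (pcoord n M L kappa).
Local Notation NL := (nonlinearity n h M L kappa).
Local Notation al := (alpha sigma eps M L kappa).
Local Notation ell0 := (2 *: (Phi n M L kappa *m lbar)).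

Let kappa0 : 0 < kappa. Proof. exact: lt_le_trans kappa1. Qed.

Lemma continuous_h i : (i.+1 < n)%N -> continuous (h i).
Proof. by move=> /h_C2[]. Qed.

Lemma alphaE (v : 'cV[R]_n) : al v = - (L / (M * kappa ^+ n)) * nested sigma eps (pc v) n.
Proof. by rewrite /alpha lam_nested. Qed.

Lemma nested_pcoord0 k : nested sigma eps (pc 0) k = 0.
Proof.
rewrite -(nested0 sigma eps sigma_sat k); congr (nested _ _ _ k).
by apply/funext => j; exact: pcoord0.
Qed.

Lemma alpha0 : al (0 : 'cV[R]_n) = 0.
Proof. by rewrite alphaE nested_pcoord0 mulr0. Qed.

Lemma cvg_nested {T : Type} (G : set_system T) {FG : Filter G} (z : T -> 'cV[R]_n)
    (v : 'cV[R]_n) k : z r @[r --> G] --> v ->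
  nested sigma eps (pc (z r)) k @[r --> G] --> nested sigma eps (pc v) k.
Proof.
move=> zv; elim: k => [|k IH] /=; first exact: cvg_cst.
apply: cvgM; first exact: cvg_cst.
have c : (pc (z r) k + nested sigma eps (pc (z r)) k) / eps k @[r --> G] -->
    (pc v k + nested sigma eps (pc v) k) / eps k.
  by apply: cvgM; [apply: cvgD => //; exact: cvg_pcoord|exact: cvg_cst].
exact: (@cvg_comp _ _ _ (fun r => (pc (z r) k + nested sigma eps (pc (z r)) k) / eps k)
  sigma _ _ _ c (continuous_saturation sigma sigma_sat _)).
Qed.

Lemma continuous_alpha : continuous (al : 'cV[R]_n -> R).
Proof.
have -> : (al : 'cV[R]_n -> R) = fun v => - (L / (M * kappa ^+ n)) * nested sigma eps (pc v) n.
  by apply/funext => v; exact: alphaE.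
move=> v; have FF : Filter (nbhs v) := nbhs_filter v.
have c := @cvg_nested _ (nbhs v) FF id v n (fun A => id).
by apply: (@cvgM _ _ (nbhs v) FF (fun=> _) _ _ _ _ c); exact: cvg_cst.
Qed.

Lemma nonlinearity0 i : (i < n)%N -> NL i 0 = 0.
Proof.
move=> ltin; have H : kappa * `|NL i 0| <= 1 / 30 ^+ n * (0 ^+ 2 / 20).
  apply: nonlinearity_small => // [|j _]; first by rewrite lexx ler01.
  by rewrite pcoord0 normr0.
rewrite expr0n/= mul0r mulr0 pmulr_rle0// in H.
by apply/eqP; rewrite -normr_le0.
Qed.

Variable F : nat -> R.
Variable X : signals R n.
Local Notation Lam := (range_matrix n (fun i => Delta * F i)).
Hypothesis loop : closed_loop (feedforward h) al (Phi n M L kappa) Lam theta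
  (fun k : nat => k%:R * Delta) lbar X.

(** One function that serves both as Lipschitz constant, through the summand 1, and as bound on the
    nonlinearity, which vanishes at 0 and has at most n arguments of size |B|. *)
Definition Lip_affine (i : nat) (B : R) : R := Lip i `|B| * (n%:R * `|B| + 1).

Hypothesis Lip_ge0 : forall i B, 0 <= Lip i B.

Lemma reduced_loop_of_closed_loop :
  reduced_loop n m theta kappa sigma eps Lip_affine (\sum_i ell0 i 0) F
    (fun i s => pc (sx X s) i) (fun i s => pc (sxi X s) i)
    (fun i s => NL i (sx X s)) (fun i s => NL i (sxi X s))
    (fun k i => entry n (iter k (mulmx Lam) ell0) i).
Proof.
have hc := continuous_h; have ac := continuous_alpha; have a0 := alpha0.
have D0 : 0 < Delta by rewrite mulr_gt0// ltr0n.
have off_t s : off_grid theta s -> forall k : nat, s <> k%:R * Delta.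
  by move=> os k e; apply: (os (k * m)%N); rewrite e natrM mulrA.
have ell0E (i : 'I_n) : ell0 i 0 = 2 * pc lbar i by rewrite mxE -pcoord_Phi.
have pl0 (i : nat) : 0 <= pc lbar i.
  by rewrite pcoord_sum sumr_ge0// => j _; rewrite mulr_ge0// pweight_ge0.
have x0l (i : nat) : `|pc (sx X 0) i| <= pc lbar i.
  apply: pcoord_norm_le => // j.
  by have [_ _ _ [+ _ _ _ _]] := loop; rewrite mul0r.
have entry_iter (k : nat) (i : 'I_n) : entry n (iter k (mulmx Lam) ell0) i = iter k (mulmx Lam) ell0 i 0.
  exact: entryE.
have ell0_entry i : (i < n)%N -> entry n ell0 i = 2 * pc lbar i.
  by move=> ltin; rewrite -[(i)]/(nat_of_ord (Ordinal ltin)) entryE ell0E.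
have psiE s : 0 < s -> spsi X s = if s <= theta then 0 else sxi X (s - theta).
  move=> s0; case: ifP => st.
    by have [_ _ _ [_ /(_ s) + _ _ _]] := loop; rewrite !mul0r add0r (ltW s0) st => /(_ isT)[].
  have ts : theta <= s by rewrite ltW// ltNge st.
  by have [_] := omega_psi_xi h al _ _ theta m lbar X hc ac theta0 m0 loop s ts.
have omegaE s : 0 < s -> somega X s = spsi X s.
  move=> s0; rewrite psiE//; case: ifP => st.
    by have [_ _ _ [_ /(_ s) + _ _ _]] := loop; rewrite !mul0r add0r (ltW s0) st => /(_ isT)[].
  have ts : theta <= s by rewrite ltW// ltNge st.
  by have [] := omega_psi_xi h al _ _ theta m lbar X hc ac theta0 m0 loop s ts.
have ctrl s : 0 < s -> nested sigma eps (pc (spsi X s)) n =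
    delayed_control n theta sigma eps (fun i s => pc (sxi X s) i) s.
  move=> s0; rewrite psiE// /delayed_control; case: ifP => // _.
  exact: nested_pcoord0.
have xd i s : (i < n)%N -> 0 < s -> off_grid theta s ->
    is_derive s (1 : R) (fun r => pc (sx X r) i)
      (p_rate n theta kappa sigma eps (fun i s => pc (sx X s) i) (fun i s => pc (sxi X s) i)
         (fun i s => NL i (sx X s)) i s).
  move=> ltin s0 os.
  have := x_derive h al _ _ theta m lbar X hc ac loop s s0 os.
  move=> /(is_derive_pcoord M L kappa _ _ _ i).
  by rewrite pcoord_closed_loop// ctrl.
have xid i s : (i < n)%N -> 0 < s -> off_grid theta s ->
    is_derive s (1 : R) (fun r => pc (sxi X r) i)
      (p_rate n theta kappa sigma eps (fun i s => pc (sxi X s) i) (fun i s => pc (sxi X s) i)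
         (fun i s => NL i (sxi X s)) i s).
  move=> ltin s0 os.
  have := xi_derive h al _ _ theta m lbar X hc ac loop s s0 os.
  move=> /(is_derive_pcoord M L kappa _ _ _ i).
  by rewrite omegaE// pcoord_closed_loop// ctrl.
have xc s : 0 < s -> {for s, continuous (sx X)}.
  exact: (x_continuous h al _ _ theta m lbar X loop).
split.
- move=> i ltin; apply: cvg_pcoord.
  exact: (x_right0 h al _ _ theta m lbar X loop).
- by move=> i s ltin s0; apply: cvg_pcoord; exact: xc.
- by [].
- move=> i s ltin s0 os; apply: cvgB; apply: cvg_pcoord; first exact: xc.
  exact: (xi_continuous h al _ _ theta m lbar X loop).
- move=> i s ltin s0; apply: cvgB; apply: cvg_pcoord.
    by apply: cvg_at_left_filter; exact: xc.
  exact: (xi_left h al _ _ theta m lbar X loop).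
- move=> i s ltin s0 os.
  apply: (@is_derive_eq _ _ _ _ _ _ _ _ (is_deriveB (xd i s ltin s0 os) (xid i s ltin s0 os))).
  by rewrite /p_rate sumrB; ring.
- move=> i k ltin.
  have k0 : 0 <= k%:R * Delta by rewrite mulr_ge0// ltW.
  set tk := k%:R * Delta in k0 *.
  have xj := xi_jump h al _ _ theta m lbar X loop k.
  rewrite -/tk (ellE h al _ _ theta m lbar X theta0 m0 loop)// in xj.
  have gk : gridn Delta tk = k.
    rewrite /tk; case: (k) => [|k']; first by rewrite mul0r gridn0.
    by rewrite (gridnP _ _ k')// lexx andbT ltr_pM2r// ltr_nat.
  rewrite gk in xj.
  have := @cvg_pcoord R n M L kappa _ _ _ _ _ i xj.
  set w := iter _ _ _ => xj'.
  have -> : pc (sx X tk) i - pc (sxi X tk) i - Num.sg (pc (sx X tk) i - pc (sxi X tk) i) *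
      entry n w i / 4 = pc (sx X tk) i -
      pc (sxi X tk + gE (Phi n M L kappa) (sx X tk) (sxi X tk) w) i.
    have -> (a b : 'cV[R]_n) : pc (a + b) i = pc a i + pc b i.
      by rewrite !pcoord_sum -big_split; apply: eq_bigr => j _; rewrite mxE mulrDr.
    rewrite -[(i)]/(nat_of_ord (Ordinal ltin)) /gE pcoord_gD// entryE.
    by rewrite mxE -pcoord_Phi pcoordB opprD addrA.
  apply: cvgB; last exact: xj'.
  apply: cvg_pcoord; move: k0; rewrite le_eqVlt => /predU1P[<-|k0]; last first.
    by apply: cvg_at_right_filter; exact: xc.
  exact: (x_right0 h al _ _ theta m lbar X loop).
- move=> i ltin /=; rewrite ell0_entry//; apply: le_trans (x0l i) _.
  by have := pl0 i; lra.
- move=> i ltin /=; rewrite ell0_entry//.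
  rewrite (xi0 h al _ _ theta m lbar X loop) pcoord0 subr0 mulrC mulKf//; exact: x0l.
- move=> i ltin /=; rewrite ell0_entry//; apply/andP; split; first by rewrite mulr_ge0.
  rewrite (bigD1 (Ordinal ltin))//= ell0E lerDl sumr_ge0// => j _.
  by rewrite ell0E mulr_ge0.
- move=> k i ltin /=.
  rewrite -[(i)]/(nat_of_ord (Ordinal ltin)) !entryE range_matrixE /=; congr (_ + _ * _).
  rewrite (@big_nat_widenl _ _ _ i.+1 0 n)// big_mkord; apply: eq_big => // j _.
  by rewrite entryE.
- move=> i s c ltin s0 c01 pc1; rewrite eps0; exact: nonlinearity_small.
- move=> i s B ltin s0 pB.
  have -> : NL i (sx X s) = NL i (sx X s) - NL i 0 by rewrite nonlinearity0// subr0.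
  apply: le_trans (LipP i (sx X s) 0 `|B| ltin _) _ => [j ij|].
    by rewrite pcoord0 normr0; split => //; apply: le_trans (pB j ij) (ler_norm _).
  rewrite /Lip_affine; apply: ler_wpM2l => //.
  apply: le_trans (_ : n%:R * `|B| <= _); last by rewrite lerDl.
  rewrite -[leLHS]ger0_norm; last by rewrite sumr_ge0.
  apply: norm_sum_nat_le => // j ij.
  by rewrite pcoord0 subr0 normr_id; apply: le_trans (pB j ij) (ler_norm _).
- move=> i s B ltin s0 pB.
  apply: le_trans (LipP i (sx X s) (sxi X s) `|B| ltin _) _ => [j ij|].
    have [? ?] := pB j ij.
    by split; [apply: le_trans (ler_norm B)|apply: le_trans (ler_norm B)].
  rewrite /Lip_affine; apply: ler_wpM2r; first by rewrite sumr_ge0.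
  by apply: ler_peMr => //; rewrite lerDr mulr_ge0.
Qed.

End LoopReduction.

(** * Existence of solutions *)

Section Gluing.
Context {R : realType} {n : nat} (theta : R).
Hypothesis theta0 : 0 < theta.
Implicit Types (z : R -> 'cV[R]_n) (Z V : nat -> R -> 'cV[R]_n).

Lemma is_derive_glue z z1 z2 (s : R) (l : 'cV[R]_n) :
  (\forall r \near s^'-, z r = z1 r) -> (\forall r \near s^'+, z r = z2 r) ->
  z s = z1 s -> z s = z2 s ->
  is_derive s (1 : R) z1 l -> is_derive s (1 : R) z2 l -> is_derive s (1 : R) z l.
Proof.
move=> zl zr e1 e2 d1 d2.
have q (w : R -> 'cV[R]_n) : is_derive s (1 : R) w l ->
    (fun k => k^-1 *: ((w \o shift s) (k *: 1) - w s)) @ 0^' --> l.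
  by move=> [wd <-]; exact: wd.
suff c : (fun k => k^-1 *: ((z \o shift s) (k *: 1) - z s)) @ 0^' --> l.
  by apply: DeriveDef; [apply: cvgP c|exact: cvg_lim].
apply/cvgrPdist_lt => e e0.
have /cvgrPdist_lt /(_ e e0) h1 := q z1 d1.
have /cvgrPdist_lt /(_ e e0) h2 := q z2 d2.
move: zl zr => [a1 /= a10 ha1] [a2 /= a20 ha2].
near=> k.
have k0 : k != 0 by near: k; exact: nbhs_dnbhs_neq.
have k1 : `|k| < a1 by near: k; exact: dnbhs0_lt.
have k2 : `|k| < a2 by near: k; exact: dnbhs0_lt.
have b1 : `|l - k^-1 *: ((z1 \o shift s) (k *: 1) - z1 s)| < e by near: k.
have b2 : `|l - k^-1 *: ((z2 \o shift s) (k *: 1) - z2 s)| < e by near: k.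
have ks : s - (k *: 1 + s) = - k by rewrite [k *: 1]mulr1; ring.
have [kn|kp|k00] := ltrgt0P k; last by rewrite k00 eqxx in k0.
  rewrite /= (_ : z (k *: 1 + s) = z2 (k *: 1 + s)).
    by move: b2; rewrite /= e2.
  apply: ha2 => /=; first by rewrite ks normrN.
  by rewrite [k *: 1]mulr1 ltrDr.
rewrite /= (_ : z (k *: 1 + s) = z1 (k *: 1 + s)).
  by move: b1; rewrite /= e1.
apply: ha1 => /=; first by rewrite ks normrN.
by rewrite [k *: 1]mulr1 gtrDr.
Unshelve. all: by end_near. Qed.

Definition cell_index (s : R) : nat := if s <= 0 then 0%N else gridn theta s.

(* The cell of index [j] is ((j - 1) theta, j theta], traversed by the local time
   in (0, theta]; all negative times belong to the cell of index 0. *)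
Definition glue_cells Z (s : R) : 'cV[R]_n :=
  Z (cell_index s) (s - (cell_index s)%:R * theta + theta).

Lemma glueE Z (j : nat) (s : R) : j%:R * theta < s <= j.+1%:R * theta ->
  glue_cells Z s = Z j.+1 (s - j%:R * theta).
Proof.
move=> js; rewrite /glue_cells /cell_index ifF; last first.
  apply/negbTE; rewrite -ltNge; case/andP: js => + _; apply: le_lt_trans.
  by rewrite mulr_ge0// ltW.
rewrite (gridnP _ _ j)//; congr (Z _ _).
by rewrite -natr1; ring.
Qed.

Lemma glue_neg Z s : s <= 0 -> glue_cells Z s = Z 0%N (s + theta).
Proof. by move=> s0; rewrite /glue_cells /cell_index s0 mul0r subr0. Qed.

Lemma glue_end Z (j : nat) : glue_cells Z (j%:R * theta) = Z j theta.
Proof.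
case: j => [|j]; first by rewrite mul0r glue_neg// add0r.
rewrite (glueE _ j); first by rewrite -natr1; congr (Z _ _); ring.
by rewrite lexx andbT ltr_pM2r// ltr_nat.
Qed.

Lemma near_glue_right Z (j : nat) :
  \forall r \near (j%:R * theta)^'+, glue_cells Z r = Z j.+1 (r - j%:R * theta).
Proof.
near=> r; apply: glueE; apply/andP; split; first by near: r; exact: nbhs_right_gt.
by apply: ltW; near: r; apply: nbhs_right_lt; rewrite ltr_pM2r// ltr_nat.
Unshelve. all: by end_near. Qed.

Lemma near_glue_left Z (j : nat) :
  \forall r \near (j.+1%:R * theta)^'-, glue_cells Z r = Z j.+1 (r - j%:R * theta).
Proof.
near=> r; apply: glueE; apply/andP; split; last by apply: ltW; near: r; exact: nbhs_left_lt.
by near: r; apply: nbhs_left_gt; rewrite ltr_pM2r// ltr_nat.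
Unshelve. all: by end_near. Qed.

Lemma near_glue Z (j : nat) (s : R) : j%:R * theta < s < j.+1%:R * theta ->
  \forall r \near s, glue_cells Z r = Z j.+1 (r - j%:R * theta).
Proof.
move=> js; have sin : s \in `]j%:R * theta, j.+1%:R * theta[ by rewrite in_itv.
have := near_in_itvoo sin; apply: filterS => r; rewrite in_itv/= => /andP[r1 r2].
by apply: glueE; rewrite r1 ltW.
Qed.

Lemma cvg_local (w : R -> 'cV[R]_n) (c s : R) : {for s - c, continuous w} ->
  w (r - c) @[r --> s] --> w (s - c).
Proof.
move=> wc; apply: (@cvg_comp _ _ _ (fun r => r - c) w _ _ _ _ wc).
by apply: cvgB; [exact: cvg_id|exact: cvg_cst].
Qed.

Lemma glue_jump Z (j : nat) : continuous (Z j.+1) ->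
  glue_cells Z r @[r --> (j%:R * theta)^'+] --> Z j.+1 0.
Proof.
move=> Zc; rewrite -[X in Z _ X](subrr (j%:R * theta)).
have c : Z j.+1 (r - j%:R * theta) @[r --> (j%:R * theta)^'+] --> Z j.+1 (j%:R * theta - j%:R * theta).
  by apply: cvg_at_right_filter; apply: cvg_local; exact: Zc.
apply: cvg_trans c; apply: near_eq_cvg.
by apply: filterS (near_glue_right Z j) => r ->.
Qed.

Lemma glue_left Z (j : nat) : continuous (Z j.+1) ->
  glue_cells Z r @[r --> (j.+1%:R * theta)^'-] --> glue_cells Z (j.+1%:R * theta).
Proof.
move=> Zc; rewrite glue_end.
have e : j.+1%:R * theta - j%:R * theta = theta by rewrite -natr1; ring.
have c : Z j.+1 (r - j%:R * theta) @[r --> (j.+1%:R * theta)^'-] --> Z j.+1 theta.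
  rewrite -[X in Z _ X]e.
  by apply: cvg_at_left_filter; apply: cvg_local; exact: Zc.
apply: cvg_trans c; apply: near_eq_cvg.
by apply: filterS (near_glue_left Z j) => r ->.
Qed.

(** [impulsive_flow] asks for a derivative also at a grid time where no jump is allowed and v
    happens to be continuous. There continuity of v equates the two one-sided derivatives of the
    glued pieces. *)
Lemma glue_flow (J : set R) Z V (v : R -> 'cV[R]_n) :
  (forall j r, is_derive r (1 : R) (Z j.+1) (V j.+1 r)) ->
  (forall j, continuous (V j.+1)) ->
  (forall (j : nat) s, j%:R * theta < s <= j.+1%:R * theta -> v s = V j.+1 (s - j%:R * theta)) ->
  (forall j : nat, ~ J (j.+1%:R * theta) -> Z j.+2 0 = Z j.+1 theta) ->
  impulsive_flow J 0 (glue_cells Z) v.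
Proof.
move=> Zd Vc vE ZJ s s0.
have Zc j : continuous (Z j.+1).
  move=> r; apply: differentiable_continuous; apply/derivable1_diffP.
  by case: (Zd j r).
have [j /andP[js]] := ex_grid_cell theta s theta0 s0.
rewrite le_eqVlt => /predU1P[sj|sj]; last first.
  have jsj : j%:R * theta < s < j.+1%:R * theta by rewrite js.
  have ng := near_glue Z j s jsj.
  have gs : glue_cells Z s = Z j.+1 (s - j%:R * theta) by apply: glueE; rewrite js ltW.
  have gc : {for s, continuous (glue_cells Z)}.
    suff : glue_cells Z r @[r --> s] --> Z j.+1 (s - j%:R * theta) by rewrite -gs.
    have c : Z j.+1 (r - j%:R * theta) @[r --> s] --> Z j.+1 (s - j%:R * theta).
      by apply: cvg_local; exact: Zc.
    by apply: cvg_trans c; apply: near_eq_cvg; apply: filterS ng => r ->.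
  split; first exact: cvg_at_left_filter.
  move=> _; split => // _; rewrite (vE j); last by rewrite js ltW.
  apply: (@near_eq_is_derive _ _ _ (fun r => Z j.+1 (r - j%:R * theta))).
    by apply: filterS ng => r ->.
  by apply: is_derive_translate; exact: Zd.
rewrite {}sj in s0 js *; set s' := j.+1%:R * theta in s0 js *.
have gl := glue_left Z j (Zc j).
have gr := glue_jump Z j.+1 (Zc j.+1).
split; first exact: gl.
move=> nJ; have e := ZJ j nJ.
split.
  apply/left_right_continuousP; split; first exact: gl.
  by rewrite glue_end -e; exact: gr.
move=> vc.
have vr : V j.+2 0 = v s'.
  have vl : v r @[r --> s'^'+] --> V j.+2 0.
    rewrite -[X in V _ X](subrr s').
    have c : V j.+2 (r - s') @[r --> s'^'+] --> V j.+2 (s' - s').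
      by apply: cvg_at_right_filter; apply: cvg_local; exact: Vc.
    apply: cvg_trans c; apply: near_eq_cvg; near=> r; rewrite (vE j.+1)//.
    apply/andP; split; first by near: r; exact: nbhs_right_gt.
    by apply: ltW; near: r; apply: nbhs_right_lt; rewrite ltr_pM2r// ltr_nat.
  have vl' : v r @[r --> s'^'+] --> v s' by exact: cvg_at_right_filter.
  exact: (cvg_unique _ vl vl').
have sj : s' - j%:R * theta = theta by rewrite /s' -natr1; ring.
apply: (@is_derive_glue _ (fun r => Z j.+1 (r - j%:R * theta)) (fun r => Z j.+2 (r - s'))).
- exact: near_glue_left.
- exact: near_glue_right.
- by rewrite glue_end sj.
- by rewrite glue_end subrr e.
- apply: is_derive_translate.
  have -> : v s' = V j.+1 (s' - j%:R * theta).
    by apply: vE; rewrite lexx andbT ltr_pM2r// ltr_nat.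
  exact: Zd.
- by apply: is_derive_translate; rewrite -vr subrr; exact: Zd.
Unshelve. all: by end_near. Qed.

Lemma impulsive_flow_translate (J J' : set R) (s0 c : R) z v :
  (forall s, J s -> J' (s + c)) ->
  impulsive_flow J s0 z v ->
  impulsive_flow J' (s0 + c) (fun s => z (s - c)) (fun s => v (s - c)).
Proof.
move=> JJ zf s s0s.
have [|zl zc] := zf (s - c); first by rewrite ltrBrDr.
split; first exact: cvg_at_left_translate.
move=> nJ; have [|zc1 zc2] := zc.
  by move=> /JJ; rewrite subrK.
split; first exact: cvg_local.
move=> vc; apply: is_derive_translate; apply: zc2.
have h : v (r - c + c - c) @[r --> s] --> v (s - c) by under eq_fun do rewrite subrK.
have sh : (fun r : R => r + c) r @[r --> s - c] --> s.
  by rewrite -[X in _ --> X](subrK c); apply: cvgD; [exact: cvg_id|exact: cvg_cst].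
have := @cvg_comp _ _ _ (fun r => r + c) (fun r => v (r - c)) _ _ _ sh vc.
by apply: cvg_trans; apply: near_eq_cvg; near=> r; rewrite /= addrK.
Unshelve. all: by end_near. Qed.

End Gluing.

Section Existence.
Context {R : realType} {n : nat} (h : forall i : nat, 'cV[R]_(n - i.+1) -> R)
  (al : 'cV[R]_n -> R) (P Lam : 'M[R]_n) (theta : R) (m : nat) (lbar x0 : 'cV[R]_n).
Hypothesis h_cont : forall i : nat, (i.+1 < n)%N -> continuous (h i).
Hypothesis al_cont : continuous al.
Hypothesis theta0 : 0 < theta.
Hypothesis x0l : forall i, `|x0 i 0| <= lbar i 0.

Local Notation f := (feedforward h).

Lemma flow_choice : exists phi : (R -> R) -> 'cV[R]_n -> R -> 'cV[R]_n,
  forall u z0, continuous u -> phi u z0 0 = z0 /\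
    forall r, is_derive r (1 : R) (phi u z0) (f (phi u z0 r) (u r)).
Proof.
have /choice[phi H] (uz : (R -> R) * 'cV[R]_n) : exists z : R -> 'cV[R]_n,
    continuous uz.1 -> z 0 = uz.2 /\
    forall r, is_derive r (1 : R) z (f (z r) (uz.1 r)).
  have [uc|nuc] := pselect (continuous uz.1); last by exists (cst 0).
  by have [z z0 zd] := feedforward_flow h h_cont uz.1 uz.2 uc; exists z.
by exists (fun u z0 => phi (u, z0)) => u z0 uc; exact: (H (u, z0) uc).
Qed.

(** Only x, xi and ell are constructed; omega and psi are taken to be xi(. - theta), and nu to be
    ell(. - theta), as every solution must have it after theta. *)
Lemma closed_loop_exists : exists2 X : signals R n,
  closed_loop f al P Lam theta (fun k : nat => k%:R * (m%:R * theta)) lbar X &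
  sx X (0%:R * (m%:R * theta)) = x0.
Proof.
have [phi phiP] := flow_choice.
pose cell : Type := ((R -> 'cV[R]_n) * (R -> 'cV[R]_n) * 'cV[R]_n)%type.
(* Method of steps: on a cell the control is a function of xi on the previous cell, hence a known
   continuous input in local time. Cell j + 1 starts at j theta, a sampling time exactly when m
   divides j. *)
pose next (j : nat) (c : cell) : cell :=
  let x := c.1.1 theta in let xi := c.1.2 theta in
  let u := fun r => al (c.1.2 r) in
  if (m %| j)%N then (phi u x, phi u (xi + gE P x xi c.2), Lam *m c.2)
  else (phi u x, phi u xi, c.2).
pose cells := fix cells (j : nat) : cell :=
  if j is j'.+1 then next j' (cells j') else (cst x0, cst 0, 2 *: (P *m lbar)).
pose Zx j := (cells j).1.1.
pose Zxi j := (cells j).1.2.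
pose Zell j (r : R) := (cells j).2.
pose u j r := al (Zxi j r).
have der_cont (z v : R -> 'cV[R]_n) :
    (forall r, is_derive r (1 : R) z (v r)) -> continuous z.
  by move=> zd r; apply: differentiable_continuous; apply/derivable1_diffP; case: (zd r).
have comp_al (z : R -> 'cV[R]_n) : continuous z -> continuous (fun r => al (z r)).
  by move=> zc r; exact: (@cvg_comp _ _ _ z al _ _ _ (zc r) (al_cont (z r))).
have Zxi_cont j : continuous (Zxi j).
  elim: j => [|j IH]; first by move=> r; exact: cvg_cst.
  have uc : continuous (u j) by exact: comp_al.
  rewrite /Zxi /= /next; case: ifP => _ /=; exact: der_cont (phiP (u j) _ uc).2.
have uc j : continuous (u j) by exact: comp_al.
have ZxE j : Zx j.+1 = phi (u j) (Zx j theta).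
  by rewrite /Zx /= /next; case: ifP.
have ZxiE j : Zxi j.+1 = phi (u j) (Zxi j theta +
    (if (m %| j)%N then gE P (Zx j theta) (Zxi j theta) (Zell j 0) else 0)).
  by rewrite /Zxi /= /next; case: ifP => //; rewrite addr0.
have ZellE j r : Zell j.+1 r = if (m %| j)%N then Lam *m Zell j 0 else Zell j 0.
  by rewrite /Zell /= /next; case: ifP.
have Zxd j r : is_derive r (1 : R) (Zx j.+1) (f (Zx j.+1 r) (u j r)).
  by rewrite ZxE; exact: ((phiP (u j) (Zx j theta) (uc j)).2 r).
have Zxid j r : is_derive r (1 : R) (Zxi j.+1) (f (Zxi j.+1 r) (u j r)).
  by rewrite ZxiE; exact: ((phiP (u j) _ (uc j)).2 r).
have Zx_start j : Zx j.+1 0 = Zx j theta.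
  by rewrite ZxE; exact: (phiP (u j) (Zx j theta) (uc j)).1.
have Zxi_start j : Zxi j.+1 0 = Zxi j theta +
    (if (m %| j)%N then gE P (Zx j theta) (Zxi j theta) (Zell j 0) else 0).
  by rewrite ZxiE; exact: (phiP (u j) _ (uc j)).1.
have Zx_cont j : continuous (Zx j.+1) := der_cont _ _ (Zxd j).
have fc (Z : nat -> R -> 'cV[R]_n) j : (forall j, continuous (Z j.+1)) ->
    continuous (fun r => f (Z j.+1 r) (u j r)).
  by move=> Zc r; apply: (@cvg_feedforward _ _ h h_cont _ (nbhs r)); [exact: Zc|exact: uc].
pose x := glue_cells theta Zx.
pose xi := glue_cells theta Zxi.
pose ell := glue_cells theta Zell.
pose psi s := xi (s - theta).
pose nu s := ell (s - theta).
have tE k : k%:R * (m%:R * theta) = (k * m)%:R * theta by rewrite natrM mulrA.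
have psiE j s : j%:R * theta < s <= j.+1%:R * theta -> psi s = Zxi j (s - j%:R * theta).
  case: j => [|j] /andP[js sj].
    by rewrite /psi /xi glue_neg//; rewrite mul1r in sj; lra.
  rewrite /psi /xi (glueE theta theta0 Zxi j).
    by congr (Zxi _ _); rewrite -natr1; ring.
  move: js sj; rewrite -(natr1 j.+1) -(natr1 j); rewrite !mulrDl !mul1r => js sj.
  by apply/andP; split; lra.
have not_sample j : ~ range (fun k : nat => k%:R * (m%:R * theta)) (j%:R * theta) -> (m %| j)%N = false.
  by move=> nj; apply/negbTE/negP => /dvdnP[k jk]; apply: nj; exists k; rewrite // tE jk.
pose X := Signals x psi xi ell psi nu.
have xf : impulsive_flow set0 0 x (fun s => f (x s) (al (psi s))).
  apply: (@glue_flow _ _ theta theta0 set0 Zx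
    (fun j r => if j is j'.+1 then f (Zx j'.+1 r) (u j' r) else 0)) => //.
  - by move=> j; exact: (fc Zx).
  - by move=> j s js; rewrite (psiE j)// /x (glueE theta theta0 Zx j).
have xif : impulsive_flow (range (fun k : nat => k%:R * (m%:R * theta))) 0 xi
    (fun s => f (xi s) (al (psi s))).
  apply: (@glue_flow _ _ theta theta0 _ Zxi
    (fun j r => if j is j'.+1 then f (Zxi j'.+1 r) (u j' r) else 0)) => //.
  - by move=> j; exact: (fc Zxi j (fun i => Zxi_cont i.+1)).
  - by move=> j s js; rewrite (psiE j)// /xi (glueE theta theta0 Zxi j).
  - by move=> j nj; rewrite Zxi_start not_sample// addr0.
have ellf : impulsive_flow (range (fun k : nat => k%:R * (m%:R * theta))) 0 ell (fun=> 0).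
  apply: (@glue_flow _ _ theta theta0 _ Zell (fun j r => 0)) => //.
  - by move=> j r; exact: cvg_cst.
  - by move=> j nj; rewrite ZellE not_sample.
have shiftJ (s : R) : range (fun k : nat => k%:R * (m%:R * theta)) s ->
    range (fun k : nat => k%:R * (m%:R * theta) + theta) (s + theta).
  by move=> [k _ <-]; exists k.
have psif : impulsive_flow (range (fun k : nat => k%:R * (m%:R * theta) + theta)) theta
    psi (fun s => f (psi s) (al (psi (s - theta)))).
  by rewrite -[X in impulsive_flow _ X]add0r; exact: (impulsive_flow_translate _ _ _ _ _ _ shiftJ xif).
have nuf : impulsive_flow (range (fun k : nat => k%:R * (m%:R * theta) + theta)) theta
    nu (fun=> 0).
  by rewrite -[X in impulsive_flow _ X]add0r; exact: (impulsive_flow_translate _ _ _ _ _ _ shiftJ ellf).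
have x_at j : x (j%:R * theta) = Zx j theta by exact: glue_end.
have xi_at j : xi (j%:R * theta) = Zxi j theta by exact: glue_end.
have ell_at j : ell (j%:R * theta) = Zell j 0 by exact: glue_end.
have xij k : jumps_to xi (k%:R * (m%:R * theta)) (xi (k%:R * (m%:R * theta)) +
    gE P (x (k%:R * (m%:R * theta))) (xi (k%:R * (m%:R * theta))) (ell (k%:R * (m%:R * theta)))).
  rewrite tE x_at xi_at ell_at; have := glue_jump theta theta0 Zxi (k * m) (Zxi_cont _).
  by rewrite Zxi_start dvdn_mull.
have ellj k : jumps_to ell (k%:R * (m%:R * theta)) (Lam *m ell (k%:R * (m%:R * theta))).
  rewrite tE ell_at.
  have Zell_cont : continuous (Zell (k * m).+1) by move=> r; exact: cvg_cst.
  have := glue_jump theta theta0 Zell (k * m) Zell_cont.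
  by rewrite ZellE dvdn_mull.
have psij k : jumps_to psi (k%:R * (m%:R * theta) + theta)
    (psi (k%:R * (m%:R * theta) + theta) +
     gE P (x (k%:R * (m%:R * theta))) (xi (k%:R * (m%:R * theta))) (ell (k%:R * (m%:R * theta)))).
  rewrite {2}/psi addrK; apply: cvg_at_right_translate; rewrite addrK; exact: xij.
have psij' k : jumps_to psi (k%:R * (m%:R * theta) + theta)
    (psi (k%:R * (m%:R * theta) + theta) +
     gD P (symbol P (x (k%:R * (m%:R * theta))) (xi (k%:R * (m%:R * theta))))
       (nu (k%:R * (m%:R * theta) + theta))).
  by rewrite /nu addrK; exact: psij.
have nuj k : jumps_to nu (k%:R * (m%:R * theta) + theta)
    (Lam *m nu (k%:R * (m%:R * theta) + theta)).
  rewrite {2}/nu addrK; apply: cvg_at_right_translate; rewrite addrK; exact: ellj.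
have zero s : s <= theta -> psi s = 0.
  by move=> st; rewrite /psi /xi glue_neg// subr_le0.
have T0 : 0%:R * (m%:R * theta) = 0%:R * theta by rewrite !mul0r.
exists X; last by rewrite /= T0 x_at.
split => /=.
- split; rewrite mul0r //.
  have := glue_jump theta theta0 Zx 0 (Zx_cont 0).
  by rewrite Zx_start -x_at mul0r.
- split.
  + by rewrite /= mul0r add0r; exact: psif.
  + by rewrite /= mul0r; exact: xif.
  + by rewrite /= mul0r; exact: ellf.
  + exact: psij.
  + by move=> k; split; [exact: xij|exact: ellj].
- split.
  + by rewrite /= mul0r add0r; exact: psif.
  + by rewrite /= mul0r add0r; exact: nuf.
  + by move=> k; split; [exact: psij'|exact: nuj].
- split => /=.
  + by move=> i; rewrite T0 x_at.
  + by move=> s; rewrite !mul0r add0r => /andP[_ st]; rewrite zero.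
  + by rewrite T0 xi_at.
  + by rewrite T0 ell_at.
  + by rewrite /nu addrK T0 ell_at.
Qed.

End Existence.

(** * Norms of the full state and the data rate *)

Section StateNorm.
Context {R : realType}.

Lemma le_enorm m (v : 'cV[R]_m) (i : 'I_m) : `|v i 0| <= enorm v.
Proof.
rewrite -sqrtr_sqr /enorm; apply: ler_wsqrtr.
by rewrite (bigD1 i)//= lerDl sumr_ge0// => j _; rewrite sqr_ge0.
Qed.

Lemma enorm_le m (v : 'cV[R]_m) (c : R) : 0 <= c -> (forall i, `|v i 0| <= c) ->
  enorm v <= m%:R * c.
Proof.
move=> c0 vc; rewrite -[leRHS]ger0_norm ?mulr_ge0// -sqrtr_sqr /enorm.
apply: ler_wsqrtr; apply: le_trans (_ : \sum_(i < m) c ^+ 2 <= _).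
  by apply: ler_sum => i _; rewrite -real_normK ?num_real// lerXn2r ?nnegrE.
rewrite sumr_const card_ord -[leLHS]mulr_natl exprMn ler_wpM2r ?sqr_ge0//.
by rewrite -natrX ler_nat; case: m {v vc} => // m; rewrite expnS expn1 leq_pmulr.
Qed.

Lemma col_mx_le m1 m2 (u : 'cV[R]_m1) (v : 'cV[R]_m2) (c : R) :
  (forall i, `|u i 0| <= c) -> (forall i, `|v i 0| <= c) ->
  forall i, `|col_mx u v i 0| <= c.
Proof. by move=> uc vc i; rewrite mxE; case: splitP => j _. Qed.

Lemma state_le n (X : signals R n) (s c : R) :
  (forall j, [/\ `|sx X s j 0| <= c, `|somega X s j 0| <= c & `|sxi X s j 0| <= c]) ->
  (forall j, [/\ `|sell X s j 0| <= c, `|spsi X s j 0| <= c & `|snu X s j 0| <= c]) ->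
  forall i, `|state X s i 0| <= c.
Proof.
move=> H1 H2; rewrite /state.
by do ![apply: col_mx_le] => j; [case: (H1 j)|case: (H1 j)|case: (H1 j)|
  case: (H2 j)|case: (H2 j)|case: (H2 j)].
Qed.

Lemma state_entries n (X : signals R n) (s : R) (j : 'I_n) :
  [/\ `|sx X s j 0| <= enorm (state X s), `|sxi X s j 0| <= enorm (state X s)
    & `|sell X s j 0| <= enorm (state X s)].
Proof.
have H := le_enorm _ (state X s); split.
- by have := H (lshift _ j); rewrite /state col_mxEu.
- by have := H (rshift n (rshift n (lshift _ j))); rewrite /state !col_mxEd col_mxEu.
- by have := H (rshift n (rshift n (rshift n (lshift _ j)))); rewrite /state !col_mxEd col_mxEu.
Qed.

(** For k >= 1 the k-th term is 2 n (k + 1) / (k d) <= 4 n / d. *)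
Lemma average_data_rate_le n (d : R) : 0 < d ->
  (average_data_rate n (fun k : nat => k%:R * d)%R <= (4 * n%:R / d)%R%:E)%E.
Proof.
move=> d0; rewrite /average_data_rate; set u := (X in limn_esup X); rewrite /limn_esup /limf_esup.
apply: (@le_trans _ _ (ereal_sup (u @` [set k | (1 <= k)%N]))).
  apply: ereal_inf_lbound; exists [set k : nat | (1 <= k)%N] => //.
  by exists 1%N.
apply: ub_ereal_sup => _ [k /= k1 <-]; rewrite lee_fin.
rewrite sumr_const card_ord mul0r subr0 /packet_bits natrM -[leLHS]mulr_natl.
have k0 : 1 <= k%:R :> R by rewrite ler1n.
have kd : 0 < k%:R * d by rewrite mulr_gt0// (lt_le_trans _ k0).
rewrite mulrA ler_pdivrMr// -natr1.
have -> : 4 * n%:R / d * (k%:R * d) = 4 * n%:R * k%:R by field; rewrite gt_eqF.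
have : 0 <= n%:R * (k%:R - 1) :> R by rewrite mulr_ge0// subr_ge0.
by lra.
Qed.

End StateNorm.

(** * Choice of the constants and estimates for the original state *)

Theorem theorem1 (R : realType) (n : nat) (n_ge1 : (1 <= n)%N)
  (h : forall i : nat, 'cV[R]_(n - i.+1) -> R)
  (h_C2 : forall i : nat, (i.+1 < n)%N -> class_C 2 (h i))
  (M : R) (M_gt0 : 0 < M)
  (h_bound : forall i : nat, (i.+1 < n)%N ->
     forall v : 'cV[R]_(n - i.+1), `|v| <= 1 -> `|h i v| <= M * enorm v ^+ 2)
  (sigma : R -> R) (sigma_sat : is_saturation sigma)
  (lbar : 'cV[R]_n) (lbar_ge0 : forall i, 0 <= lbar i 0)
  (theta : R) (theta_gt0 : 0 < theta)
  (Rhat : R) (Rhat_gt0 : 0 < Rhat)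
  (eps : nat -> R) (kappa L : R)
  (eps_eq : forall i : nat, (i < n)%N -> 1 = 30 ^+ (n - i) * eps i)
  (kappa_ge1 : 1 <= kappa)
  (kappa_ge : theta * Num.max
       (6 * 30 ^+ n.+1 * n%:R * (n%:R + 1))
       (8 * n%:R ^+ 2 * (8 * n%:R * (1 + n%:R ^+ 2) ^+ n.-1 + 1) ^+ 2)
     <= kappa)
  (L_gt0 : 0 < L)
  (L_le : L <= Num.min
       (Num.min
          (kappa / (20 * 30 ^+ n * n%:R ^+ 4 * n`!%:R ^+ 3))
          (kappa / (8 * (1 + n%:R ^+ 2) ^+ n.-1 * Num.sqrt n%:R
                      * n%:R ^+ 3 * n`!%:R ^+ 3)))
       (Num.min (M * kappa / (n.+1)`!%:R) M)) :
  exists (Lam : 'M[R]_n) (t : nat -> R),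
    let loop := closed_loop (feedforward h) (alpha sigma eps M L kappa)
                  (Phi n M L kappa) Lam theta t lbar in
    [/\ schur_stable Lam,
        increasing_seq t,
        (exists Tm TM : R, [/\ 0 < Tm, 0 < TM &
           forall k, Tm <= t k.+1 - t k <= TM]),
        (forall x0 : 'cV[R]_n, (forall i, `|x0 i 0| <= lbar i 0) ->
           exists2 X : signals R n, loop X & sx X (t 0%N) = x0) &
        [/\ (exists (C : set 'cV[R]_(n + (n + (n + (n + (n + n)))))) (T : R),
               [/\ [/\ compact C, C 0, 0 < T & t 0%N + 3 * theta <= T],
                   (forall X, loop X -> forall s : R, T <= s -> C (state X s)) &
                   (exists k delta : R, [/\ 0 < k, 0 < delta &
                      forall X, loop X -> forall s : R, T <= s ->
                        enorm (state X s) <=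
                        k * history_norm theta X T
                          * expR (- (delta * (s - T)))])]) &
            (average_data_rate n t < Rhat%:E)%E]].
Proof.
have n0 : (0 < n)%N by [].
have k0 : 0 < kappa by exact: lt_le_trans kappa_ge1.
have n1 : 1 <= n%:R :> R by rewrite ler1n.
have p30 j : 0 < 30 ^+ j :> R by rewrite exprn_gt0.
have epsE i : (i < n)%N -> eps i = 1 / 30 ^+ (n - i).
  move=> /eps_eq e; have p0 : 30 ^+ (n - i) != 0 :> R by rewrite gt_eqF.
  by apply: (mulfI p0); rewrite -e mul1r divff.
have eps_gt0 i : (i < n)%N -> 0 < eps i by move=> ltin; rewrite epsE// divr_gt0.
have eps_step i : (i.+1 < n)%N -> eps i.+1 = 30 * eps i.
  move=> i1n; rewrite !epsE ?(ltnW i1n)//.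
  have -> : (n - i = (n - i.+1).+1)%N by rewrite -subSn ?subSS// ltnW.
  by rewrite exprS; field; rewrite gt_eqF.
have eps_top i : (i < n)%N -> eps i <= 1 / 30.
  move=> ltin; rewrite epsE// ler_pM2l// lef_pV2 ?posrE//.
  by rewrite -[leLHS]expr1 ler_weXn2l ?ler1n// subn_gt0.
have eps_bot i : (i < n)%N -> eps 0%N <= eps i.
  move=> ltin; rewrite !epsE// ler_pM2l// lef_pV2 ?posrE//.
  by rewrite ler_weXn2l ?ler1n// subn0 leq_subr.
have eps0E : eps 0%N = 1 / 30 ^+ n by rewrite epsE// subn0.
have ka : theta * (6 * 30 ^+ n.+1 * n%:R * (n%:R + 1)) <= kappa.
  by apply: le_trans kappa_ge; rewrite ler_pM2l// le_max lexx.
(* The first term of the maximum, with 180 = 6 * 30 and eps_0 = 30^-n. *)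
have small_delay : 180 * (n%:R * (n%:R + 1)) * theta <= kappa * eps 0%N.
  rewrite eps0E div1r ler_pdivlMr//; apply: le_trans ka.
  by rewrite exprS le_eqVlt; apply/orP; left; apply/eqP; ring.
have eps_pow : 3 ^+ n * eps 0%N <= 1 / 10.
  rewrite eps0E div1r -expr_div_n.
  have -> : 3 / 30 = 1 / 10 :> R by field.
  by rewrite -[leRHS]expr1 ler_wiXn2l//; clear; lra.
move: L_le; rewrite !le_min => /andP[/andP[Ls _] /andP[Ls' _]].
have [Lip [Lip0 LipP]] := nonlinearity_lipschitz n h M L kappa M_gt0 L_gt0 kappa_ge1 h_C2.
have Lip2_ge0 i B : 0 <= Lip_affine Lip (n := n) i B.
  by rewrite /Lip_affine mulr_ge0// addr_ge0// mulr_ge0.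
pose ell0 := 2 *: (Phi n M L kappa *m lbar).
pose A := \sum_i ell0 i 0.
have A0 : 0 <= A.
  rewrite sumr_ge0// => i _; rewrite mxE -pcoord_Phi mulr_ge0// pcoord_sum sumr_ge0// => j _.
  by apply: mulr_ge0 => //; exact: pweight_ge0.
(* The number of delays per sampling period is fixed by the rate alone, before F and Lambda. *)
pose m := (Num.truncn (4 * n%:R / Rhat / theta)).+1.
have m0 : (0 < m)%N by [].
have m_large : 4 * n%:R / (m%:R * theta) < Rhat.
  have : 4 * n%:R / Rhat / theta < m%:R.
    have q0 : 0 <= 4 * n%:R / Rhat / theta by rewrite !divr_ge0 ?mulr_ge0// ltW.
    by case/andP: (truncn_itv q0).
  rewrite ltr_pdivrMr// ltr_pdivrMr// => lt.
  by rewrite ltr_pdivrMr ?mulr_gt0 ?ltr0n// [Rhat * _]mulrC.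
have D0 : 0 < m%:R * theta by rewrite mulr_gt0// ltr0n.
have [F [B [K [T [dl [[F0 B0 K0 dl0 Tth] HF]]]]]] :=
  reduced_stability n m theta kappa sigma eps (Lip_affine (n := n) Lip) A n0 m0 theta_gt0 k0
    sigma_sat eps_gt0 eps_step eps_top eps_bot small_delay eps_pow Lip2_ge0 A0.
have hc i : (i.+1 < n)%N -> continuous (h i) by move=> /h_C2[].
have ac := continuous_alpha (n := n) M L kappa sigma eps sigma_sat.
exists (range_matrix n (fun i => m%:R * theta * F i)), (fun k : nat => k%:R * (m%:R * theta)) => loop.
(* [W] and [W2] bound Phi^-1 and Phi in the max norm; they translate the estimates between the two
   coordinate systems. *)
pose W : R := \sum_j \sum_k `|invmx (Phi n M L kappa) j k|.
have W0 : 0 <= W by rewrite sumr_ge0// => j _; rewrite sumr_ge0.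
have entryW (v : 'cV[R]_n) c : 0 <= c ->
    (forall i, (i < n)%N -> `|pcoord n M L kappa v i| <= c) -> forall j, `|v j 0| <= W * c.
  move=> c0 vc j; apply: le_trans (entry_le M L kappa M_gt0 L_gt0 k0 v c c0 vc j) _.
  rewrite ler_wpM2r// /W [leRHS](bigD1 j)//= lerDl sumr_ge0// => i _; exact: sumr_ge0.
pose W2 : R := \sum_(i < n) \sum_j pweight (n := n) M L kappa i j.
have W20 : 0 <= W2.
  by rewrite sumr_ge0// => i _; rewrite sumr_ge0// => j _; rewrite pweight_ge0.
have pcoordW (v : 'cV[R]_n) c i : 0 <= c -> (forall j, `|v j 0| <= c) -> (i < n)%N ->
    `|pcoord n M L kappa v i| <= W2 * c.
  move=> c0 vc ltin.
  apply: le_trans (pcoord_norm_le M L kappa M_gt0 L_gt0 k0 v (const_mx c) i _) _.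
    by move=> j; rewrite mxE.
  rewrite pcoord_sum; under eq_bigr do rewrite mxE.
  rewrite -mulr_suml ler_wpM2r// /W2 [leRHS](bigD1 (Ordinal ltin))//= lerDl sumr_ge0// => k _.
  by rewrite sumr_ge0// => j _; rewrite pweight_ge0.
have red X : loop X -> _ := fun lX => HF _ _ _ _ _ (reduced_loop_of_closed_loop h M L kappa sigma
  eps theta m lbar Lip n0 M_gt0 L_gt0 kappa_ge1 h_C2 h_bound Ls Ls' sigma_sat eps0E theta_gt0 m0
  lbar_ge0 LipP F X lX Lip0).
pose en (k : nat) (j : nat) : R :=
  entry n (iter k (mulmx (range_matrix n (fun i => m%:R * theta * F i))) ell0) j.
have bounded X (s : R) : loop X -> 0 <= s ->
    [/\ forall j, `|sx X s j 0| <= W * B, forall j, `|sxi X s j 0| <= W * B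
      & forall j, `|sell X s j 0| <= B].
  move=> lX s0; have [bd _] := red X lX; split.
  - by apply: entryW => // i ltin; have [] := bd i s ltin s0.
  - by apply: entryW => // i ltin; have [] := bd i s ltin s0.
  - move=> j; rewrite (ellE h _ _ _ theta m lbar X theta_gt0 m0 lX s s0) -entryE.
    have [_ _ /andP[L0 L1]] := bd j s (ltn_ord j) s0.
    by rewrite ger0_norm.
have sec X (s : R) : loop X -> theta <= s ->
    [/\ somega X s = sxi X (s - theta), spsi X s = sxi X (s - theta) & snu X s = sell X (s - theta)].
  move=> lX ts; have [-> ->] := omega_psi_xi h _ _ _ theta m lbar X hc ac theta_gt0 m0 lX s ts.
  rewrite (nuE h _ _ _ theta m lbar X theta_gt0 m0 lX s ts).
  by rewrite (ellE h _ _ _ theta m lbar X theta_gt0 m0 lX) ?subr_ge0.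
pose B1 := W * B + B.
have B10 : 0 <= B1 by rewrite addr_ge0// mulr_ge0.
have bounded_state X (s : R) : loop X -> theta <= s -> forall i, `|state X s i 0| <= B1.
  move=> lX ts; have s0 : 0 <= s by apply: le_trans ts; exact: ltW.
  have [xB xiB lB] := bounded X s lX s0.
  have st0 : 0 <= s - theta by rewrite subr_ge0.
  have [_ xiB' lB'] := bounded X (s - theta) lX st0.
  have [e1 e2 e3] := sec X s lX ts.
  have WB : W * B <= B1 by rewrite lerDl.
  have BB : B <= B1 by rewrite lerDr mulr_ge0.
  apply: state_le => j; rewrite ?e1 ?e2 ?e3; split;
    by [apply: le_trans WB|apply: le_trans BB].
split.
- exact: range_matrix_schur.
- by move=> i j; rewrite ler_pM2r// ler_nat.
- exists (m%:R * theta), (m%:R * theta); split => // k.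
  by rewrite -natr1 mulrDl mul1r addrAC subrr add0r lexx.
- move=> x0 x0l.
  exact: (closed_loop_exists h _ _ _ theta m lbar x0 hc ac theta_gt0 x0l).
split; last first.
  by apply: le_lt_trans (average_data_rate_le n _ D0) _; rewrite lte_fin.
exists [set v | forall i, `|v i 0| <= B1], T; split.
- split; [exact: compact_box|by move=> i; rewrite mxE normr0| |].
    by apply: lt_le_trans Tth; rewrite mulr_gt0.
  by rewrite mul0r add0r; apply: le_trans Tth; rewrite ler_pM2r// ler_nat.
- move=> X lX s Ts; apply: bounded_state => //; apply: le_trans Ts; apply: le_trans Tth.
  by rewrite ler_peMl ?ler1n// ltW.
(* At time s, omega, psi and nu are values of xi and ell at s - theta, and [d] makes up for the
   decay over that delay. The three summands of [c] below serve x and xi, then ell, then times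
   before T. *)
pose d := expR (dl * theta).
have d1 : 1 <= d by rewrite /d -expR0 ler_expR mulr_ge0// ltW.
pose c := d * (W * (K * (W2 + 1)) + K * (W2 + 1) + 1).
have c0 : 0 <= c.
  by rewrite /c mulr_ge0 ?(le_trans ler01 d1)// !addr_ge0// !mulr_ge0// addr_ge0.
set dim := (n + (n + (n + (n + (n + n)))))%N.
exists (dim%:R * c + 1), dl; split => //; first by rewrite ltr_wpDl// mulr_ge0.
move=> X lX s Ts.
set N := history_norm theta X T.
have th2 : 0 <= 2 * theta by rewrite mulr_ge0// ltW.
have histN r : T - 2 * theta <= r <= T -> enorm (state X r) <= N.
  (* The supremum bounds its set because the state is bounded on the window, which lies beyond theta
     since T >= 4 theta. *)
  move=> /andP[r1 r2]; apply: ub_le_sup.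
    exists (dim%:R * B1) => _ [q /= + <-]; rewrite in_itv/= => /andP[q1 q2].
    apply: enorm_le => //; apply: bounded_state => //.
    by move: Tth (ltW theta_gt0) q1; clear; lra.
  exists (r - T); last by rewrite /= addrC subrK.
  by rewrite /= in_itv/=; move: r1 r2; clear => r1 r2; apply/andP; split; lra.
have TT : T - 2 * theta <= T <= T by rewrite lexx andbT gerBl.
have N0 : 0 <= N by apply: le_trans (histN T TT); exact: sqrtr_ge0.
have hist r : T - 2 * theta <= r <= T -> forall j,
    [/\ `|sx X r j 0| <= N, `|sxi X r j 0| <= N & `|sell X r j 0| <= N].
  move=> rT j; have [h1 h2 h3] := state_entries n X r j; have h4 := histN r rT.
  by split; [exact: le_trans h4|exact: le_trans h4|exact: le_trans h4].
have [_ dec] := red X lX.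
(* W2 N bounds the p-coordinates of x and xi; the extra N is for ell, whose entries are the ranges
   themselves. *)
pose N' := (W2 + 1) * N.
have N'0 : 0 <= N' by rewrite mulr_ge0// addr_ge0.
have N'W : W2 * N <= N' by rewrite /N' mulrDl lerDl mul1r.
have N'N : N <= N' by rewrite /N' mulrDl mul1r lerDr mulr_ge0.
have {}dec := dec N' N'0.
have {}dec : forall j r, (j < n)%N -> T <= r ->
  [/\ `|pcoord n M L kappa (sx X r) j| <= K * N' * expR (- (dl * (r - T))),
      `|pcoord n M L kappa (sxi X r) j| <= K * N' * expR (- (dl * (r - T))) &
      en (gridn (m%:R * theta) r) j <= K * N' * expR (- (dl * (r - T)))].
  apply: dec => j r jn rT; have hr := hist r rT.
  have r0 : 0 <= r by case/andP: rT; move: Tth (ltW theta_gt0); clear; lra.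
  split.
  - by apply: le_trans N'W; apply: pcoordW => // k; have [] := hr k.
  - by apply: le_trans N'W; apply: pcoordW => // k; have [] := hr k.
  - have [_ _ h3] := hr (Ordinal jn); apply: le_trans N'N; apply: le_trans h3.
    rewrite (ellE h _ _ _ theta m lbar X theta_gt0 m0 lX r r0) -entryE; exact: ler_norm.
have KN0 : 0 <= K * N' by exact: mulr_ge0.
have decay r : T <= r -> forall j,
    [/\ `|sx X r j 0| <= W * (K * N') * expR (- (dl * (r - T))),
        `|sxi X r j 0| <= W * (K * N') * expR (- (dl * (r - T))) &
        `|sell X r j 0| <= K * N' * expR (- (dl * (r - T)))].
  move=> Tr j.
  have r0 : 0 <= r by move: Tth (ltW theta_gt0) Tr; clear; lra.
  have KE : 0 <= K * N' * expR (- (dl * (r - T))) by rewrite mulr_ge0// expR_ge0.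
  rewrite -mulrA; split.
  - by apply: entryW => // i ltin; have [] := dec i r ltin Tr.
  - by apply: entryW => // i ltin; have [] := dec i r ltin Tr.
  - have [_ _ +] := dec j r (ltn_ord j) Tr; have [bd _] := red X lX.
    have [_ _ /andP[L0 _]] := bd j r (ltn_ord j) r0.
    by rewrite (ellE h _ _ _ theta m lbar X theta_gt0 m0 lX r r0) -entryE ger0_norm.
set E := expR (- (dl * (s - T))).
have E0 : 0 <= E by exact: expR_ge0.
have Nc0 : 0 <= c * N * E by apply: mulr_ge0 => //; exact: mulr_ge0.
have cE a r : 0 <= a -> s - theta <= r -> a * expR (- (dl * (r - T))) <= d * a * E.
  move=> a0 sr; rewrite [d * a]mulrC -mulrA ler_wpM2l// /d /E -expRD ler_expR.
  have : dl * (s - theta) <= dl * r by rewrite ler_pM2l.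
  by clear; lra.
have big1 : d * (W * (K * N')) * E <= c * N * E.
  rewrite ler_wpM2r// /N' /c.
  have -> : d * (W * (K * ((W2 + 1) * N))) = d * (W * (K * (W2 + 1))) * N by ring.
  rewrite ler_wpM2r// ler_pM2l ?(lt_le_trans ltr01)//.
  by rewrite -addrA lerDl addr_ge0// mulr_ge0// addr_ge0.
have big2 : d * (K * N') * E <= c * N * E.
  rewrite ler_wpM2r// /N' /c.
  have -> : d * (K * ((W2 + 1) * N)) = d * (K * (W2 + 1)) * N by ring.
  rewrite ler_wpM2r// ler_pM2l ?(lt_le_trans ltr01)//.
  by rewrite addrAC lerDr addr_ge0// !mulr_ge0// addr_ge0.
have big3 : d * N * E <= c * N * E.
  rewrite ler_wpM2r// ler_wpM2r// /c ler_peMr ?(le_trans ler01 d1)//.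
  by rewrite lerDr addr_ge0// !mulr_ge0// addr_ge0.
(* When s < T + theta the delayed time s - theta precedes T, where only the history bound N is
   available. *)
have near_T r j : s - theta <= r -> T - theta <= r ->
    `|sxi X r j 0| <= c * N * E /\ `|sell X r j 0| <= c * N * E.
  move=> sr Tr; have [Tr'|/ltW rT] := leP T r.
    have [_ h2 h3] := decay r Tr' j; split.
      by apply: le_trans h2 _; apply: le_trans big1; apply: cE => //; rewrite mulr_ge0.
    by apply: le_trans h3 _; apply: le_trans big2; apply: cE.
  have rT2 : T - 2 * theta <= r <= T.
    by rewrite rT andbT; move: Tr (ltW theta_gt0); clear; lra.
  have NE : N <= c * N * E.
    apply: le_trans big3; apply: le_trans (cE N r N0 sr).
    by rewrite ler_peMr// -expR0 ler_expR oppr_ge0 mulr_ge0_le0 ?subr_le0// ltW.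
  have [_ h2 h3] := hist r rT2 j.
  by split; [exact: le_trans NE|exact: le_trans NE].
have th0 : 0 <= theta by exact: ltW.
have ts : theta <= s by move: Tth th0 Ts; clear; lra.
have [e1 e2 e3] := sec X s lX ts.
have [s1 s2] : s - theta <= s /\ T - theta <= s - theta.
  by move: th0 Ts; clear; split; lra.
have xs j : `|sx X s j 0| <= c * N * E.
  have [h1 _ _] := decay s Ts j; apply: le_trans h1 _; apply: le_trans big1.
  by apply: cE => //; rewrite mulr_ge0.
have all_le i : `|state X s i 0| <= c * N * E.
  apply: state_le => j; rewrite ?e1 ?e2 ?e3.
    by split => //; [case: (near_T (s - theta) j)|case: (near_T s j s1 (le_trans s2 s1))].
  by split; [case: (near_T s j s1 (le_trans s2 s1))|case: (near_T (s - theta) j)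
            |case: (near_T (s - theta) j)].
apply: le_trans (enorm_le _ _ _ Nc0 all_le) _.
rewrite !mulrA -[leLHS]mulrA -[leRHS]mulrA ler_wpM2r ?mulr_ge0//.
by rewrite lerDl.
Qed.
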